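(* Let $(\mathcal M,\mathbf g,\mathbf F)$ be an electrostatic spherically symmetric spacetime with charge $Q\in\mathbb R\setminus\{0\}$ and ADM mass $M\in\mathbb R$ for an admissible reduced Hamiltonian $\zeta$. Suppose that the bare mass $m_0=\lim_{r\downarrow0}m(r)$ of the central singularity is negative, $m_0<0$, and that the singularity at the center is naked (there is no horizon), i.e. $1-\frac{2\mathsf G\,m(r)}{c^2r}>0$ for all $r>0$. Then the twice-contracted second Bianchi identity holds weakly on $\mathcal M$.
   Context: $\mathsf G>0$ (Newton's constant) and $c>0$ (speed of light) are fixed constants. Admissible reduced Hamiltonian: a function $\zeta:[0,\infty)\to\mathbb R$ (with derivatives $\zeta',\zeta''$ on $(0,\infty)$) satisfying (R1) $\lim_{\mu\to0}\zeta(\mu)/\mu=1$; (R2) $\zeta'(\mu)>0$ and $\zeta(\mu)-\mu\zeta'(\mu)\ge0$ for all $\mu>0$; (R3) $\zeta'(\mu)+2\mu\zeta''(\mu)\ge0$ for all $\mu>0$; (R4) $I_\zeta=2^{-11/4}\int_0^\infty y^{-7/4}\zeta(y)\,dy<\infty$; (R5) there are constants $J_\zeta,K_\zeta,L_\zeta>0$ with $J_\zeta\sqrt\mu-K_\zeta\le\zeta(\mu)\le J_\zeta\sqrt\mu$ and $J_\zeta\sqrt\mu-2L_\zeta\le2\zeta'(\mu)\mu\le J_\zeta\sqrt\mu$ (for all $\mu\ge 0$, resp. $\mu>0$). Electrostatic spherically symmetric spacetime for $\zeta$ with charge $Q$ and ADM mass $M$: the static spherically symmetric spacetime with metric $$ds_{\mathbf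 g}^2=-e^{2\alpha(r)}c^2dt^2+e^{-2\alpha(r)}dr^2+r^2(d\vartheta^2+\sin^2\vartheta\,d\varphi^2),\quad e^{2\alpha(r)}=1-\frac{2\mathsf G m(r)}{c^2r},$$ where the cumulative mass function is $m(r)=M-\frac1{c^2}\int_r^\infty\zeta\big(\tfrac{Q^2}{2s^4}\big)s^2\,ds$, and with electromagnetic field $\mathbf F=d\mathbf A$, $\mathbf A=\Big(Q\int_r^\infty\zeta'\big(\tfrac{Q^2}{2s^4}\big)\tfrac{1}{s^2}\,ds\Big)c\,dt$. The function $\alpha$ is smooth for $r>0$. Without horizon, $t\in\mathbb R$, $r\in(0,\infty)$ are global coordinates. Spatially conformally flat coordinates: fix $\rho_0>0$ and set $\rho(r)=\rho_0\exp\Big(\int_0^r\frac{dr'}{\sqrt{r'^2-\frac{2\mathsf G}{c^2}r'm(r')}}\Big)$. In coordinates $(t,\rho,\vartheta,\varphi)$, $\rho\in(\rho_0,\infty)$, the metric is $-e^{2\gamma(\rho)}c^2dt^2+\phi^4(\rho)[d\rho^2+\rho^2(d\vartheta^2+\sin^2\vartheta\,d\varphi^2)]$ with $\phi=\sqrt{r/\rho}$ and $\gamma(\rho)=\alpha(r(\rho))$, so $\mathcal M\cong\mathbb R\times(\mathbb R^3\setminus\overline{B_{\rho_0}(0)})$; put $\overline{\mathcal M}\cong\mathbb R\times(\mathbb R^3\setminus B_{\rho_0}(0))$. Weak Bianchi identity: the twice-contracted second Bianchi identity holds weakly on $\mathcal M$ if for every vector field $\psi$ that is smooth on $\overline{\mathcal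 M}$ (up to and including the boundary, in the coordinates built from $\rho$) and compactly supported in $\overline{\mathcal M}$, the integral $\int_{\mathcal M}G^\mu{}_\nu\nabla_\mu\psi^\nu\,d\mathrm{vol}_{\mathbf g}$ exists and equals $\lim_{\varepsilon\to0}\int_{\mathcal T_\varepsilon}i_X(d\mathrm{vol}_{\mathbf g})$, and both equal $0$. Here $G^\mu{}_\nu=R^\mu{}_\nu-\frac12R\,\delta^\mu{}_\nu$ is the Einstein tensor, $X^\mu=G^\mu{}_\nu\psi^\nu$, $i_X$ is the interior product, and $\mathcal T_\varepsilon\cong\mathbb R\times\partial B_{\rho_0+\varepsilon}(0)$ is oriented as the boundary of $\mathbb R\times(\mathbb R^3\setminus\overline{B_{\rho_0+\varepsilon}(0)})$. *)

(* Defs.v *)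
From HB Require Import structures.
From mathcomp Require Import all_boot all_order all_algebra.
From mathcomp Require Import all_classical all_reals all_analysis.

Set Implicit Arguments.
Unset Strict Implicit.
Unset Printing Implicit Defensive.

Import Order.TTheory GRing.Theory Num.Theory.
Import numFieldNormedType.Exports.

Local Open Scope classical_set_scope.
Local Open Scope ring_scope.

(* [NG] is Newton's constant and [c] the speed of light. The curvature is
   computed in a global chart of the spacetime, see [chart_point]. *)

Definition I_zeta (R : realType) (zeta : R -> R) : \bar R :=
  ((2 `^ (- (11 / 4)))%R%:E *
   \int[lebesgue_measure]_(y in [set y : R | (0 < y)%R])
     (y `^ (- (7 / 4)) * zeta y)%R%:E)%E.

(* Only the values of [zeta] on [0, +oo) matter. *)
Record admissible (R : realType) (zeta : R -> R) : Prop := Admissible {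
  adm_derivable : forall mu : R, 0 < mu -> derivable zeta mu 1;
  adm_derivable2 : forall mu : R, 0 < mu -> derivable (derive1 zeta) mu 1;
  adm_R1 : zeta mu / mu @[mu --> 0^'+] --> (1 : R);
  adm_R2 : forall mu : R, 0 < mu ->
    0 < derive1 zeta mu /\ 0 <= zeta mu - mu * derive1 zeta mu;
  adm_R3 : forall mu : R, 0 < mu ->
    0 <= derive1 zeta mu + 2 * mu * derive1n 2 zeta mu;
  adm_R4 : (I_zeta zeta < +oo)%E;
  adm_R5 : exists J K L : R, [/\ 0 < J, 0 < K, 0 < L,
    (forall mu : R, 0 <= mu ->
       J * Num.sqrt mu - K <= zeta mu <= J * Num.sqrt mu) &
    (forall mu : R, 0 < mu ->
       J * Num.sqrt mu - 2 * L <= 2 * derive1 zeta mu * mu <= J * Num.sqrt mu)] }.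

Definition mass (R : realType) (c : R) (zeta : R -> R) (Q M r : R) : R :=
  M - c ^- 2 * \int[lebesgue_measure]_(s in `]r, +oo[)
                 (zeta (Q ^+ 2 / (2 * s ^+ 4)) * s ^+ 2).

Definition potential (R : realType) (zeta : R -> R) (Q r : R) : R :=
  Q * \int[lebesgue_measure]_(s in `]r, +oo[)
        (derive1 zeta (Q ^+ 2 / (2 * s ^+ 4)) / s ^+ 2).

Definition exp2alpha (R : realType) (NG c : R) (zeta : R -> R) (Q M r : R) : R :=
  1 - 2 * NG * mass c zeta Q M r / (c ^+ 2 * r).

Definition alpha (R : realType) (NG c : R) (zeta : R -> R) (Q M r : R) : R :=
  ln (exp2alpha NG c zeta Q M r) / 2.

Definition iso_radius (R : realType) (NG c : R) (zeta : R -> R)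
    (Q M rho0 r : R) : R :=
  rho0 * expR (\int[lebesgue_measure]_(s in `]0, r[)
    (Num.sqrt (s ^+ 2 - 2 * NG / c ^+ 2 * s * mass c zeta Q M s))^-1).

(* The inverse function rho |-> r(rho), defined by choice. In the absence of
   horizon and for negative bare mass, [iso_radius] is a bijection from
   (0, +oo) to (rho0, +oo), so that the choice is unique for rho0 < rho. *)
Definition area_radius (R : realType) (NG c : R) (zeta : R -> R)
    (Q M rho0 rho : R) : R :=
  xget 0 [set r : R | 0 < r /\ iso_radius NG c zeta Q M rho0 r = rho].

Definition gamma (R : realType) (NG c : R) (zeta : R -> R)
    (Q M rho0 rho : R) : R :=
  alpha NG c zeta Q M (area_radius NG c zeta Q M rho0 rho).

Definition conf_factor (R : realType) (NG c : R) (zeta : R -> R)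
    (Q M rho0 rho : R) : R :=
  Num.sqrt (area_radius NG c zeta Q M rho0 rho / rho).

(* A point is (t, x1, x2, x3) with x1, x2, x3 the Cartesian coordinates of the
   spatial point with spherical coordinates (rho, theta, phi). This is a global
   chart, in which d rho^2 + rho^2 d Omega^2 = dx1^2 + dx2^2 + dx3^2. Index 0 is
   the time index. *)

Definition chart_point (R : realType) (t x1 x2 x3 : R) : 'rV[R]_4 :=
  \row_(i < 4) nth 0 [:: t; x1; x2; x3] i.

Definition space_norm (R : realType) (x : 'rV[R]_4) : R :=
  Num.sqrt (\sum_(i < 4 | i != 0) x 0 i ^+ 2).

Definition exterior (R : realType) (rho0 : R) : set 'rV[R]_4 :=
  [set x | rho0 < space_norm x].

Definition exteriorbar (R : realType) (rho0 : R) : set 'rV[R]_4 :=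
  [set x | rho0 <= space_norm x].

Definition partial (R : realType) (V : normedModType R) (i : 'I_4)
    (f : 'rV[R]_4 -> V) : 'rV[R]_4 -> V :=
  fun x => 'D_(delta_mx 0 i) f x.

(* C^infinity on [U]: all iterated partial derivatives exist and are
   continuous. *)
Definition smooth_on (R : realType) (V : normedModType R)
    (U : set 'rV[R]_4) (f : 'rV[R]_4 -> V) : Prop :=
  forall (s : seq 'I_4) (x : 'rV[R]_4), U x ->
    {for x, continuous (foldr (@partial R V) f s)} /\
    forall i : 'I_4, derivable (foldr (@partial R V) f s) x (delta_mx 0 i).

(* Gamma^k_ij *)
Definition christoffel (R : realType) (g : 'rV[R]_4 -> 'M[R]_4)
    (k i j : 'I_4) (x : 'rV[R]_4) : R :=
  2^-1 * \sum_(l < 4) invmx (g x) k l *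
    (partial i (fun y => g y j l) x + partial j (fun y => g y i l) x
     - partial l (fun y => g y i j) x).

Definition ricci (R : realType) (g : 'rV[R]_4 -> 'M[R]_4)
    (x : 'rV[R]_4) : 'M[R]_4 :=
  \matrix_(j, k) (
    \sum_(i < 4) (partial i (christoffel g i j k) x
                  - partial j (christoffel g i i k) x)
    + \sum_(i < 4) \sum_(p < 4)
        (christoffel g i i p x * christoffel g p j k x
         - christoffel g i j p x * christoffel g p i k x)).

(* R^mu_nu, row index mu *)
Definition ricci_mixed (R : realType) (g : 'rV[R]_4 -> 'M[R]_4)
    (x : 'rV[R]_4) : 'M[R]_4 := invmx (g x) *m ricci g x.

Definition scalar_curvature (R : realType) (g : 'rV[R]_4 -> 'M[R]_4)
    (x : 'rV[R]_4) : R := \tr (ricci_mixed g x).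

(* G^mu_nu, row index mu *)
Definition einstein (R : realType) (g : 'rV[R]_4 -> 'M[R]_4)
    (x : 'rV[R]_4) : 'M[R]_4 :=
  ricci_mixed g x - (2^-1 * scalar_curvature g x)%:M.

(* nabla_mu psi^nu *)
Definition cov_deriv (R : realType) (g : 'rV[R]_4 -> 'M[R]_4)
    (psi : 'rV[R]_4 -> 'rV[R]_4) (mu nu : 'I_4) (x : 'rV[R]_4) : R :=
  partial mu (fun y => psi y 0 nu) x
  + \sum_(l < 4) christoffel g nu mu l x * psi x 0 l.

Definition vol_density (R : realType) (g : 'rV[R]_4 -> 'M[R]_4)
    (x : 'rV[R]_4) : R := Num.sqrt `|\det (g x)|.

(* The volume form for the orientation dt /\ dx1 /\ dx2 /\ dx3 *)
Definition vol_form (R : realType) (g : 'rV[R]_4 -> 'M[R]_4)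
    (x v0 v1 v2 v3 : 'rV[R]_4) : R :=
  vol_density g x *
  \det (\matrix_(i < 4, j < 4) (nth 0 [:: v0; v1; v2; v3] i : 'rV[R]_4) 0 j).

(* G^mu_nu nabla_mu psi^nu, as a density with respect to dt dx1 dx2 dx3 *)
Definition bianchi_density (R : realType) (g : 'rV[R]_4 -> 'M[R]_4)
    (psi : 'rV[R]_4 -> 'rV[R]_4) (x : 'rV[R]_4) : R :=
  (\sum_(mu < 4) \sum_(nu < 4) einstein g x mu nu * cov_deriv g psi mu nu x)
  * vol_density g x.

Definition bianchi_integrable (R : realType) (g : 'rV[R]_4 -> 'M[R]_4)
    (rho0 : R) (psi : 'rV[R]_4 -> 'rV[R]_4) : Prop :=
  (((@lebesgue_measure R \x @lebesgue_measure R) \x @lebesgue_measure R)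
     \x @lebesgue_measure R)%E.-integrable
    [set p : R * R * R * R | exterior rho0 (chart_point p.1.1.1 p.1.1.2 p.1.2 p.2)]
    (fun p => (bianchi_density g psi (chart_point p.1.1.1 p.1.1.2 p.1.2 p.2))%:E).

Definition bianchi_integral (R : realType) (g : 'rV[R]_4 -> 'M[R]_4)
    (rho0 : R) (psi : 'rV[R]_4 -> 'rV[R]_4) : \bar R :=
  (\int[((@lebesgue_measure R \x @lebesgue_measure R) \x @lebesgue_measure R)
         \x @lebesgue_measure R]_(p in
      [set p : R * R * R * R | exterior rho0 (chart_point p.1.1.1 p.1.1.2 p.1.2 p.2)])
    (bianchi_density g psi (chart_point p.1.1.1 p.1.1.2 p.1.2 p.2))%:E)%E.

Definition cylinder_point (R : realType) (rho t th ph : R) : 'rV[R]_4 :=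
  chart_point t (rho * sin th * cos ph) (rho * sin th * sin ph) (rho * cos th).

Definition flux_vector (R : realType) (g : 'rV[R]_4 -> 'M[R]_4)
    (psi : 'rV[R]_4 -> 'rV[R]_4) (x : 'rV[R]_4) : 'rV[R]_4 :=
  \row_(mu < 4) \sum_(nu < 4) einstein g x mu nu * psi x 0 nu.

(* The pullback of i_X dvol, i.e. of dvol(X, -, -, -), to the cylinder
   R x S_rho under (t, theta, phi). The cylinder is oriented as the boundary of
   the exterior region, whose outward normal is - d/d rho: the coordinate system
   (t, theta, phi) is positively oriented, because (- d_rho, d_t, d_theta, d_phi)
   is positive for dt /\ dx1 /\ dx2 /\ dx3. *)
Definition flux_density (R : realType) (g : 'rV[R]_4 -> 'M[R]_4)
    (psi : 'rV[R]_4 -> 'rV[R]_4) (rho t th ph : R) : R :=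
  let x := cylinder_point rho t th ph in
  vol_form g x (flux_vector g psi x)
    (derive1 (fun s : R => cylinder_point rho s th ph) t)
    (derive1 (fun s : R => cylinder_point rho t s ph) th)
    (derive1 (fun s : R => cylinder_point rho t th s) ph).

Definition boundary_flux (R : realType) (g : 'rV[R]_4 -> 'M[R]_4)
    (psi : 'rV[R]_4 -> 'rV[R]_4) (rho : R) : \bar R :=
  (\int[(@lebesgue_measure R \x @lebesgue_measure R) \x @lebesgue_measure R]_(p in
      [set p : R * R * R | (0 <= p.1.2 <= pi)%R /\ (0 <= p.2 <= 2 * pi)%R])
    (flux_density g psi rho p.1.1 p.1.2 p.2)%:E)%E.

(* Smooth up to and including the boundary: locally, or equivalently (partition
   of unity) on a neighbourhood of the closed exterior, [psi] extends smoothly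
   across the boundary. *)
Definition smooth_up_to_boundary (R : realType) (rho0 : R)
    (psi : 'rV[R]_4 -> 'rV[R]_4) : Prop :=
  exists (U : set 'rV[R]_4) (Psi : 'rV[R]_4 -> 'rV[R]_4),
    [/\ open U, exteriorbar rho0 `<=` U, smooth_on U Psi &
        forall x, exteriorbar rho0 x -> psi x = Psi x].

(* The support may meet the boundary cylinder. *)
Definition compactly_supported (R : realType) (rho0 : R)
    (psi : 'rV[R]_4 -> 'rV[R]_4) : Prop :=
  compact (closure [set x | exteriorbar rho0 x /\ psi x != 0]).

Definition weak_bianchi (R : realType) (g : 'rV[R]_4 -> 'M[R]_4)
    (rho0 : R) : Prop :=
  forall psi : 'rV[R]_4 -> 'rV[R]_4,
    smooth_up_to_boundary rho0 psi -> compactly_supported rho0 psi ->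
    [/\ bianchi_integrable g rho0 psi,
        boundary_flux g psi (rho0 + eps) @[eps --> 0^'+]
          --> bianchi_integral g rho0 psi &
        bianchi_integral g rho0 psi = 0%E].

Definition electrostatic_metric (R : realType) (NG c : R) (zeta : R -> R)
    (Q M rho0 : R) (x : 'rV[R]_4) : 'M[R]_4 :=
  \matrix_(i, j)
    if i != j then 0
    else if i == 0 then
      - expR (2 * gamma NG c zeta Q M rho0 (space_norm x)) * c ^+ 2
    else conf_factor NG c zeta Q M rho0 (space_norm x) ^+ 4.

Definition four_potential (R : realType) (NG c : R) (zeta : R -> R)
    (Q M rho0 : R) (x : 'rV[R]_4) : 'rV[R]_4 :=
  \row_(i < 4)
    if i == 0 then
      potential zeta Q (area_radius NG c zeta Q M rho0 (space_norm x)) * c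
    else 0.

Definition ext_deriv (R : realType) (A : 'rV[R]_4 -> 'rV[R]_4)
    (x : 'rV[R]_4) : 'M[R]_4 :=
  \matrix_(i, j) (partial i (fun y => A y 0 j) x - partial j (fun y => A y 0 i) x).

(* [g] and [F] on the manifold R x (R^3 minus the closed ball of radius rho0);
   in the absence of horizon this chart covers the whole spacetime. *)
Record electrostatic_spacetime (R : realType) (NG c : R) (zeta : R -> R)
    (Q M rho0 : R) (g F : 'rV[R]_4 -> 'M[R]_4) : Prop := ElectrostaticSpacetime {
  es_alpha_smooth : forall (n : nat) (r : R), 0 < r ->
    derivable (derive1n n (alpha NG c zeta Q M)) r 1;
  es_metric : forall x, exterior rho0 x ->
    g x = electrostatic_metric NG c zeta Q M rho0 x;
  es_field : forall x, exterior rho0 x ->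
    F x = ext_deriv (four_potential NG c zeta Q M rho0) x }.

(* Main.v *)
(* Since the bare mass is negative, r e^(2 alpha) stays bounded at the center,
   while the field equations r^2 G^t_t = r (e^(2 alpha))' + e^(2 alpha) - 1 =
   - const zeta r^2 and their derivative bound the components of the Einstein
   tensor by const / r^2. The Einstein tensor times the volume density is
   therefore of order sqrt r: the density of the Bianchi integral is bounded with
   bounded support, and the flux through the cylinders tends to 0. Away from the
   center the pointwise Bianchi identity turns the density into a divergence.
   Multiplied by the cutoffs max(0, 1 - 1 / (n r))^2 it comes from a compactly
   supported C^1 field, so that its integral vanishes by integration along the
   coordinate lines. The gradient of the cutoff is of order 1 / (n r^(3/2)) on
   n r >= 1, so the term it contributes is bounded and tends to 0 pointwise, and
   dominated convergence gives the identity. *)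
Require Import Defs.
From HB Require Import structures.
From mathcomp Require Import all_boot all_order all_algebra.
From mathcomp Require Import all_classical all_reals all_analysis.
From mathcomp Require Import perm measurable_realfun.
From mathcomp Require Import ring lra.

Set Implicit Arguments.
Unset Strict Implicit.
Unset Printing Implicit Defensive.

Import Order.TTheory GRing.Theory Num.Theory.
Import numFieldNormedType.Exports.

Local Open Scope classical_set_scope.
Local Open Scope ring_scope.

(** The center becomes a cylinder of positive radius rho0 because m0 < 0: then dr / (r e^alpha)
    behaves like r^(-1/2) dr and is integrable at 0. Test fields may be nonzero on this cylinder,
    where only upper bounds on the curvature are available, so no divergence theorem is applied up
    to the boundary. The cutoff is a function of r, so its gradient is explicit through dr / d rho =
    r e^alpha / rho and rho - rho0 need not be compared with r; the factor e^alpha it brings, at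
    most of order r^(-1/2), is just absorbed by the order sqrt r of the densitised Einstein tensor.
    The curvature is computed for an abstract profile S of e^(2 alpha). Coordinate derivatives of
    functions of |x| are multiples of x_i, so each tensor identity becomes a rational identity in
    the coordinates and a few radial coefficients. The law zeta enters only through bounds on S and
    its derivatives and through the behaviour of r(rho). *)

(** * Directional derivatives and the squared positive part *)

Section directional_derivatives.
Context {R : realType} {V : normedModType R}.
Implicit Types (x v : V).

(** Restriction to the line through [x] along [v] carries the one-variable chain rule over to
    directional derivatives, with no need for a total differential. *)
Lemma is_derive_line {W : normedModType R} (f : V -> W) x v d :
  is_derive x v f d <-> is_derive (0 : R) (1 : R) (fun h => f (h *: v + x)) d.
Proof.
have E : 'D_v f x = 'D_1 (fun h : R => f (h *: v + x)) 0.
  rewrite /derive; set g1 := fun h => h^-1 *: _; set g2 := fun h => h^-1 *: _.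
  suff -> : g1 = g2 by [].
  by rewrite funeqE /g1 /g2 => h /=; rewrite addr0 scale0r add0r [_%:A]mulr1.
split=> -[fd <-].
  by rewrite E; split => //; move/derivable1P : fd.
by rewrite -E; split => //; apply/derivable1P.
Qed.

Lemma is_derive_comp1 (f : V -> R) (h : R -> R) x v df dh :
  is_derive x v f df -> is_derive (f x) (1 : R) h dh ->
  is_derive x v (h \o f) (dh * df).
Proof.
move=> /is_derive_line fd hd; apply/is_derive_line.
have hd' : is_derive ((fun t : R => f (t *: v + x)) 0) (1 : R) h dh.
  by rewrite scale0r add0r.
exact: (is_derive1_comp hd' fd).
Qed.

Lemma is_derive_inv (f : V -> R) x v d : f x != 0 -> is_derive x v f d ->
  is_derive x v (fun y => (f y)^-1) (- d / f x ^+ 2).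
Proof.
move=> f0 [fd <-]; split; first exact: derivableV.
by rewrite (deriveV f0 fd) /GRing.scale/= mulNr mulNr mulrC.
Qed.

End directional_derivatives.

(** Integration along a coordinate line needs the derivative at every parameter [t], not only at the
    base point. *)
Lemma is_derive_along {R : realType} {V W : normedModType R} (f : V -> W)
    (v x : V) (t : R) d :
  is_derive (t *: v + x) v f d ->
  is_derive t (1 : R) (fun h => f (h *: v + x)) d.
Proof.
move=> /is_derive_line fd; apply/is_derive_line.
suff -> : (fun h : R => f ((h *: 1 + t) *: v + x)) =
  (fun h => f (h *: v + (t *: v + x))) by [].
by apply/funext => h; rewrite [h *: 1]mulr1 scalerDl addrA.
Qed.


Lemma is_derive_coord (R : realType) (x : 'rV[R]_4) (i j : 'I_4) :
  is_derive x (delta_mx 0 i) (fun y : 'rV[R]_4 => y 0 j) ((i == j)%:R).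
Proof.
have := @derivable_id R 'rV[R]_4 x (delta_mx 0 i).
move=> dx; apply: DeriveDef; first by move/derivable_mxP : dx => /(_ 0 j).
have := derive_id x (delta_mx 0 i : 'rV[R]_4).
rewrite (derive_mx dx) => /matrixP/(_ 0 j); rewrite !mxE /= => ->.
by rewrite eq_sym.
Qed.

Lemma is_derive_continuous {R : realType} (f : R -> R) (y d : R) :
  is_derive y (1 : R) f d -> {for y, continuous f}.
Proof. by move=> [fd _]; exact/differentiable_continuous/derivable1_diffP. Qed.

Lemma pos_part_continuous {R : realType} : continuous (fun y : R => Num.max 0 y).
Proof.
move=> y; apply: (@continuous_max _ _ (cst 0) id); last exact: cvg_id.
exact: cst_continuous.
Qed.

(** Squaring removes the kink: at 0 the difference quotient is at most |h|^2 / |h|. This is why the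
    cutoff is a square. *)
Lemma is_derive_pos_sqr {R : realType} (z : R) :
  is_derive z (1 : R) (fun y => Num.max 0 y ^+ 2) (2 * Num.max 0 z).
Proof.
have dsq : is_derive z (1 : R) (fun y : R => y ^+ 2) (2 * z).
  apply: (is_derive_eq (is_deriveX 2 (is_derive_id z (1 : R)))).
  by rewrite /GRing.scale/= expr1 mulr1.
have [z0|z0|<-] := ltgtP 0 z.
- apply: near_eq_is_derive dsq; near=> y.
  by rewrite max_r// ltW//; near: y; exact: lt_nbhsr.
- apply: (@near_eq_is_derive _ _ _ (cst 0)); last first.
    by rewrite mulr0; exact: is_derive_cst.
  near=> y; rewrite max_l ?expr0n// ltW//; near: y; exact: lt_nbhsl.
- rewrite mulr0.
  have cv : h^-1 *: (((fun y : R => Num.max 0 y ^+ 2) \o shift 0) (h *: 1) -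
      Num.max 0 0 ^+ 2) @[h --> 0^'] --> (0 : R).
    apply/cvgrPdist_le => e e0; near=> h.
    rewrite /= maxxx expr0n subr0 sub0r normrN addr0 [h *: 1]mulr1 [_ *: _]/GRing.scale/=.
    have h0 : h != 0 by near: h; exact: nbhs_dnbhs_neq.
    have he : `|h| <= e by near: h; exact: dnbhs0_le.
    rewrite normrM normfV ler_pdivrMl ?normr_gt0// normrX.
    apply: (@le_trans _ _ (`|h| ^+ 2)).
      rewrite lerXn2r ?nnegrE//; case: (leP 0 h) => // h1.
      by rewrite normr0.
    by rewrite expr2 ler_wpM2l.
  by split; [apply/cvg_ex; exists 0|exact: cvg_lim].
Unshelve. all: by end_near. Qed.

(** * Functions of class C^1 on open sets of the chart *)

Section C1.
Context {R : realType}.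
Implicit Types (U : set 'rV[R]_4) (f : 'rV[R]_4 -> R).

(** First order is all the regularity that the squared positive part has. Continuity is a clause of
    its own, which keeps the product and composition rules elementary. *)
Definition C1on U f := forall x, U x -> {for x, continuous f} /\
  forall i, derivable f x (delta_mx 0 i) /\ {for x, continuous (partial i f)}.

Lemma C1on_is_derive U f x i : C1on U f -> U x ->
  is_derive x (delta_mx 0 i) f (partial i f x).
Proof. by move=> /(_ x) h /h [_ /(_ i)[]] d _; exact: DeriveDef. Qed.

Lemma open_near_eq U (f h : 'rV[R]_4 -> R) x : open U -> U x ->
  (forall y, U y -> f y = h y) -> \forall y \near x, f y = h y.
Proof. by move=> oU Ux fh; near=> y; apply: fh; near: y; exact: open_nbhs_nbhs.
Unshelve. all: by end_near. Qed.

Lemma near_eq_continuous {T T' : topologicalType} (f h : T -> T') (x : T) :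
  (\forall y \near x, f y = h y) -> {for x, continuous f} -> {for x, continuous h}.
Proof.
move=> fh; rewrite /prop_for /continuous_at -(nbhs_singleton fh).
by apply: cvg_trans; apply: near_eq_cvg.
Qed.

(** On an open set the candidate [df] agrees with the partial derivative in a neighbourhood of each
    point, so continuity can be read off from [df]. *)
Lemma C1onI U f (df : 'I_4 -> 'rV[R]_4 -> R) : open U ->
  (forall x, U x -> {for x, continuous f}) ->
  (forall x i, U x -> is_derive x (delta_mx 0 i) f (df i x)) ->
  (forall x i, U x -> {for x, continuous (df i)}) -> C1on U f.
Proof.
move=> oU cf fd cdf x Ux; split; first exact: cf.
move=> i; split; first by have [] := fd x i Ux.
apply: near_eq_continuous (cdf x i Ux); apply: (@open_near_eq U) => // y Uy.
by have [_ <-] := fd y i Uy.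
Qed.

Lemma C1on_sub U U' f : U' `<=` U -> C1on U f -> C1on U' f.
Proof. by move=> UU h x /UU /h. Qed.

Lemma C1on_eq U f h : open U -> (forall x, U x -> f x = h x) -> C1on U f -> C1on U h.
Proof.
move=> oU fh cf; apply: (@C1onI _ _ (fun i => partial i f)) => //.
- move=> x Ux; apply: near_eq_continuous (cf x Ux).1.
  exact: (@open_near_eq U).
- move=> x i Ux; apply: near_eq_is_derive (C1on_is_derive i cf Ux).
  exact: (@open_near_eq U).
- by move=> x i /cf [_ /(_ i)[]].
Qed.

Lemma C1onU U U' f : C1on U f -> C1on U' f -> C1on (U `|` U') f.
Proof. by move=> h h' x [/h|/h']. Qed.

Lemma C1on_cst U (a : R) : open U -> C1on U (fun=> a).
Proof.
move=> oU; apply: (@C1onI _ _ (fun _ => cst 0)) => // x *; exact: cst_continuous.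
Qed.

Lemma C1on_coord U j : open U -> C1on U (fun x => x 0 j).
Proof.
move=> oU; apply: (@C1onI _ _ (fun i => cst (i == j)%:R)) => //.
- by move=> x _; exact: coord_continuous.
- by move=> x i _; exact: is_derive_coord.
- by move=> x i _; exact: cst_continuous.
Qed.

Lemma C1onD U f h : open U -> C1on U f -> C1on U h -> C1on U (fun x => f x + h x).
Proof.
move=> oU cf ch; apply: (@C1onI _ _ (fun i x => partial i f x + partial i h x)) => //.
- by move=> x Ux; exact: (continuousD (cf x Ux).1 (ch x Ux).1).
- move=> x i Ux; have := C1on_is_derive i cf Ux.
  by have := C1on_is_derive i ch Ux => dh df; exact: is_deriveD.
- move=> x i Ux; exact: (continuousD ((cf x Ux).2 i).2 ((ch x Ux).2 i).2).
Qed.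

Lemma C1onM U f h : open U -> C1on U f -> C1on U h -> C1on U (fun x => f x * h x).
Proof.
move=> oU cf ch.
apply: (@C1onI _ _ (fun i x => f x * partial i h x + h x * partial i f x)) => //.
- by move=> x Ux; exact: (continuousM (cf x Ux).1 (ch x Ux).1).
- move=> x i Ux; have := C1on_is_derive i cf Ux.
  by have := C1on_is_derive i ch Ux => dh df; exact: is_deriveM.
- move=> x i Ux; exact: (continuousD (continuousM (cf x Ux).1 ((ch x Ux).2 i).2)
                        (continuousM (ch x Ux).1 ((cf x Ux).2 i).2)).
Qed.

Lemma C1on_sum U n (f : 'I_n -> 'rV[R]_4 -> R) : open U ->
  (forall i, C1on U (f i)) -> C1on U (fun x => \sum_i f i x).
Proof.
elim: n f => [|n ih] f oU cf.
  apply: (@C1on_eq U (fun=> 0)) => //; last exact: C1on_cst.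
  by move=> x _; rewrite big_ord0.
apply: (@C1on_eq U (fun x => f ord0 x + \sum_i f (lift ord0 i) x)) => //.
  by move=> x _; rewrite big_ord_recl.
by apply: C1onD => //; exact: ih.
Qed.

(** The set [K] confines the values of [f], because outer functions such as the square root or the
    inverse are differentiable on part of the line only. *)
Lemma C1on_comp U (K : set R) f (h dh : R -> R) : open U -> C1on U f ->
  (forall x, U x -> K (f x)) ->
  (forall y, K y -> is_derive y (1 : R) h (dh y)) ->
  (forall y, K y -> {for y, continuous dh}) -> C1on U (fun x => h (f x)).
Proof.
move=> oU cf UK hd cdh.
have ch y : K y -> {for y, continuous h}.
  by move=> /hd /is_derive_continuous.
apply: (@C1onI _ _ (fun i x => dh (f x) * partial i f x)) => //.
- move=> x Ux; exact: (continuous_comp (cf x Ux).1 (ch _ (UK x Ux))).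
- move=> x i Ux; apply: is_derive_comp1; first exact: C1on_is_derive cf Ux.
  exact/hd/UK.
- move=> x i Ux; apply: continuousM; last exact: ((cf x Ux).2 i).2.
  exact: (continuous_comp (cf x Ux).1 (cdh _ (UK x Ux))).
Qed.

Lemma C1onV U f : open U -> (forall x, U x -> f x != 0) -> C1on U f ->
  C1on U (fun x => (f x)^-1).
Proof.
move=> oU f0 cf.
apply: (@C1on_comp U [set y | y != 0] f GRing.inv (fun y => - y ^- 2)) => //.
- move=> y /= y0; have dy := @derivable_id R R y 1.
  split; first exact: (derivableV y0 dy).
  by rewrite (deriveV y0 dy) derive_id /GRing.scale/= mulr1.
- move=> y /= y0; apply: continuousN; apply: continuousV; first by rewrite expf_neq0.
  exact: exprn_continuous.
Qed.

Lemma C1onX U f n : open U -> C1on U f -> C1on U (fun x => f x ^+ n).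
Proof.
move=> oU cf; elim: n => [|n ih].
  exact: C1on_cst.
apply: (@C1on_eq U (fun x => f x * f x ^+ n)) => //; last exact: C1onM.
by move=> x _; rewrite exprS.
Qed.

End C1.

(** * Curvature of static conformally flat metrics *)

Notation o0 := (@Ordinal 4 0 isT).
Notation o1 := (@Ordinal 4 1 isT).
Notation o2 := (@Ordinal 4 2 isT).
Notation o3 := (@Ordinal 4 3 isT).

(** Produces literal ordinals, on which the index tests in the tensors below compute. *)
Lemma ord4P (P : 'I_4 -> Prop) : P o0 -> P o1 -> P o2 -> P o3 -> forall i, P i.
Proof.
move=> P0 P1 P2 P3 [[|[|[|[|//]]]] i4].
- by rewrite (_ : Ordinal i4 = o0)//; apply/val_inj.
- by rewrite (_ : Ordinal i4 = o1)//; apply/val_inj.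
- by rewrite (_ : Ordinal i4 = o2)//; apply/val_inj.
- by rewrite (_ : Ordinal i4 = o3)//; apply/val_inj.
Qed.

Lemma sum4 (V : nmodType) (F : 'I_4 -> V) :
  \sum_i F i = F o0 + (F o1 + (F o2 + F o3)).
Proof.
rewrite !big_ord_recl big_ord0 addr0.
by do ! congr (_ + _); congr F; apply/val_inj.
Qed.

(** With the time coordinate set to 0, a function of |x| has derivative (coefficient) times
    [spatial x i] for all four indices at once. Indices are compared as natural numbers so that the
    tests compute. *)
Definition spatial {R : realType} (x : 'rV[R]_4) (i : 'I_4) : R :=
  if i == 0 :> nat then 0 else x 0 i.

Definition sqnorm {R : realType} (x : 'rV[R]_4) : R :=
  spatial x o1 ^+ 2 + spatial x o2 ^+ 2 + spatial x o3 ^+ 2.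

Section static_conformally_flat.
Context {R : realType}.
Variables (U : set 'rV[R]_4) (g : 'rV[R]_4 -> 'M[R]_4).
(* [u] and [w] are the logarithmic derivatives of sqrt N and sqrt P with respect
   to |x|^2 / 2, and [v] is the coefficient of Gamma^i_00. *)
Variables (N P u v w du dv dw : 'rV[R]_4 -> R).
Hypothesis oU : open U.
Hypothesis gE : forall x, U x -> g x =
  \matrix_(i, j) if i != j then 0 else if i == 0 then - N x else P x.
Hypothesis N0 : forall x, U x -> N x != 0.
Hypothesis P0 : forall x, U x -> P x != 0.
Hypothesis dN : forall x i, U x ->
  is_derive x (delta_mx 0 i) N (2 * N x * u x * spatial x i).
Hypothesis dP : forall x i, U x ->
  is_derive x (delta_mx 0 i) P (2 * P x * w x * spatial x i).
Hypothesis vE : forall x, U x -> v x = N x * u x / P x.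
Hypothesis hdu : forall x i, U x ->
  is_derive x (delta_mx 0 i) u (du x * spatial x i).
Hypothesis hdv : forall x i, U x ->
  is_derive x (delta_mx 0 i) v (dv x * spatial x i).
Hypothesis hdw : forall x i, U x ->
  is_derive x (delta_mx 0 i) w (dw x * spatial x i).

Lemma invmx_static x : U x -> invmx (g x) =
  \matrix_(i, j) if i != j then 0 else if i == 0 then - (N x)^-1 else (P x)^-1.
Proof.
move=> Ux; set h := \matrix_(i, j) _.
suff gh : g x *m h = 1%:M.
  by rewrite -[invmx _]mulmx1 -gh mulKmx//; have [] := mulmx1_unit gh.
apply/matrixP => i j; rewrite gE// !mxE sum4 !mxE.
have := N0 Ux; have := P0 Ux; move: i j.
by do 2 apply: ord4P; move=> /= ? ?; field; do ?split.
Qed.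

Lemma det_static x : U x -> \det (g x) = - N x * P x ^+ 3.
Proof.
move=> Ux; rewrite gE//.
pose d : 'rV[R]_4 := \row_i (if i == 0 then - N x else P x).
rewrite (_ : \matrix_(_, _) _ = diag_mx d).
  by rewrite det_diag !big_ord_recl big_ord0 !mxE /= mulr1 !exprS expr0; ring.
by apply/matrixP => i j; rewrite !mxE; case: eqP => [->|]//=; rewrite mulr0n.
Qed.

(** The Christoffel symbols of diag(-N, P, P, P). The last case is that of a conformally flat
    metric; it also gives 0 when exactly one lower index is the time index, because [spatial x o0]
    is 0. *)
Definition chr (x : 'rV[R]_4) (k i j : 'I_4) : R :=
  if k == 0 :> nat then u x * ((i == 0 :> nat)%:R * spatial x j + (j == 0 :> nat)%:R * spatial x i)
  else if (i == 0 :> nat) && (j == 0 :> nat) then v x * spatial x k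
  else w x * ((k == i :> nat)%:R * spatial x j + (k == j :> nat)%:R * spatial x i
              - (i == j :> nat)%:R * spatial x k).

Lemma partial_metric l i j x : U x -> partial l (fun y => g y i j) x =
  (i == j :> nat)%:R * (if i == 0 :> nat then - (2 * N x * u x) else 2 * P x * w x) * spatial x l.
Proof.
move=> Ux; rewrite /partial.
pose h y := if i != j then 0 else if i == 0 :> nat then - N y else P y.
have E : \forall y \near x, h y = g y i j.
  by apply: (open_near_eq oU Ux) => y Uy; rewrite gE// mxE.
rewrite -(near_eq_derive _ E) /h val_eqE.
case: eqP => _ /=; last by rewrite derive_cst !mul0r.
rewrite mul1r; case: eqP => _.
  by have dNx := dN l Ux; rewrite (derive_val (is_derive := is_deriveN dNx)) mulNr.
by have [_ ->] := dP l Ux.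
Qed.

Lemma christoffel_static k i j x : U x -> christoffel g k i j x = chr x k i j.
Proof.
move=> Ux; rewrite /christoffel invmx_static// sum4 !partial_metric// !mxE /chr.
have := N0 Ux; have := P0 Ux; rewrite (vE Ux) /spatial; move: k i j.
by do 3 apply: ord4P; move=> /= ? ?; field; do ?split.
Qed.

Lemma is_derive_spatial (x : 'rV[R]_4) m i :
  is_derive x (delta_mx 0 m) (spatial^~ i) ((m == i :> nat) && (i != 0 :> nat))%:R.
Proof.
rewrite /spatial; case: eqP => _ /=; last first.
  by rewrite andbT; exact: is_derive_coord.
by rewrite andbF; exact: is_derive_cst.
Qed.

(** [d l] is the derivative of [spatial x l] in direction [m]; the other terms come from the radial
    coefficients. *)
Definition dchr (x : 'rV[R]_4) (m k i j : 'I_4) : R :=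
  let d l : R := ((m == l :> nat) && (l != 0 :> nat))%:R in
  if k == 0 :> nat then
    u x * ((i == 0 :> nat)%:R * d j + (j == 0 :> nat)%:R * d i) +
    du x * spatial x m * ((i == 0 :> nat)%:R * spatial x j + (j == 0 :> nat)%:R * spatial x i)
  else if (i == 0 :> nat) && (j == 0 :> nat) then v x * d k + dv x * spatial x m * spatial x k
  else w x * ((k == i :> nat)%:R * d j + (k == j :> nat)%:R * d i - (i == j :> nat)%:R * d k) +
    dw x * spatial x m * ((k == i :> nat)%:R * spatial x j + (k == j :> nat)%:R * spatial x i
                          - (i == j :> nat)%:R * spatial x k).

Lemma is_derive_chr x m k i j : U x ->
  is_derive x (delta_mx 0 m) (fun y => chr y k i j) (dchr x m k i j).
Proof.
move=> Ux; rewrite /chr /dchr.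
have sp := is_derive_spatial x m.
have spZ (a : R) l := is_deriveZ a (sp l).
case: (eqVneq (k : nat) 0%N) => k0 /=.
  apply: (is_derive_eq (is_deriveM (hdu m Ux)
            (is_deriveD (spZ (i == 0 :> nat)%:R j) (spZ (j == 0 :> nat)%:R i)))).
  by rewrite ?fctE /GRing.scale/= /GRing.scale/= ?k0 ?andbT; ring.
case: ifP => _.
  apply: (is_derive_eq (is_deriveM (hdv m Ux) (sp k))).
  by rewrite ?fctE /GRing.scale/= /GRing.scale/= ?k0 ?andbT; ring.
apply: (is_derive_eq (is_deriveM (hdw m Ux) (is_deriveB
  (is_deriveD (spZ (k == i :> nat)%:R j) (spZ (k == j :> nat)%:R i)) (spZ (i == j :> nat)%:R k)))).
by rewrite ?fctE /GRing.scale/= /GRing.scale/= ?k0 ?andbT; ring.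
Qed.

Lemma partial_christoffel m k i j x : U x ->
  partial m (christoffel g k i j) x = dchr x m k i j.
Proof.
move=> Ux; have dc := is_derive_chr m k i j Ux.
rewrite /partial -[RHS](derive_val (is_derive := dc)).
by apply: near_eq_derive; apply: (open_near_eq oU Ux) => y; exact: christoffel_static.
Qed.

(** The symbols involve [N] and [P] only through [u], [v], [w], so each of the 16 components is a
    polynomial identity in the coordinates, these three coefficients and their derivatives. *)
Lemma ricci_static x : U x -> ricci g x = \matrix_(j, k)
  if j == 0 :> nat then
    if k == 0 :> nat then dv x * sqnorm x + 3 * v x + v x * (u x + 3 * w x) * sqnorm x
                   - 2 * u x * v x * sqnorm x
    else 0
  else if k == 0 :> nat then 0
  else (2 * u x * w x + w x ^+ 2 - u x ^+ 2 - dw x - du x)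
         * spatial x j * spatial x k
       - (dw x * sqnorm x + 4 * w x + u x + u x * w x * sqnorm x + w x ^+ 2 * sqnorm x) *+ (j == k :> nat).
Proof.
move=> Ux; apply/matrixP => j k; rewrite !mxE.
under eq_bigr do rewrite !partial_christoffel//.
under [X in _ + X]eq_bigr do under eq_bigr do rewrite !christoffel_static//.
rewrite /sqnorm !sum4 /dchr /chr.
have s0 : spatial x o0 = 0 by [].
move: j k; do 2 apply: ord4P; rewrite /= ?s0.
all: move: (spatial x o1) (spatial x o2) (spatial x o3) => x1 x2 x3.
all: move: (u x) (v x) (w x) (du x) (dv x) (dw x) => *.
all: rewrite ?mulr1n ?mulr0n; ring.
Qed.

(** In these terms R_00 = [r0], and R_jk = [p] x_j x_k - [q] delta_jk on spatial indices. *)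
Let r0 x := dv x * sqnorm x + 3 * v x + v x * (u x + 3 * w x) * sqnorm x
  - 2 * u x * v x * sqnorm x.
Let p x := 2 * u x * w x + w x ^+ 2 - u x ^+ 2 - dw x - du x.
Let q x := dw x * sqnorm x + 4 * w x + u x + u x * w x * sqnorm x
  + w x ^+ 2 * sqnorm x.

Lemma einstein_static x : U x -> einstein g x = \matrix_(i, j)
  if (i == 0 :> nat) || (j == 0 :> nat) then
    - 2^-1 * (r0 x / N x + (p x * sqnorm x - 3 * q x) / P x) *+ (i == j :> nat)
  else p x / P x * spatial x i * spatial x j
    + (2^-1 * (r0 x / N x) + (q x / 2 - p x * sqnorm x / 2) / P x) *+ (i == j :> nat).
Proof.
move=> Ux; have sE : \tr (ricci_mixed g x) = - (r0 x / N x) + (p x * sqnorm x - 3 * q x) / P x.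
  rewrite /mxtrace /ricci_mixed ricci_static// invmx_static// sum4 !mxE !sum4 !mxE /=.
  rewrite /q /p /r0 /sqnorm.
  by rewrite ?mulr1n; field; rewrite (N0 Ux) (P0 Ux).
apply/matrixP => i j; rewrite /einstein /scalar_curvature sE /ricci_mixed.
rewrite ricci_static// invmx_static// 2!mxE sum4 !mxE.
have N0x := N0 Ux; have P0x := P0 Ux; rewrite /q /p /r0.
move: (sqnorm x) (spatial x) => sx xx.
move: (u x) (v x) (w x) (du x) (dv x) (dw x) => *.
move: i j; do 2 apply: ord4P; rewrite /=.
all: rewrite ?mulr1n ?mulr0n; field.
all: by rewrite ?N0x ?P0x.
Qed.

End static_conformally_flat.

(** * Derivatives of the Euclidean norm of the spatial part *)

Section radial_functions.
Context {R : realType}.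
Implicit Types (x : 'rV[R]_4) (i : 'I_4).

Lemma is_derive_sqnorm x i :
  is_derive x (delta_mx 0 i) (@sqnorm R) (2 * spatial x i).
Proof.
have X n l := is_deriveX n (is_derive_spatial x i l).
apply: (is_derive_eq (is_deriveD (is_deriveD (X 2%N o1) (X 2%N o2)) (X 2%N o3))).
rewrite /GRing.scale/= !expr1.
have s0 : spatial x o0 = 0 by [].
by move: i X; apply: ord4P => _ /=; rewrite /GRing.scale/= ?s0; ring.
Qed.

Lemma C1on_spatial (U : set 'rV[R]_4) i : open U -> C1on U (spatial^~ i).
Proof.
move=> oU; rewrite /spatial; case: eqP => _; first exact: C1on_cst.
exact: C1on_coord.
Qed.

Lemma C1on_sqnorm (U : set 'rV[R]_4) : open U -> C1on U (@sqnorm R).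
Proof.
move=> oU; have X n i := C1onX n oU (C1on_spatial i oU).
exact: (C1onD oU (C1onD oU (X 2%N o1) (X 2%N o2)) (X 2%N o3)).
Qed.

Lemma space_normE x : space_norm x = Num.sqrt (sqnorm x).
Proof.
rewrite /space_norm /sqnorm; congr Num.sqrt.
by rewrite big_mkcond sum4 /= add0r addrA.
Qed.

Lemma sqnorm_ge0 x : 0 <= sqnorm x.
Proof. by rewrite !addr_ge0// sqr_ge0. Qed.

Lemma space_norm_sqr x : space_norm x ^+ 2 = sqnorm x.
Proof. by rewrite space_normE sqr_sqrtr// sqnorm_ge0. Qed.

Lemma space_norm_continuous : continuous (@space_norm R).
Proof.
move=> x; rewrite (_ : @space_norm R = Num.sqrt \o @sqnorm R); last first.
  by apply/funext => y /=; rewrite space_normE.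
apply: continuous_comp; first exact: (C1on_sqnorm openT (I : setT x)).1.
exact: sqrt_continuous.
Qed.

Lemma open_exterior (rho0 : R) : open (@exterior R rho0).
Proof.
rewrite (_ : exterior _ = @space_norm R @^-1` [set y | rho0 < y])//.
by apply: open_comp; [move=> x _; exact: space_norm_continuous|exact: open_gt].
Qed.

Lemma is_derive_space_norm x i : 0 < space_norm x ->
  is_derive x (delta_mx 0 i) (@space_norm R) (spatial x i / space_norm x).
Proof.
move=> x0; have s0 : 0 < sqnorm x by rewrite -space_norm_sqr exprn_gt0.
have -> : @space_norm R = Num.sqrt \o @sqnorm R.
  by apply/funext => y /=; rewrite space_normE.
apply: (is_derive_eq (is_derive_comp1 (is_derive_sqnorm x i) (is_derive1_sqrt s0))).
by move: x0; rewrite /= -space_normE => x0; field; rewrite gt_eqF.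
Qed.

Lemma C1on_space_norm (U : set 'rV[R]_4) : open U ->
  (forall x, U x -> 0 < space_norm x) -> C1on U (@space_norm R).
Proof.
move=> oU U0; have sE : forall x, U x -> Num.sqrt (sqnorm x) = space_norm x.
  by move=> x _; rewrite space_normE.
apply: (C1on_eq oU sE).
apply: (@C1on_comp _ U [set y | 0 < y] (@sqnorm R) Num.sqrt (fun y => (2 * Num.sqrt y)^-1) oU).
- exact: C1on_sqnorm.
- by move=> x /U0 x0 /=; rewrite -space_norm_sqr exprn_gt0.
- move=> y /= y0; apply: continuousV; first by rewrite mulf_neq0// gt_eqF// sqrtr_gt0.
  apply: (@continuousM _ _ (cst 2) Num.sqrt); last exact: sqrt_continuous.
  exact: cst_continuous.
Qed.

End radial_functions.

(* [S] is e^(2 alpha) as a function of the area radius r, with derivatives [T],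
   [D], [W], and [rad] is the area radius as a function of rho. *)
Record radial_profile (R : realType) (rho0 : R) (S T D W rad : R -> R) : Prop :=
  RadialProfile {
  rp_gt0 : forall r : R, 0 < r -> 0 < S r;
  rp_S : forall r : R, 0 < r -> is_derive r (1 : R) S (T r);
  rp_T : forall r : R, 0 < r -> is_derive r (1 : R) T (D r);
  rp_D : forall r : R, 0 < r -> is_derive r (1 : R) D (W r);
  rp_W : forall r : R, 0 < r -> {for r, continuous W};
  rp_rad_gt0 : forall rho : R, rho0 < rho -> 0 < rad rho;
  rp_rad : forall rho : R, rho0 < rho ->
    is_derive rho (1 : R) rad (rad rho * Num.sqrt (S (rad rho)) / rho) }.

(* The quantities in [rc_bound] are r^2 G^t_t = r^2 G^r_r, the angular component
   of the Einstein tensor, and r e^(2 alpha). As the volume density is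
   c sqrt(r S) r^(5/2) / rho^3, they make the density of [G] of order sqrt r. *)
Record regular_center (R : realType) (rho0 : R) (S T D rad : R -> R) : Prop :=
  RegularCenter {
  rc_bound : forall R1 : R, exists2 C, 0 < C & forall r, 0 < r <= R1 ->
    [/\ `|r * T r + S r - 1| <= C, `|T r / r + D r / 2| <= C & r * S r <= C];
  rc_rad_bound : forall rho1 : R, exists2 R1, 0 < R1 &
    forall rho, rho0 < rho <= rho1 -> rad rho <= R1;
  rc_rad0 : rad rho @[rho --> rho0^'+] --> (0 : R) }.

(** * The Einstein tensor of a static spherically symmetric metric *)

Section spherically_symmetric.
Context {R : realType}.
Variables (rho0 c : R) (S T D W rad : R -> R).
Hypotheses (rho0_gt0 : 0 < rho0) (c_gt0 : 0 < c).
Hypothesis prof : radial_profile rho0 S T D W rad.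

Let U := @exterior R rho0.
Let oU : open U := @open_exterior R rho0.
Let rr (x : 'rV[R]_4) := rad (space_norm x).
Let E (x : 'rV[R]_4) := Num.sqrt (S (rr x)).
Let TT (x : 'rV[R]_4) := T (rr x).
Let DD (x : 'rV[R]_4) := D (rr x).

Lemma exterior_norm_gt0 x : U x -> 0 < space_norm x.
Proof. exact: lt_trans. Qed.

Lemma exterior_sqnorm_gt0 x : U x -> 0 < sqnorm x.
Proof. by move=> /exterior_norm_gt0 x0; rewrite -space_norm_sqr exprn_gt0. Qed.

Lemma area_gt0 x : U x -> 0 < rr x.
Proof. exact: (rp_rad_gt0 prof). Qed.

Lemma lapse_gt0 x : U x -> 0 < E x.
Proof. by move=> Ux; rewrite sqrtr_gt0 (rp_gt0 prof)// area_gt0. Qed.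

Lemma lapse_sqr x : U x -> E x ^+ 2 = S (rr x).
Proof. by move=> Ux; rewrite sqr_sqrtr// ltW// (rp_gt0 prof)// area_gt0. Qed.

(** The equation for [rad] reads dr / (r sqrt S) = d rho / rho, which is what makes the coordinates
    isotropic. *)
Lemma is_derive_area x i : U x ->
  is_derive x (delta_mx 0 i) rr (rr x * E x / sqnorm x * spatial x i).
Proof.
move=> Ux; have x0 := exterior_norm_gt0 Ux.
have dn := is_derive_space_norm i x0.
apply: (is_derive_eq (is_derive_comp1 dn (rp_rad prof Ux))).
by rewrite -space_norm_sqr /E /rr; field; rewrite gt_eqF.
Qed.

Lemma is_derive_of_area (f : R -> R) df x i : U x -> is_derive (rr x) (1 : R) f df ->
  is_derive x (delta_mx 0 i) (fun y => f (rr y))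
    (df * (rr x * E x / sqnorm x) * spatial x i).
Proof.
move=> Ux fd; have dr := is_derive_area i Ux.
by apply: (is_derive_eq (is_derive_comp1 dr fd)); rewrite mulrA.
Qed.

Lemma is_derive_lapse x i : U x ->
  is_derive x (delta_mx 0 i) E (rr x * TT x / (2 * sqnorm x) * spatial x i).
Proof.
move=> Ux; have r0 := area_gt0 Ux; have E0 := lapse_gt0 Ux.
have s0 := exterior_sqnorm_gt0 Ux.
have dE := is_derive_comp1 (rp_S prof r0) (is_derive1_sqrt (rp_gt0 prof r0)).
apply: (is_derive_eq (is_derive_of_area i Ux dE)).
by rewrite -/(E x) -/(TT x); field; rewrite !gt_eqF.
Qed.

Lemma is_derive_sqnormV x i : U x ->
  is_derive x (delta_mx 0 i) (fun y => (sqnorm y)^-1)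
    (- 2 / sqnorm x ^+ 2 * spatial x i).
Proof.
move=> Ux; have s0 := exterior_sqnorm_gt0 Ux.
have ds := is_derive_sqnorm x i.
apply: (is_derive_eq (is_derive_inv (lt0r_neq0 s0) ds)).
by rewrite /GRing.scale/=; field; rewrite gt_eqF.
Qed.

Lemma is_derive_areaV x i : U x ->
  is_derive x (delta_mx 0 i) (fun y => (rr y)^-1)
    (- E x / (rr x * sqnorm x) * spatial x i).
Proof.
move=> Ux; have r0 := area_gt0 Ux; have s0 := exterior_sqnorm_gt0 Ux.
have dr := is_derive_area i Ux.
apply: (is_derive_eq (is_derive_inv (lt0r_neq0 r0) dr)).
by rewrite /GRing.scale/=; field; rewrite !gt_eqF.
Qed.

Lemma is_derive_lapseV x i : U x ->
  is_derive x (delta_mx 0 i) (fun y => (E y)^-1)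
    (- (rr x * TT x) / (2 * E x ^+ 2 * sqnorm x) * spatial x i).
Proof.
move=> Ux; have E0 := lapse_gt0 Ux; have s0 := exterior_sqnorm_gt0 Ux.
have dE := is_derive_lapse i Ux.
apply: (is_derive_eq (is_derive_inv (lt0r_neq0 E0) dE)).
by rewrite /GRing.scale/=; field; rewrite !gt_eqF.
Qed.

(** Here [u] and [w] are the logarithmic derivatives of c E and r / |x|. Inverses are kept as
    separate factors, so that the derivatives follow from the product rule and the lemmas on
    inverses above. *)
Let Nf x := c ^+ 2 * E x ^+ 2.
Let Pf x := rr x ^+ 2 * (sqnorm x)^-1.
Let u x := 2^-1 * (rr x * TT x * ((E x)^-1 * (sqnorm x)^-1)).
Let v x := c ^+ 2 / 2 * (E x * TT x * (rr x)^-1).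
Let w x := (E x - 1) * (sqnorm x)^-1.
Let du x := rr x * TT x / (2 * sqnorm x ^+ 2) + rr x ^+ 2 * DD x / (2 * sqnorm x ^+ 2)
  - rr x ^+ 2 * TT x ^+ 2 / (4 * E x ^+ 2 * sqnorm x ^+ 2)
  - rr x * TT x / (E x * sqnorm x ^+ 2).
Let dv x := c ^+ 2 / 2 * (TT x ^+ 2 / (2 * sqnorm x)
  + E x ^+ 2 * DD x / sqnorm x - E x ^+ 2 * TT x / (rr x * sqnorm x)).
Let dw x := rr x * TT x / (2 * sqnorm x ^+ 2) - 2 * (E x - 1) / sqnorm x ^+ 2.

Lemma is_derive_TT x i : U x ->
  is_derive x (delta_mx 0 i) TT (DD x * (rr x * E x / sqnorm x) * spatial x i).
Proof. by move=> Ux; exact: (is_derive_of_area i Ux (rp_T prof (area_gt0 Ux))). Qed.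

Lemma is_derive_N x i : U x ->
  is_derive x (delta_mx 0 i) Nf (2 * Nf x * u x * spatial x i).
Proof.
move=> Ux; have E0 := lapse_gt0 Ux; have s0 := exterior_sqnorm_gt0 Ux.
have dE := is_derive_lapse i Ux.
apply: (is_derive_eq (is_deriveZ (c ^+ 2) (is_deriveX 2 dE))).
by rewrite /Nf /u /GRing.scale/= /GRing.scale/= ?fctE; field; rewrite !gt_eqF.
Qed.

Lemma is_derive_P x i : U x ->
  is_derive x (delta_mx 0 i) Pf (2 * Pf x * w x * spatial x i).
Proof.
move=> Ux; have s0 := exterior_sqnorm_gt0 Ux.
have dr := is_derive_area i Ux.
apply: (is_derive_eq (is_deriveM (is_deriveX 2 dr) (is_derive_sqnormV i Ux))).
by rewrite /Pf /w /GRing.scale/= /GRing.scale/= ?fctE; field; rewrite !gt_eqF.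
Qed.

Lemma is_derive_u x i : U x -> is_derive x (delta_mx 0 i) u (du x * spatial x i).
Proof.
move=> Ux; have E0 := lapse_gt0 Ux; have s0 := exterior_sqnorm_gt0 Ux.
have dr := is_derive_area i Ux.
apply: (is_derive_eq (is_deriveZ (2^-1) (is_deriveM (is_deriveM dr (is_derive_TT i Ux))
  (is_deriveM (is_derive_lapseV i Ux) (is_derive_sqnormV i Ux))))).
by rewrite /du /GRing.scale/= /GRing.scale/= ?fctE; field; rewrite !gt_eqF.
Qed.

Lemma is_derive_v x i : U x -> is_derive x (delta_mx 0 i) v (dv x * spatial x i).
Proof.
move=> Ux; have s0 := exterior_sqnorm_gt0 Ux; have r0 := area_gt0 Ux.
apply: (is_derive_eq (is_deriveZ (c ^+ 2 / 2) (is_deriveM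
  (is_deriveM (is_derive_lapse i Ux) (is_derive_TT i Ux)) (is_derive_areaV i Ux)))).
by rewrite /dv /GRing.scale/= /GRing.scale/= ?fctE; field; rewrite !gt_eqF.
Qed.

Lemma is_derive_w x i : U x -> is_derive x (delta_mx 0 i) w (dw x * spatial x i).
Proof.
move=> Ux; have s0 := exterior_sqnorm_gt0 Ux.
apply: (is_derive_eq (is_deriveM (is_deriveB (is_derive_lapse i Ux)
  (is_derive_cst (1 : R) x (delta_mx 0 i))) (is_derive_sqnormV i Ux))).
by rewrite /dw /GRing.scale/= /GRing.scale/= ?fctE; field; rewrite !gt_eqF.
Qed.

(** [A] is the eigenvalue of the mixed Einstein tensor in the time and radial directions, [B] the
    one tangent to the spheres; the spatial block is A times the projection x_i x_j / |x|^2 plus B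
    times the complementary one. *)
Let A x := (rr x * TT x + E x ^+ 2 - 1) / rr x ^+ 2.
Let B x := TT x / rr x + DD x / 2.

Variable g : 'rV[R]_4 -> 'M[R]_4.
Hypothesis gE : forall x, U x -> g x =
  \matrix_(i, j) if i != j then 0 else if i == 0 then - Nf x else Pf x.

Lemma N_neq0 x : U x -> Nf x != 0.
Proof. by move=> Ux; rewrite mulf_neq0 ?sqrf_eq0 ?gt_eqF ?lapse_gt0. Qed.

Lemma P_neq0 x : U x -> Pf x != 0.
Proof.
move=> Ux; rewrite mulf_neq0 ?sqrf_eq0 ?invr_eq0 ?gt_eqF ?area_gt0//.
exact: exterior_sqnorm_gt0.
Qed.

Lemma vE x : U x -> v x = Nf x * u x / Pf x.
Proof.
move=> Ux; have E0 := lapse_gt0 Ux; have s0 := exterior_sqnorm_gt0 Ux.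
have r0 := area_gt0 Ux.
by rewrite /v /Nf /u /Pf; field; rewrite !gt_eqF.
Qed.

Lemma christoffel_spherical k i j x : U x ->
  christoffel g k i j x = chr u v w x k i j.
Proof.
exact: (christoffel_static oU gE N_neq0 P_neq0 is_derive_N is_derive_P vE).
Qed.

Lemma einstein_spherical x : U x -> einstein g x = \matrix_(i, j)
  if (i == 0 :> nat) || (j == 0 :> nat) then A x *+ (i == j :> nat)
  else (A x - B x) / sqnorm x * spatial x i * spatial x j + B x *+ (i == j :> nat).
Proof.
move=> Ux; have E0 := lapse_gt0 Ux; have s0 := exterior_sqnorm_gt0 Ux.
have r0 := area_gt0 Ux.
rewrite (einstein_static oU gE N_neq0 P_neq0 is_derive_N is_derive_P vE
  is_derive_u is_derive_v is_derive_w)//.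
apply/matrixP => i j; rewrite !mxE; case: ifPn => _.
  congr (_ *+ _); rewrite /Nf /Pf /v /u /w /du /dv /dw /A.
  by field; rewrite !gt_eqF.
congr (_ * _ * _ + _ *+ _).
  by rewrite /Nf /Pf /v /u /w /du /dv /dw /A /B; field; rewrite !gt_eqF.
by rewrite /Nf /Pf /v /u /w /du /dv /dw /A /B; field; rewrite !gt_eqF.
Qed.

Let V x := c * E x * rr x ^+ 3 / space_norm x ^+ 3.

Lemma vol_density_spherical x : U x ->
  vol_density g x = V x.
Proof.
move=> Ux; rewrite /vol_density (det_static gE)//.
have E0 := lapse_gt0 Ux; have n0 := exterior_norm_gt0 Ux.
have r0 := area_gt0 Ux.
rewrite /V /Nf /Pf -space_norm_sqr.
have -> : - (c ^+ 2 * E x ^+ 2) * (rr x ^+ 2 / space_norm x ^+ 2) ^+ 3 =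
  - (c * E x * rr x ^+ 3 / space_norm x ^+ 3) ^+ 2 by field; rewrite !gt_eqF.
rewrite normrN ger0_norm ?sqr_ge0// sqrtr_sqr ger0_norm//.
by rewrite !(mulr_ge0, exprn_ge0, invr_ge0) // ltW.
Qed.

(** [div] will turn out to be the radial coefficient of two vectors: the coordinate divergence of
    the densitised Einstein tensor and its contraction with the Christoffel symbols. That they agree
    is the pointwise Bianchi identity. *)
Let C x := (A x - B x) / sqnorm x.
Let div x := V x * (A x * u x + w x * (A x + 2 * B x)).

Lemma A_BC x : U x -> A x = B x + C x * sqnorm x.
Proof.
by move=> Ux; rewrite /C mulfVK ?gt_eqF ?exterior_sqnorm_gt0// addrC subrK.
Qed.

Lemma is_derive_V x i : U x ->
  is_derive x (delta_mx 0 i) V (V x * (u x + 3 * w x) * spatial x i).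
Proof.
move=> Ux; have E0 := lapse_gt0 Ux; have n0 := exterior_norm_gt0 Ux.
have dn := is_derive_space_norm i n0; have dr := is_derive_area i Ux.
have dE := is_derive_lapse i Ux.
have dn3 := @is_derive_inv _ _ (fun y => space_norm y ^+ 3) _ _ _
  (expf_neq0 3 (lt0r_neq0 n0)) (is_deriveX 3 dn).
apply: (is_derive_eq (is_deriveM (is_deriveM (is_deriveZ c dE) (is_deriveX 3 dr)) dn3)).
rewrite /V /u /w -space_norm_sqr ?fctE /GRing.scale/= /GRing.scale/= ?fctE.
by field; rewrite !gt_eqF.
Qed.

(** This is A'(r) = 2 (B - A) / r, the radial Bianchi identity: differentiating r T + S - 1 gives r
    D + 2 T = 2 r B. *)
Lemma is_derive_A x i : U x ->
  is_derive x (delta_mx 0 i) A (- 2 * C x * E x * spatial x i).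
Proof.
move=> Ux; have r0 := area_gt0 Ux; have s0 := exterior_sqnorm_gt0 Ux.
have dr := is_derive_area i Ux; have dT := is_derive_TT i Ux.
have dE := is_derive_lapse i Ux.
have dr2 := @is_derive_inv _ _ (fun y => rr y ^+ 2) _ _ _
  (expf_neq0 2 (lt0r_neq0 r0)) (is_deriveX 2 dr).
apply: (is_derive_eq (is_deriveM (is_deriveB (is_deriveD (is_deriveM dr dT)
  (is_deriveX 2 dE)) (is_derive_cst (1 : R) x (delta_mx 0 i))) dr2)).
rewrite /C /A /B /GRing.scale/= /GRing.scale/= ?fctE.
by field; rewrite !gt_eqF.
Qed.

Let dB x := (DD x / rr x - TT x / rr x ^+ 2 + W (rr x) / 2) * (rr x * E x / sqnorm x).

Lemma is_derive_B x i : U x ->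
  is_derive x (delta_mx 0 i) B (dB x * spatial x i).
Proof.
move=> Ux; have r0 := area_gt0 Ux; have s0 := exterior_sqnorm_gt0 Ux.
have dr := is_derive_area i Ux; have dT := is_derive_TT i Ux.
have dD := is_derive_of_area i Ux (rp_D prof r0).
have dr1 := is_derive_inv (lt0r_neq0 r0) dr.
apply: (is_derive_eq (is_deriveD (is_deriveM dT dr1)
  (is_deriveM dD (is_derive_cst (2^-1 : R) x (delta_mx 0 i))))).
rewrite /dB /DD /TT /GRing.scale/= /GRing.scale/= ?fctE.
by field; rewrite !gt_eqF.
Qed.

(** The Einstein tensor times the volume density; its covariant divergence consists of plain partial
    derivatives and a single Christoffel contraction. *)
Definition stress (mu nu : 'I_4) x :=
  if (mu == 0 :> nat) || (nu == 0 :> nat) then V x * A x *+ (mu == nu :> nat)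
  else V x * C x * spatial x mu * spatial x nu + V x * B x *+ (mu == nu :> nat).

Lemma vol_einstein mu nu x : U x -> vol_density g x * einstein g x mu nu = stress mu nu x.
Proof.
move=> Ux; rewrite vol_density_spherical// einstein_spherical// mxE /stress.
by case: ifP => _; rewrite -?/(C x) ?mulrnAr// mulrDr !mulrA mulrnAr.
Qed.

Lemma C1on_area : C1on U rr.
Proof.
have cn := C1on_space_norm oU exterior_norm_gt0.
apply: (C1on_comp (K := [set y | rho0 < y]) oU cn) => [x //|y /= y0|y /= y0].
  exact: (rp_rad prof y0).
have drad := rp_rad prof y0; have r0 := rp_rad_gt0 prof y0.
have cr := is_derive_continuous drad.
have cS := is_derive_continuous (rp_S prof r0).
apply: (continuousM (s := fun y => rad y * Num.sqrt (S (rad y))) (t := GRing.inv)).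
  apply: (continuousM (s := rad) (t := Num.sqrt \o (S \o rad)) cr).
  apply: continuous_comp; last exact: sqrt_continuous.
  exact: (continuous_comp cr cS).
apply: (continuousV (s := id)); first by rewrite gt_eqF// (lt_trans rho0_gt0).
exact: cvg_id.
Qed.

Lemma C1on_of_area (f df : R -> R) :
  (forall r : R, 0 < r -> is_derive r (1 : R) f (df r)) ->
  (forall r : R, 0 < r -> {for r, continuous df}) -> C1on U (fun x => f (rr x)).
Proof.
move=> fd cdf; apply: (C1on_comp (K := [set y | 0 < y]) oU C1on_area) => //.
exact: area_gt0.
Qed.

Lemma C1on_lapse : C1on U E.
Proof.
have cS : C1on U (fun x => S (rr x)).
  apply: C1on_of_area (rp_S prof) _ => r r0.
  exact: is_derive_continuous (rp_T prof r0).
apply: (C1on_comp (K := [set y | 0 < y]) (dh := fun y => (2 * Num.sqrt y)^-1) oU cS).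
- by move=> x Ux; exact: (rp_gt0 prof (area_gt0 Ux)).
- move=> y /= y0; apply: continuousV; first by rewrite mulf_neq0// gt_eqF// sqrtr_gt0.
  apply: (@continuousM _ _ (cst 2) Num.sqrt); last exact: sqrt_continuous.
  exact: cst_continuous.
Qed.

(** The second derivative of S occurs in [B], so this is where the continuity of the third one, [W],
    is used. *)
Lemma C1on_stress mu nu : C1on U (stress mu nu).
Proof.
have pos (f : 'rV[R]_4 -> R) : (forall x, U x -> 0 < f x) -> forall x, U x -> f x != 0.
  by move=> f0 x /f0 /lt0r_neq0.
have cni := C1onV oU (pos _ exterior_norm_gt0) (C1on_space_norm oU exterior_norm_gt0).
have cri := C1onV oU (pos _ area_gt0) C1on_area.
have csi := C1onV oU (pos _ exterior_sqnorm_gt0) (C1on_sqnorm oU).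
have cT : C1on U TT.
  by apply: C1on_of_area (rp_T prof) _ => r /(rp_D prof) /is_derive_continuous.
have cD : C1on U DD by apply: C1on_of_area (rp_D prof) (rp_W prof).
have cst a := C1on_cst a oU.
have cA : C1on U A.
  have h := C1onM oU (C1onD oU (C1onD oU (C1onM oU C1on_area cT) (C1onX 2 oU C1on_lapse))
    (cst (-1))) (C1onX 2 oU cri).
  by apply: (C1on_eq oU _ h) => x Ux; rewrite /A exprVn.
have cB : C1on U B := C1onD oU (C1onM oU cT cri) (C1onM oU cD (cst (2^-1))).
have cC : C1on U C.
  have h := C1onM oU (C1onD oU cA (C1onM oU (cst (-1)) cB)) csi.
  by apply: (C1on_eq oU _ h) => x Ux; rewrite mulN1r.
have cV : C1on U V.
  have h := C1onM oU (C1onM oU (C1onM oU (cst c) C1on_lapse) (C1onX 3 oU C1on_area))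
    (C1onX 3 oU cni).
  by apply: (C1on_eq oU _ h) => x Ux; rewrite exprVn.
have mulrnE (f : 'rV[R]_4 -> R) b : (fun x => f x *+ b) = (fun x => f x * b%:R).
  by apply/funext => x; rewrite mulr_natr.
rewrite /stress; case: (_ || _).
  by rewrite mulrnE; exact: (C1onM oU (C1onM oU cV cA) (cst _)).
have sp i := C1on_spatial i oU.
apply: (C1onD oU (C1onM oU (C1onM oU (C1onM oU cV cC) (sp mu)) (sp nu))).
by rewrite mulrnE; exact: (C1onM oU (C1onM oU cV cB) (cst _)).
Qed.

Lemma partial_stress (m mu nu : 'I_4) (x : 'rV[R]_4) : U x ->
  let d (i : 'I_4) : R := ((m == i :> nat) && (i != 0 :> nat))%:R in
  partial m (stress mu nu) x =
  if (mu == 0 :> nat) || (nu == 0 :> nat)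
  then V x * ((u x + 3 * w x) * A x - 2 * C x * E x) * spatial x m *+ (mu == nu :> nat)
  else V x * ((u x + 3 * w x) * C x - (2 * C x * (E x + 1) + dB x) / sqnorm x)
         * spatial x m * spatial x mu * spatial x nu
       + V x * C x * (d mu * spatial x nu + d nu * spatial x mu)
       + V x * ((u x + 3 * w x) * B x + dB x) * spatial x m *+ (mu == nu :> nat).
Proof.
move=> Ux d; have s0 := exterior_sqnorm_gt0 Ux.
have dV := is_derive_V m Ux; have dA := is_derive_A m Ux.
have dB' := is_derive_B m Ux; have ds := is_derive_sqnormV m Ux.
rewrite /stress; case: (_ || _).
  have dn := is_deriveZ ((mu == nu :> nat)%:R : R) (is_deriveM dV dA).
  rewrite (_ : (fun y => V y * A y *+ (mu == nu :> nat)) =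
    (mu == nu :> nat)%:R \*: (V * A)); last first.
    by apply/funext => y; rewrite -mulr_natl.
  rewrite /partial (derive_val (is_derive := dn)) /GRing.scale/= /GRing.scale/=.
  by rewrite -[RHS]mulr_natl; ring.
have dC := is_deriveM (is_deriveB dA dB') ds.
have dmu := is_derive_spatial x m mu; have dnu := is_derive_spatial x m nu.
have dn := is_deriveD (is_deriveM (is_deriveM (is_deriveM dV dC) dmu) dnu)
  (is_deriveZ ((mu == nu :> nat)%:R : R) (is_deriveM dV dB')).
rewrite (_ : (fun y => _ + _) = V * ((A - B) * (fun y => (sqnorm y)^-1)) * spatial^~ mu
  * spatial^~ nu + (mu == nu :> nat)%:R \*: (V * B)); last first.
  by apply/funext => y; rewrite !fctE /= -[X in _ + X = _]mulr_natl.
rewrite /partial (derive_val (is_derive := dn)) -/(d mu) -/(d nu) !fctE.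
rewrite /GRing.scale/= /GRing.scale/= -[X in _ = _ + X]mulr_natl /C.
by field; rewrite gt_eqF.
Qed.

(** The derivative of [B] cancels, because [B] multiplies the projection onto the tangent spaces of
    the spheres and its gradient is radial. *)
Lemma div_stress nu x : U x ->
  \sum_mu partial mu (stress mu nu) x = div x * spatial x nu.
Proof.
move=> Ux; have s0 := exterior_sqnorm_gt0 Ux.
under eq_bigr do rewrite partial_stress//.
rewrite sum4.
(* Eliminating the lapse in favour of [w] turns the term -2 C (E - 1) into -2 w (A - B), which
   completes [div]. *)
have -> : E x = w x * sqnorm x + 1 by rewrite /w mulfVK ?gt_eqF ?subrK.
rewrite /div (A_BC Ux); have sp0 : spatial x o0 = 0 by [].
move: s0; rewrite /sqnorm; move: (dB x) (C x) (B x) (u x) (w x) (V x) => *.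
move: nu; apply: ord4P; rewrite /= ?sp0 ?mulr1n ?mulr0n; field.
all: by rewrite ?gt_eqF.
Qed.

Lemma stress_christoffel l x : U x ->
  \sum_mu \sum_nu stress mu nu x * chr u v w x nu mu l = div x * spatial x l.
Proof.
move=> Ux; rewrite !sum4 /stress /chr /div (A_BC Ux) /sqnorm.
have sp0 : spatial x o0 = 0 by [].
move: (C x) (B x) (u x) (v x) (w x) (V x) => *.
by move: l; apply: ord4P; rewrite /= ?sp0 ?mulr1n ?mulr0n; ring.
Qed.

(** * Estimates near the center *)

Section bounds.
Hypothesis reg : regular_center rho0 S T D rad.

Lemma center_bound (rho1 : R) : exists K R1 : R, [/\ 0 < K, 0 < R1 &
  forall x : 'rV[R]_4, U x -> space_norm x <= rho1 -> [/\ rr x <= R1,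
    `|rr x * TT x + E x ^+ 2 - 1| <= K, `|B x| <= K & rr x * E x ^+ 2 <= K]].
Proof.
have [R1 R10 hR] := rc_rad_bound reg rho1; have [K K0 hK] := rc_bound reg R1.
exists K, R1; split => // x Ux xr; have rR : rr x <= R1 by apply: hR; apply/andP.
have [|h1 h2 h3] := hK (rr x); first by rewrite area_gt0.
by rewrite lapse_sqr.
Qed.

Lemma spatial_le (x : 'rV[R]_4) i : `|spatial x i| <= space_norm x.
Proof.
rewrite space_normE -sqrtr_sqr ler_wsqrtr//.
have ? := sqr_ge0 (spatial x o1); have ? := sqr_ge0 (spatial x o2).
have ? := sqr_ge0 (spatial x o3).
have s0 : spatial x o0 = 0 by [].
rewrite /sqnorm; move: i; apply: ord4P; rewrite ?s0.
all: move: (spatial x o1) (spatial x o2) (spatial x o3) => *; nra.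
Qed.

Lemma inv_norm_le n (x : 'rV[R]_4) : U x -> (space_norm x ^+ n)^-1 <= (rho0 ^+ n)^-1.
Proof.
move=> Ux; have n0 := exterior_norm_gt0 Ux.
by rewrite lef_pV2 ?posrE ?exprn_gt0// lerXn2r ?nnegrE// ltW.
Qed.

(** Since V = (c / rho^3) r^2 (r E), the bounds on r^2 A and on B leave one factor r E. It is not
    yet replaced by its bound of order sqrt r: the gradient of the cutoff supplies another E, and r
    E^2 is bounded. *)
Lemma stress_bound (rho1 : R) : exists2 K, 0 <= K &
  forall x : 'rV[R]_4, U x -> space_norm x <= rho1 ->
  forall mu nu, `|stress mu nu x| <= K * (rr x * E x).
Proof.
have [C0 [R1 [C0_gt0 R1_gt0 h]]] := center_bound rho1.
exists (c / rho0 ^+ 3 * (C0 + 2 * (R1 ^+ 2 * C0))).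
  by rewrite !(mulr_ge0, addr_ge0, invr_ge0, exprn_ge0)// ltW.
move=> x Ux /(h x Ux)[rR hA hB _] mu nu.
have r0 := area_gt0 Ux; have E0 := lapse_gt0 Ux; have n0 := exterior_norm_gt0 Ux.
have s0 := exterior_sqnorm_gt0 Ux.
have rE0 : 0 <= rr x * E x by rewrite mulr_ge0// ltW.
have K0 : 0 <= c / space_norm x ^+ 3 <= c / rho0 ^+ 3.
  rewrite ler_pM2l// inv_norm_le// andbT divr_ge0// ?exprn_ge0// ltW//.
have kA : `|V x * A x| <= c / rho0 ^+ 3 * C0 * (rr x * E x).
  have -> : V x * A x = c / space_norm x ^+ 3 * (rr x * TT x + E x ^+ 2 - 1) *
    (rr x * E x) by rewrite /V /A; field; rewrite !gt_eqF.
  rewrite normrM (ger0_norm rE0) ler_wpM2r// normrM ger0_norm; last by case/andP: K0.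
  by case/andP: K0 => *; rewrite ler_pM.
have kB : `|V x * B x| <= c / rho0 ^+ 3 * (R1 ^+ 2 * C0) * (rr x * E x).
  have -> : V x * B x = c / space_norm x ^+ 3 * (rr x ^+ 2 * B x) *
    (rr x * E x) by rewrite /V; field; rewrite !gt_eqF.
  rewrite normrM (ger0_norm rE0) ler_wpM2r// normrM ger0_norm; last by case/andP: K0.
  case/andP: K0 => *; rewrite ler_pM// normrM ger0_norm ?sqr_ge0// ler_pM//.
    by rewrite sqr_ge0.
  by rewrite lerXn2r ?nnegrE// ltW.
have kB0 := le_trans (normr_ge0 _) kB.
rewrite /stress; case: ifP => _.
  have : `|V x * A x *+ (mu == nu :> nat)| <= `|V x * A x|.
    by case: (_ == _); rewrite ?mulr1n// mulr0n normr0 normr_ge0.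
  lra.
have k1 : `|V x * C x * spatial x mu * spatial x nu| <= `|V x * A x| + `|V x * B x|.
  have -> : V x * C x * spatial x mu * spatial x nu =
    (V x * A x - V x * B x) * (spatial x mu * spatial x nu / sqnorm x).
    by rewrite /C; field; rewrite gt_eqF.
  rewrite normrM; apply: (@le_trans _ _ (`|V x * A x - V x * B x| * 1)); last first.
    by rewrite mulr1 ler_normB.
  rewrite ler_wpM2l// normrM normfV (ger0_norm (ltW s0)) ler_pdivrMr// mul1r.
  by rewrite -space_norm_sqr expr2 normrM ler_pM// spatial_le.
have k2 : `|V x * B x *+ (mu == nu :> nat)| <= `|V x * B x|.
  by case: (_ == _); rewrite ?mulr1n// mulr0n normr0 normr_ge0.
apply: le_trans (ler_normD _ _) _; lra.
Qed.

(** The Christoffel coefficients need not be bounded, but their products with the stress are: in V A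
    u the lapse cancels and a multiple of r^2 T remains, while V w carries the factor r E^2 - r
    E. *)
Lemma div_bound (rho1 : R) : exists2 K, 0 <= K &
  forall x : 'rV[R]_4, U x -> space_norm x <= rho1 -> `|div x| <= K.
Proof.
have [C0 [R1 [C0_gt0 R1_gt0 h]]] := center_bound rho1.
exists (c / rho0 ^+ 5 * (C0 * (R1 * C0 + C0 + R1) / 2 +
  (C0 + (1 + R1 * C0)) * (C0 + 2 * (R1 ^+ 2 * C0)))).
  by rewrite !(mulr_ge0, addr_ge0, invr_ge0, exprn_ge0)// ltW.
move=> x Ux /(h x Ux)[rR hA hB hE].
have r0 := area_gt0 Ux; have E0 := lapse_gt0 Ux; have n0 := exterior_norm_gt0 Ux.
have K0 : 0 <= c / space_norm x ^+ 5 <= c / rho0 ^+ 5.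
  by rewrite ler_pM2l// inv_norm_le// andbT divr_ge0// ?exprn_ge0// ltW.
set a := rr x * TT x + E x ^+ 2 - 1 in hA *.
have -> : div x = c / space_norm x ^+ 5 * (a * (rr x ^+ 2 * TT x) / 2 +
  (rr x * E x ^+ 2 - rr x * E x) * (a + 2 * (rr x ^+ 2 * B x))).
  by rewrite /div /V /A /u /w -space_norm_sqr -/a; field; rewrite !gt_eqF.
have rC : 0 <= rr x * E x ^+ 2 by rewrite mulr_ge0 ?sqr_ge0// ltW.
have hT : `|rr x ^+ 2 * TT x| <= R1 * C0 + C0 + R1.
  (* The definition of [a], solved for T; no bound on T itself is at hand. *)
  have -> : rr x ^+ 2 * TT x = rr x * a - rr x * E x ^+ 2 + rr x.
    by rewrite /a; ring.
  apply: le_trans (ler_normD _ _) _; rewrite (ger0_norm (ltW r0)) lerD//.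
  apply: le_trans (ler_normB _ _) _; rewrite (ger0_norm rC) lerD//.
  by rewrite normrM (ger0_norm (ltW r0)) ler_pM// ltW.
have hrE : `|rr x * E x ^+ 2 - rr x * E x| <= C0 + (1 + R1 * C0).
  apply: le_trans (ler_normB _ _) _; rewrite (ger0_norm rC) lerD//.
  rewrite ger0_norm ?mulr_ge0 ?ltW//.
  (* With y = r E, a bound on y^2 gives one on y through y <= 1 + y^2. *)
  have : rr x * (rr x * E x ^+ 2) <= R1 * C0 by rewrite ler_pM// ltW.
  have := sqr_ge0 (rr x * E x - 1); have : 0 <= (rr x * E x) ^+ 2 := sqr_ge0 _.
  have -> : rr x * (rr x * E x ^+ 2) = (rr x * E x) ^+ 2 by ring.
  move: (rr x * E x) => y; nra.
have hB2 : `|a + 2 * (rr x ^+ 2 * B x)| <= C0 + 2 * (R1 ^+ 2 * C0).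
  apply: le_trans (ler_normD _ _) _; rewrite lerD// normrM ger0_norm// ler_wpM2l//.
  rewrite normrM ger0_norm ?sqr_ge0// ler_pM// ?sqr_ge0// lerXn2r ?nnegrE// ltW//.
rewrite normrM ger0_norm; last by case/andP: K0.
case/andP: K0 => *; rewrite ler_pM//; apply: le_trans (ler_normD _ _) _.
rewrite lerD//; last by rewrite normrM ler_pM.
by rewrite normrM (@ger0_norm _ 2^-1)// ler_wpM2r// normrM ler_pM.
Qed.

Lemma area_lapse_bound (rho1 : R) : exists2 K, 0 <= K &
  forall x : 'rV[R]_4, U x -> space_norm x <= rho1 ->
    rr x * E x ^+ 2 <= K /\ rr x * E x <= Num.sqrt (K * rr x).
Proof.
have [C0 [R1 [C0_gt0 R1_gt0 h]]] := center_bound rho1.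
exists C0; first exact: ltW.
move=> x Ux /(h x Ux)[rR _ _ hE]; split => //.
have r0 := area_gt0 Ux; have E0 := lapse_gt0 Ux.
have rE0 : 0 <= rr x * E x by rewrite mulr_ge0// ltW.
rewrite -(ger0_norm rE0) -sqrtr_sqr; apply: ler_wsqrtr.
have -> : (rr x * E x) ^+ 2 = rr x * E x ^+ 2 * rr x by ring.
by rewrite ler_wpM2r// ltW.
Qed.

End bounds.

(** * The density as a divergence, and the cutoff *)

Lemma bianchi_density_stress psi x : U x -> bianchi_density g psi x =
  \sum_mu \sum_nu stress mu nu x * partial mu (fun y => psi y 0 nu) x
  + div x * \sum_l spatial x l * psi x 0 l.
Proof.
move=> Ux; rewrite /bianchi_density /cov_deriv.
transitivity (\sum_mu \sum_nu (stress mu nu x * partial mu (fun y => psi y 0 nu) x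
  + \sum_l stress mu nu x * chr u v w x nu mu l * psi x 0 l)).
  rewrite mulr_suml; apply: eq_bigr => mu _; rewrite mulr_suml; apply: eq_bigr => nu _.
  rewrite mulrC mulrA vol_einstein// mulrDr; congr (_ + _).
  by rewrite mulr_sumr; apply: eq_bigr => l _; rewrite christoffel_spherical// mulrA.
under eq_bigr do rewrite big_split/=.
rewrite big_split/=; congr (_ + _).
under eq_bigr do rewrite exchange_big/=.
rewrite exchange_big/= mulr_sumr; apply: eq_bigr => l _.
rewrite mulrA -(stress_christoffel l Ux) mulr_suml; apply: eq_bigr => mu _.
by rewrite mulr_suml.
Qed.

(** In the product rule the derivative of the stress contributes [div] times x_nu, which is exactly
    the Christoffel part of the density. Only the gradient of [chi] is left over. *)
Lemma div_cutoff (chi : 'rV[R]_4 -> R) (psi : 'rV[R]_4 -> 'rV[R]_4) x :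
  C1on U chi -> (forall nu, C1on U (fun y => psi y 0 nu)) -> U x ->
  \sum_mu partial mu (fun y => chi y * \sum_nu stress mu nu y * psi y 0 nu) x =
  chi x * bianchi_density g psi x
  + \sum_mu \sum_nu partial mu chi x * (stress mu nu x * psi x 0 nu).
Proof.
move=> cchi cpsi Ux; rewrite bianchi_density_stress//.
transitivity (\sum_mu (chi x * \sum_nu (stress mu nu x * partial mu (fun y => psi y 0 nu) x
  + psi x 0 nu * partial mu (stress mu nu) x)
  + \sum_nu partial mu chi x * (stress mu nu x * psi x 0 nu))).
  apply: eq_bigr => mu _.
  have ds nu := C1on_is_derive mu (@C1on_stress mu nu) Ux.
  have dp nu := C1on_is_derive mu (cpsi nu) Ux.
  have dn := is_deriveM (C1on_is_derive mu cchi Ux)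
    (is_derive_sum (fun nu => is_deriveM (ds nu) (dp nu))).
  rewrite /partial.
  rewrite (_ : (fun y => _) = chi * (\sum_nu stress mu nu * (fun y => psi y 0 nu))).
    rewrite (derive_val (is_derive := dn)) /GRing.scale/=; congr (_ + _).
    by rewrite mulrC fct_sumE mulr_sumr.
  by apply/funext => y; rewrite !fctE fct_sumE.
rewrite big_split/=; congr (_ + _); rewrite -mulr_sumr; congr (_ * _).
under [LHS]eq_bigr do rewrite big_split/=.
rewrite big_split/=; congr (_ + _); rewrite exchange_big/= mulr_sumr.
apply: eq_bigr => nu _; rewrite -mulr_sumr div_stress//; ring.
Qed.

Lemma bianchi_density_bound (rho1 M : R) :
  regular_center rho0 S T D rad -> 0 <= M ->
  exists2 K, 0 <= K & forall (psi : 'rV[R]_4 -> 'rV[R]_4) x, U x -> space_norm x <= rho1 ->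
    (forall nu, `|psi x 0 nu| <= M) ->
    (forall mu nu, `|partial mu (fun y => psi y 0 nu) x| <= M) ->
    `|bianchi_density g psi x| <= K.
Proof.
move=> reg M0; have [K1 K10 hK1] := stress_bound reg rho1.
have [K2 K20 hK2] := div_bound reg rho1.
have [K3 K30 hK3] := area_lapse_bound reg rho1.
have [R1 R10 hR] := rc_rad_bound reg rho1.
exists (\sum_(mu < 4) \sum_(nu < 4) (K1 * Num.sqrt (K3 * R1) * M)
  + K2 * \sum_(l < 4) (`|rho1| * M)).
  have K13 : 0 <= K1 * Num.sqrt (K3 * R1) * M by rewrite !mulr_ge0 ?sqrtr_ge0.
  rewrite addr_ge0 ?mulr_ge0 ?sumr_ge0// => i _; rewrite ?sumr_ge0 ?mulr_ge0//.
move=> psi x Ux xr hpsi hdpsi; rewrite bianchi_density_stress//.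
apply: le_trans (ler_normD _ _) _; apply: lerD.
  apply: le_trans (ler_norm_sum _ _ _) _; apply: ler_sum => mu _.
  apply: le_trans (ler_norm_sum _ _ _) _; apply: ler_sum => nu _.
  rewrite normrM ler_pM//; apply: le_trans (hK1 x Ux xr mu nu) _.
  rewrite ler_wpM2l//; apply: le_trans (hK3 x Ux xr).2 _.
  by rewrite ler_wsqrtr// ler_wpM2l// hR//; apply/andP.
rewrite normrM ler_pM// ?hK2//.
apply: le_trans (ler_norm_sum _ _ _) _; apply: ler_sum => l _.
rewrite normrM ler_pM//; apply: le_trans (spatial_le x l) _.
by apply: le_trans xr _; exact: ler_norm.
Qed.

(* [n * r] measures the distance to the center, so that the cutoff vanishes
   near the boundary cylinder and tends to 1 as [n] tends to infinity. *)
Definition cutoff (n : R) (x : 'rV[R]_4) : R := Num.max 0 (1 - (n * rr x)^-1) ^+ 2.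

Lemma cutoff_ge0_le1 n x : 0 < n -> U x -> 0 <= cutoff n x <= 1.
Proof.
move=> n0 /area_gt0 r0; rewrite sqr_ge0/= exprn_ile1//; first by rewrite le_max lexx.
by rewrite ge_max ler01/= gerBl invr_ge0 ltW// mulr_gt0.
Qed.

Lemma cutoff_eq0 n x : 0 < n -> U x -> n * rr x <= 1 -> cutoff n x = 0.
Proof.
move=> n0 /area_gt0 r0 nr; rewrite /cutoff max_l ?expr0n//.
by rewrite subr_le0 -[leLHS]invr1 lef_pV2 ?posrE// mulr_gt0.
Qed.

Lemma cutoff_cvg x : U x -> cutoff k.+1%:R x @[k --> \oo] --> (1 : R).
Proof.
move=> Ux; have r0 := area_gt0 Ux.
have h : 1 - (k.+1%:R * rr x)^-1 @[k --> \oo] --> 1 - 0 * (rr x)^-1.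
  apply: cvgB; first exact: cvg_cst.
  under eq_fun do rewrite invfM; apply: cvgM; last exact: cvg_cst.
  exact: cvg_harmonic.
rewrite mul0r subr0 in h.
rewrite /cutoff -[X in _ --> X](_ : Num.max 0 1 ^+ 2 = _).
  exact: (cvg_comp _ _ h (is_derive_continuous (is_derive_pos_sqr (1 : R)))).
by rewrite max_r// expr1n.
Qed.

Lemma is_derive_cutoff n x i : n != 0 -> U x -> is_derive x (delta_mx 0 i) (cutoff n)
  (2 * Num.max 0 (1 - (n * rr x)^-1) * (E x / (n * rr x * sqnorm x)) * spatial x i).
Proof.
move=> n0 Ux; have r0 := area_gt0 Ux; have s0 := exterior_sqnorm_gt0 Ux.
have nr0 : n * rr x != 0 by rewrite mulf_neq0// gt_eqF.
have dr := is_deriveZ n (is_derive_area i Ux).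
have dn := is_deriveB (is_derive_cst (1 : R) x (delta_mx 0 i))
  (@is_derive_inv _ _ (fun y => n * rr y) _ _ _ nr0 dr).
apply: (is_derive_eq (is_derive_comp1 dn (is_derive_pos_sqr _))).
rewrite !fctE /GRing.scale/= sub0r; set y := Num.max _ _.
by field; rewrite n0 !gt_eqF.
Qed.

Lemma C1on_cutoff n : n != 0 -> C1on U (cutoff n).
Proof.
move=> n0; have C1cst a := C1on_cst a oU.
have c1 : C1on U (fun x => 1 + -1 * (n * rr x)^-1).
  apply: (C1onD oU (C1cst 1) (C1onM oU (C1cst (-1)) (C1onV oU _ (C1onM oU (C1cst n) C1on_area)))).
  by move=> x /area_gt0 r0; rewrite mulf_neq0// gt_eqF.
have c2 : C1on U (fun x => Num.max 0 (1 + -1 * (n * rr x)^-1) ^+ 2).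
  apply: (C1on_comp (K := setT) (h := fun y => Num.max 0 y ^+ 2)
    (dh := fun y => 2 * Num.max 0 y) oU c1) => // y _.
    exact: is_derive_pos_sqr.
  have c2 : {for y, continuous (cst 2 : R -> R)} by exact: cst_continuous.
  exact: (continuousM c2 (@pos_part_continuous R y)).
by apply: (C1on_eq oU _ c2) => x _; rewrite /cutoff mulN1r.
Qed.

(** Two estimates of one term: the bound uniform in [n] is for domination, the decaying one for the
    pointwise limit. The gradient of the cutoff brings E z / (n r), and E times the stress is
    bounded because r E^2 is. *)
Lemma cutoff_flux_bound (rho1 M : R) :
  regular_center rho0 S T D rad -> 0 <= M ->
  exists2 K, 0 <= K & forall (n : R) (psi : 'rV[R]_4 -> 'rV[R]_4) x,
    0 < n -> U x -> space_norm x <= rho1 -> (forall nu, `|psi x 0 nu| <= M) ->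
    let t := \sum_mu \sum_nu partial mu (cutoff n) x * (stress mu nu x * psi x 0 nu) in
    `|t| <= K /\ `|t| <= K / (n * rr x).
Proof.
move=> reg M0; have [K1 K10 hK1] := stress_bound reg rho1.
have [K3 K30 hK3] := area_lapse_bound reg rho1.
(* The 2 comes from differentiating the square, 1 / rho0 bounds 1 / |x|, [K1] and [K3] bound the
   stress and r E^2, and the two factors 4 count the indices. *)
exists (2 / rho0 * (K3 * K1) * M *+ 4 *+ 4).
  by rewrite !mulrn_wge0// !mulr_ge0// invr_ge0 ltW.
move=> n psi x n0 Ux xr hpsi /=.
have r0 := area_gt0 Ux; have E0 := lapse_gt0 Ux; have x0 := exterior_norm_gt0 Ux.
have nr0 : 0 < n * rr x by rewrite mulr_gt0.
set z := Num.max 0 (1 - (n * rr x)^-1).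
have z0 : 0 <= z by rewrite le_max lexx.
have z1 : z <= 1 by rewrite ge_max ler01/= gerBl invr_ge0 ltW.
(* For n r < 1 the numerator vanishes; otherwise the denominator is at least 1. *)
have zn : z / (n * rr x) <= 1.
  rewrite ler_pdivrMr// mul1r /z ge_max ltW//=.
  have [h|h] := leP 1 (n * rr x).
    by apply: le_trans h; rewrite gerBl invr_ge0 ltW.
  rewrite (le_trans _ (ltW nr0))// subr_le0 -[leLHS]invr1 lef_pV2 ?posrE//.
  exact: ltW.
have [hE _] := hK3 x Ux xr.
have main : `|\sum_mu \sum_nu partial mu (cutoff n) x * (stress mu nu x * psi x 0 nu)| <=
    2 / rho0 * (K3 * K1) * M *+ 4 *+ 4 * (z / (n * rr x)).
  have -> : 2 / rho0 * (K3 * K1) * M *+ 4 *+ 4 * (z / (n * rr x)) =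
      \sum_(mu < 4) \sum_(nu < 4) (2 / rho0 * (K3 * K1) * M) * (z / (n * rr x)).
    by rewrite !sumr_const !card_ord -!mulrnAl.
  apply: le_trans (ler_norm_sum _ _ _) _; rewrite ler_sum// => mu _.
  apply: le_trans (ler_norm_sum _ _ _) _; rewrite ler_sum// => nu _.
  rewrite /partial; have [_ ->] := is_derive_cutoff mu (lt0r_neq0 n0) Ux; rewrite -/z.
  have -> : 2 * z * (E x / (n * rr x * sqnorm x)) * spatial x mu *
    (stress mu nu x * psi x 0 nu) =
    2 * (spatial x mu / space_norm x / space_norm x) * (E x * stress mu nu x) * psi x 0 nu
      * (z / (n * rr x)).
    by rewrite -space_norm_sqr; field; rewrite !gt_eqF.
  have zn0 : 0 <= z / (n * rr x) by rewrite divr_ge0// ltW.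
  rewrite normrM (ger0_norm zn0) ler_wpM2r// normrM ler_pM//.
  rewrite normrM ler_pM//.
    rewrite normrM ger0_norm// ler_wpM2l// normrM normfV (ger0_norm (ltW x0)).
    rewrite -[leRHS]mul1r ler_pM ?invr_ge0 ?(ltW x0)//.
      rewrite normrM normfV (ger0_norm (ltW x0)) ler_pdivrMr// mul1r.
      exact: spatial_le.
    by rewrite lef_pV2 ?posrE// ltW.
  rewrite normrM (ger0_norm (ltW E0)).
  apply: (@le_trans _ _ (E x * (K1 * (rr x * E x)))); first by rewrite ler_wpM2l ?hK1// ltW.
  have -> : E x * (K1 * (rr x * E x)) = rr x * E x ^+ 2 * K1 by ring.
  by rewrite ler_wpM2r.
set K := _ *+ 4 *+ 4 in main *.
have K0 : 0 <= K by rewrite !mulrn_wge0// !mulr_ge0// invr_ge0 ltW.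
split; apply: le_trans main _; first by rewrite -[leRHS]mulr1 ler_wpM2l.
rewrite mulrA ler_wpM2r//; first by rewrite invr_ge0 ltW.
by rewrite -[leRHS]mulr1 ler_wpM2l.
Qed.

End spherically_symmetric.

(** * Integration over coordinate lines *)

Section fubini_zero.
Local Open Scope ereal_scope.
Context {d1 d2 : measure_display} {T1 : measurableType d1} {T2 : measurableType d2}
  {R : realType}.
Variables (m1 : {sigma_finite_measure set T1 -> \bar R})
  (m2 : {sigma_finite_measure set T2 -> \bar R}).

Lemma integral_prod_eq0l (f : T1 * T2 -> R) :
  (m1 \x m2).-integrable setT (EFin \o f) ->
  (forall x, \int[m2]_y (f (x, y))%:E = 0) -> \int[m1 \x m2]_p (f p)%:E = 0.
Proof.
move=> fi f0; rewrite -(integral12_prod_meas1 fi).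
by apply: integral0_eq => x _; rewrite /fubini_F /=.
Qed.

Lemma integral_prod_eq0r (f : T1 * T2 -> R) :
  (m1 \x m2).-integrable setT (EFin \o f) ->
  (forall y, \int[m1]_x (f (x, y))%:E = 0) -> \int[m1 \x m2]_p (f p)%:E = 0.
Proof.
move=> fi f0; rewrite -(integral21_prod_meas1 fi).
by apply: integral0_eq => x _; rewrite /fubini_G /=.
Qed.

End fubini_zero.

Section product_sigma_finite.
Context {d1 d2 : measure_display} {T1 : measurableType d1} {T2 : measurableType d2}
  {R : realType}.
Variables (m1 : {sigma_finite_measure set T1 -> \bar R})
  (m2 : {sigma_finite_measure set T2 -> \bar R}).

(** A name for the product measure under which it carries a sigma-finite structure, as Fubini's
    theorem requires of the left factor in a nested product. *)
Definition sfprod : set (T1 * T2) -> \bar R := (m1 \x m2)%E.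

HB.instance Definition _ := Measure.on sfprod.

Let product_sigma_finite : sigma_finite setT sfprod.
Proof.
have /sigma_finiteP[F [TF ndF Foo]] := sigma_finiteT m1.
have /sigma_finiteP[G [TG ndG Goo]] := sigma_finiteT m2.
exists (fun n => F n `*` G n) => [|n].
  apply/seteqP; split => // -[x y] _.
  have [n _ Fnx] : (\bigcup_n F n) x by rewrite -TF.
  have [k _ Gky] : (\bigcup_n G n) y by rewrite -TG.
  (* Both exhaustions are increasing, so a common index catches both coordinates. *)
  exists (maxn n k) => //; split => /=.
    by move: x Fnx; exact/subsetPset/ndF/leq_maxl.
  by move: y Gky; exact/subsetPset/ndG/leq_maxr.
have [mF finF] := Foo n; have [mG finG] := Goo n.
split; first exact: measurableX.
by rewrite /sfprod product_measure1E// lte_mul_pinfty// ge0_fin_numE.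
Qed.

HB.instance Definition _ := Measure_isSigmaFinite.Build _ _ _ sfprod
  product_sigma_finite.

End product_sigma_finite.

Section fubini_zero4.
Local Open Scope ereal_scope.
Context {d1 d2 d3 d4 : measure_display} {T1 : measurableType d1}
  {T2 : measurableType d2} {T3 : measurableType d3} {T4 : measurableType d4}
  {R : realType}.
Variables (m1 : {sigma_finite_measure set T1 -> \bar R})
  (m2 : {sigma_finite_measure set T2 -> \bar R})
  (m3 : {sigma_finite_measure set T3 -> \bar R})
  (m4 : {sigma_finite_measure set T4 -> \bar R}).
Variable f : T1 * T2 * T3 * T4 -> R.
Hypothesis f4 : (m1 \x m2 \x m3 \x m4).-integrable setT (EFin \o f).
Hypothesis f3 : forall z,
  (m1 \x m2 \x m3).-integrable setT (EFin \o (fun p => f (p, z))).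
Hypothesis f2 : forall y z,
  (m1 \x m2).-integrable setT (EFin \o (fun p => f (p, y, z))).

Local Notation m12 := (sfprod m1 m2).
Local Notation m123 := (sfprod m12 m3).

(** Slices are integrable for every value of the fixed coordinates, not just almost every, so
    Fubini's theorem applies to each slice until a single line remains. *)
Lemma integral_prod4_eq0_1 :
  (forall x y z, \int[m1]_s (f (s, x, y, z))%:E = 0) ->
  \int[m1 \x m2 \x m3 \x m4]_p (f p)%:E = 0.
Proof.
move=> h; apply: (@integral_prod_eq0r _ _ _ _ R m123 m4 f f4) => z.
apply: (@integral_prod_eq0r _ _ _ _ R m12 m3 _ (f3 z)) => y.
by apply: (integral_prod_eq0r (f2 y z)) => x; exact: h.
Qed.

Lemma integral_prod4_eq0_2 :
  (forall t y z, \int[m2]_s (f (t, s, y, z))%:E = 0) ->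
  \int[m1 \x m2 \x m3 \x m4]_p (f p)%:E = 0.
Proof.
move=> h; apply: (@integral_prod_eq0r _ _ _ _ R m123 m4 f f4) => z.
apply: (@integral_prod_eq0r _ _ _ _ R m12 m3 _ (f3 z)) => y.
by apply: (integral_prod_eq0l (f2 y z)) => x; exact: h.
Qed.

Lemma integral_prod4_eq0_3 :
  (forall t x z, \int[m3]_s (f (t, x, s, z))%:E = 0) ->
  \int[m1 \x m2 \x m3 \x m4]_p (f p)%:E = 0.
Proof.
move=> h; apply: (@integral_prod_eq0r _ _ _ _ R m123 m4 f f4) => z.
by apply: (@integral_prod_eq0l _ _ _ _ R m12 m3 _ (f3 z)) => -[t x]; exact: h.
Qed.

Lemma integral_prod4_eq0_4 :
  (forall t x y, \int[m4]_s (f (t, x, y, s))%:E = 0) ->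
  \int[m1 \x m2 \x m3 \x m4]_p (f p)%:E = 0.
Proof.
move=> h; apply: (@integral_prod_eq0l _ _ _ _ R m123 m4 f f4) => -[[t x] y].
exact: h.
Qed.

End fubini_zero4.

Lemma bounded_support_integrable {d : measure_display} {T : measurableType d}
    {R : realType} (mu : {measure set T -> \bar R}) (K : set T) (M : R) (f : T -> R) :
  measurable K -> (mu K < +oo)%E -> measurable_fun setT f ->
  (forall x, `|f x| <= M) -> (forall x, ~ K x -> f x = 0) ->
  mu.-integrable setT (EFin \o f).
Proof.
move=> mK Kfin mf fM fK.
have fi : mu.-integrable K (EFin \o f).
  apply: measurable_bounded_integrable => //; first exact: measurable_funS mf.
  by exists M; split; rewrite ?num_real// => N MN x _; apply: le_trans (fM x) (ltW MN).
rewrite (_ : EFin \o f = (EFin \o f) \_ K); first by apply/(integrable_mkcond _ mK).1.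
apply/funext => x /=; rewrite patchE; case: ifPn => // /negP xK.
by rewrite fK// => Kx; apply: xK; rewrite inE.
Qed.

(** * Integrals of partial derivatives over the chart *)

Section spacetime_integral.
Context {R : realType}.
Local Notation mu := (@lebesgue_measure R).
Local Notation RR := (measurableTypeR R).

Definition point4 (p : RR * RR * RR * RR) : 'rV[R]_4 :=
  chart_point p.1.1.1 p.1.1.2 p.1.2 p.2.

(** Countably many boxes, with rational center and radius 1 / (n + 1), form a base of the topology
    and consist of measurable rectangles. They link the topology of row vectors to the product
    sigma-algebra. *)
Let box (q : rat * rat * rat * rat * nat) : set (RR * RR * RR * RR) :=
  let e : R := q.2.+1%:R^-1 in
  ball (ratr q.1.1.1.1 : R) e `*` ball (ratr q.1.1.1.2 : R) e
  `*` ball (ratr q.1.1.2 : R) e `*` ball (ratr q.1.2 : R) e.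

Lemma chart_pointE (t x y z : RR) : [/\ chart_point t x y z 0 o0 = t,
  chart_point t x y z 0 o1 = x, chart_point t x y z 0 o2 = y &
  chart_point t x y z 0 o3 = z].
Proof. by rewrite /chart_point !mxE. Qed.

Lemma rV4_norm_lt (x : 'rV[R]_4) (e : R) : 0 < e ->
  (forall i, `|x 0 i| < e) -> `|x| < e.
Proof.
move=> e0 h; rewrite [`|x|]mx_normrE.
by apply: bigmax_lt => // -[i j] _ /=; rewrite ord1.
Qed.

Lemma coord_le_norm (x : 'rV[R]_4) i : `|x 0 i| <= `|x|.
Proof.
rewrite [leRHS]mx_normrE.
exact: (le_bigmax _ (fun ij : 'I_1 * 'I_4 => `|x ij.1 ij.2|) (0, i)).
Qed.

Lemma measurable_point4 (A : set 'rV[R]_4) : open A -> measurable (point4 @^-1` A).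
Proof.
move=> oA; pose F q := if `[< box q `<=` point4 @^-1` A >] then box q else set0.
rewrite (_ : _ @^-1` _ = \bigcup_q F q); last first.
  apply/seteqP; split => [p Ap|p [q _]]; last first.
    by rewrite /F; case: asboolP => [h /h|_ []].
  have /nbhs_ballP[e /= e0 eA] := open_nbhs_nbhs (conj oA Ap : open_nbhs (point4 p) A).
  (* Half of [e], because two points of one box are compared through its center. *)
  have [n ne] : exists n, n.+1%:R^-1 < e / 2.
    have e20 : 0 < e / 2 by rewrite divr_gt0.
    near \oo => n; exists n; near: n.
    exact: (near_infty_natSinv_lt (PosNum e20)).
  have n0 : (0 : R) < n.+1%:R^-1 by rewrite invr_gt0.
  have rat_near (a : R) : exists q : rat, ball (ratr q : R) n.+1%:R^-1 a.
    have [|q] := @rat_in_itvoo R a (a + n.+1%:R^-1); first by rewrite ltrDl.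
    rewrite in_itv/= => /andP[q1 q2]; exists q.
    by rewrite /ball/= ger0_norm ?subr_ge0 ?ltW// ltrBlDl.
  have [q0 h0] := rat_near p.1.1.1; have [q1 h1] := rat_near p.1.1.2.
  have [q2 h2] := rat_near p.1.2; have [q3 h3] := rat_near p.2.
  exists (q0, q1, q2, q3, n) => //; rewrite /F; case: asboolP => [_|]; first by [].
  case=> p' [[[/= b0 b1] b2] b3]; apply: eA; rewrite mx_norm_ball /ball_/=.
  apply: rV4_norm_lt => // i; rewrite !mxE.
  have close (a b q : R) : ball q n.+1%:R^-1 a -> ball q n.+1%:R^-1 b -> `|a - b| < e.
    move=> /ball_sym ha hb; have := ball_triangle ha hb.
    by rewrite /ball/= => /lt_le_trans; apply; rewrite (splitr e) lerD// ltW.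
  move: i; apply: ord4P => /=; [exact: close h0 b0|exact: close h1 b1|
    exact: close h2 b2|exact: close h3 b3].
apply: countable_bigcupT_measurable => // q; rewrite /F; case: ifP => _.
  have mb (a e : R) : measurable (ball a e : set RR) by exact: measurable_realfun.measurable_ball.
  exact: (measurableX (measurableX (measurableX (mb _ _) (mb _ _)) (mb _ _)) (mb _ _)).
exact: measurable0.
Unshelve. all: by end_near. Qed.

Lemma measurable_fun_point4 (f : 'rV[R]_4 -> R) : continuous f ->
  measurable_fun setT (f \o point4).
Proof.
move=> /continuousP cf; apply: (measurability _ (measurable_realfun.RGenOpens.measurableE R)).
move=> _ [_ [a [b ->] <-]]; rewrite setTI.
have oA : open (f @^-1` `]a, b[) by exact/cf/interval_open.
exact: (measurable_point4 oA).
Qed.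

Lemma integral_derive_eq0 (G h : R -> R) (L : R) :
  (forall x, is_derive x (1 : R) G (h x)) -> continuous h ->
  (forall x, L < `|x| -> G x = 0 /\ h x = 0) ->
  (\int[mu]_x (h x)%:E)%E = 0%E.
Proof.
(* Nothing is assumed on the sign of [L]; the bound |L| + 1 is positive and puts both endpoints
   strictly outside the support. *)
move=> dG ch h0; have L1 : `|L| < `|L| + 1 by rewrite ltrDl.
set b := `|L| + 1 in L1.
have b0 : 0 < b by rewrite ltr_wpDl.
have nb : - b < b by lra.
have cG x : {for x, continuous G} by exact: is_derive_continuous (dG x).
have out x : b <= `|x| -> G x = 0 /\ h x = 0.
  by move=> bx; apply: h0; apply: le_lt_trans (ler_norm L) (lt_le_trans L1 bx).
have := @continuous_FTC2 R h G (- b) b nb _ _ _.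
have [-> _] : G b = 0 /\ h b = 0 by apply: out; rewrite gtr0_norm.
have [-> _] : G (- b) = 0 /\ h (- b) = 0 by apply: out; rewrite normrN gtr0_norm.
rewrite sube0 => FTC; transitivity (\int[mu]_(x in `[(- b)%R, b]) (h x)%:E)%E.
- rewrite [RHS]integral_mkcond; apply: eq_integral => x _.
  rewrite patchE; case: ifPn => // xb; rewrite (out x _).2//.
  move: xb; rewrite notin_setE/= in_itv/= => /negP; rewrite -ler_norml -ltNge.
  exact: ltW.
- apply: FTC.
- exact: continuous_subspaceT.
- split=> [x _||]; first by have [] := dG x.
  + exact: cvg_at_right_filter (cG _).
  + exact: cvg_at_left_filter (cG _).
- by move=> x _; rewrite derive1E; have [_ ->] := dG x.
Qed.

(** The extreme value theorem on a cube; with |L| as half side the cube contains 0 and is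
    nonempty. *)
Lemma support_bounded (h : 'rV[R]_4 -> R) (L : R) : continuous h ->
  (forall (x : 'rV[R]_4) i, L < `|x 0 i| -> h x = 0) -> exists2 M, 0 <= M & forall x, `|h x| <= M.
Proof.
move=> ch h0; pose A := [set v : 'rV[R]_4 | forall i, `[- `|L|, `|L|]%classic (v ord0 i)].
have cA : compact A.
  by apply: (@rV_compact _ _ (fun=> `[- `|L|, `|L|]%classic)) => i; exact: segment_compact.
have A0 : A !=set0.
  by exists 0 => i /=; rewrite mxE in_itv/= oppr_le0 normr_ge0.
have cnh : {within A, continuous (fun x => `|h x|)}.
  apply: continuous_subspaceT => x.
  exact: (continuous_comp (ch x) (@norm_continuous _ _ (h x))).
have [v vA hv] := EVT_max_rV A0 cA cnh.
exists `|h v|; first exact: normr_ge0.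
move=> x; have [xA|/existsNP[i]] := pselect (A x); first by apply: hv; rewrite inE.
move=> /negP; rewrite /= in_itv/= -ler_norml -ltNge => xi.
by rewrite (h0 x i) ?normr0// (le_lt_trans (ler_norm L)).
Qed.

Section partial_derivative.
Variables (F : 'rV[R]_4 -> R) (L : R).
Hypothesis cF : C1on setT F.
Hypothesis F0 : forall (x : 'rV[R]_4) i, L < `|x 0 i| -> F x = 0.

(** The strict inequality is an open condition, so [F] vanishes in a whole neighbourhood of [x]. *)
Lemma partial_support i (x : 'rV[R]_4) j : L < `|x 0 j| -> partial i F x = 0.
Proof.
move=> Lx; rewrite /partial -(derive_cst (0 : R) x (delta_mx 0 i)).
apply: near_eq_derive; near=> y; apply: (F0 (i := j)); near: y.
have cj : {for x, continuous (fun y : 'rV[R]_4 => `|y 0 j|)}.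
  apply: (continuous_comp (@coord_continuous _ _ _ 0 j x)).
  exact: norm_continuous.
have := cj; move=> /cvgr_gt; apply.
Unshelve. all: by end_near. Qed.

Lemma partial_continuous i : continuous (partial i F).
Proof. by move=> x; have [_ /(_ i)[]] := cF (I : setT x). Qed.

Lemma integral_line_eq0 i (x : 'rV[R]_4) :
  (\int[mu]_s (partial i F (s *: delta_mx 0 i + x))%:E)%E = 0%E.
Proof.
pose ell (s : R) : 'rV[R]_4 := s *: delta_mx 0 i + x.
have cell : continuous ell.
  move=> s; apply: (@continuousD _ _ _ (fun s : R => s *: (delta_mx 0 i : 'rV[R]_4)) (cst x)).
    exact: scalel_continuous.
  exact: cst_continuous.
(* The line starts at [x], so its coordinate [i] is s + x_i and the support in s is shifted by at
   most |x_i|. *)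
apply: (@integral_derive_eq0 (F \o ell) (partial i F \o ell) (L + `|x 0 i|)).
- move=> s; apply: is_derive_along.
  by apply: C1on_is_derive cF _.
- by move=> s; apply: (continuous_comp (cell s)); exact: partial_continuous.
- move=> s Ls; have Li : L < `|ell s 0 i|.
    rewrite !mxE !eqxx/= mulr1.
    have := ler_normB (s + x 0 i) (x 0 i); rewrite addrK; lra.
  by split; [exact: F0 Li|exact: partial_support Li].
Qed.

Let I : set RR := `[- `|L|, `|L|].
Let mI : measurable I. Proof. exact: measurable_itv. Qed.
Let finI : (mu I < +oo)%E.
Proof. by rewrite lebesgue_measure_itv; case: ifP => // _; rewrite -EFinB ltry. Qed.

Let mI2 := measurableX mI mI.
Let mI3 := measurableX mI2 mI.
Let mI4 := measurableX mI3 mI.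
Let finI2 : ((mu \x mu)%E (I `*` I) < +oo)%E.
Proof.
rewrite product_measure1E; [|exact: mI|exact: mI].
by apply: lte_mul_pinfty => //; rewrite ge0_fin_numE.
Qed.
Let finI3 : ((mu \x mu \x mu)%E (I `*` I `*` I) < +oo)%E.
Proof.
rewrite product_measure1E; [|exact: mI2|exact: mI].
by apply: lte_mul_pinfty => //; rewrite ge0_fin_numE.
Qed.
Let finI4 : ((mu \x mu \x mu \x mu)%E (I `*` I `*` I `*` I) < +oo)%E.
Proof.
rewrite product_measure1E; [|exact: mI3|exact: mI].
by apply: lte_mul_pinfty => //; rewrite ge0_fin_numE.
Qed.

Let notI (x : RR) : ~ I x -> L < `|x|.
Proof.
move=> /negP; rewrite /I /= in_itv/= -ler_norml -ltNge; apply: le_lt_trans.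
exact: ler_norm.
Qed.

Let f i p := partial i F (point4 p).

Let mf i : measurable_fun setT (f i).
Proof. exact: measurable_fun_point4 (@partial_continuous i). Qed.

Let fM i : exists M, forall p, `|f i p| <= M.
Proof.
have [M _ h] := @support_bounded (partial i F) L (@partial_continuous i) (@partial_support i).
by exists M => p; exact: h.
Qed.

Let coord4 (t x y z : RR) : [/\ point4 (t, x, y, z) 0 o0 = t,
  point4 (t, x, y, z) 0 o1 = x, point4 (t, x, y, z) 0 o2 = y &
  point4 (t, x, y, z) 0 o3 = z].
Proof. exact: chart_pointE. Qed.

Let f0 i (t x y z : RR) : ~ ((I t /\ I x) /\ I y) /\ True \/ ~ I z -> f i (t, x, y, z) = 0.
Proof.
have [h0 h1 h2 h3] := coord4 t x y z.
case=> [[h _]|h]; last by apply: (@partial_support _ _ o3); rewrite h3; exact: notI.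
have [It|/notI It] := pselect (I t); last by apply: (@partial_support _ _ o0); rewrite h0.
have [Ix|/notI Ix] := pselect (I x); last by apply: (@partial_support _ _ o1); rewrite h1.
by apply: (@partial_support _ _ o2); rewrite h2; apply: notI => Iy; apply: h.
Qed.

Lemma integrable_partial i : (mu \x mu \x mu \x mu)%E.-integrable setT (EFin \o f i).
Proof.
have [M hM] := fM i.
have out p : ~ (I `*` I `*` I `*` I) p -> f i p = 0.
  move=> h; apply: (@f0 i p.1.1.1 p.1.1.2 p.1.2 p.2).
  have [Iz|] := pselect (I p.2); last by right.
  by left; split => // h'; apply: h.
exact: bounded_support_integrable mI4 finI4 (@mf i) hM out.
Qed.

Let integrable3 i z :
  (mu \x mu \x mu)%E.-integrable setT (EFin \o (fun p => f i (p, z))).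
Proof.
have [M hM] := fM i.
have out p : ~ (I `*` I `*` I) p -> f i (p, z) = 0.
  by move=> h; apply: (@f0 i p.1.1 p.1.2 p.2 z); left.
apply: (bounded_support_integrable mI3 finI3 _ _ out) => //.
exact: measurable_fun_pair1 (@mf i).
Qed.

Let integrable2 i y z :
  (mu \x mu)%E.-integrable setT (EFin \o (fun p => f i (p, y, z))).
Proof.
have [M hM] := fM i.
have out p : ~ (I `*` I) p -> f i (p, y, z) = 0.
  by move=> h; apply: (@f0 i p.1 p.2 y z); left; split => // -[].
apply: (bounded_support_integrable mI2 finI2 _ _ out) => //.
exact: measurable_fun_pair1 (measurable_fun_pair1 z (@mf i)).
Qed.

Let line (i : 'I_4) (p : R -> RR * RR * RR * RR) :
  (forall s : R, point4 (p s) = s *: delta_mx 0 i + point4 (p 0)) ->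
  (\int[mu]_s (f i (p s))%:E)%E = 0%E.
Proof.
move=> pE; rewrite -[RHS](integral_line_eq0 i (point4 (p 0))).
by apply: eq_integral => s _; rewrite /f -pE.
Qed.

(** The order of integration is chosen by the index, so that the line parallel to the differentiated
    coordinate is integrated innermost. *)
Lemma integral_partial_eq0 i : (\int[mu \x mu \x mu \x mu]_p (f i p)%:E)%E = 0%E.
Proof.
have lineE (q : R -> RR * RR * RR * RR) (j : 'I_4) :
    (forall (s : R) (l : 'I_4), point4 (q s) 0 l = s * (l == j :> nat)%:R + point4 (q 0) 0 l) ->
    forall s : R, point4 (q s) = s *: delta_mx 0 j + point4 (q 0).
  by move=> h s; apply/rowP => l; rewrite h !mxE eqxx.
move: i; apply: ord4P.
- apply: (integral_prod4_eq0_1 (integrable_partial o0) (@integrable3 o0) (@integrable2 o0)).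
  move=> x y z; apply: (line (p := fun s : R => (s, x, y, z))); apply: lineE => s.
  by apply: ord4P; rewrite !mxE /= ?mulr1 ?mulr0 ?add0r ?addr0.
- apply: (integral_prod4_eq0_2 (integrable_partial o1) (@integrable3 o1) (@integrable2 o1)).
  move=> t y z; apply: (line (p := fun s : R => (t, s, y, z))); apply: lineE => s.
  by apply: ord4P; rewrite !mxE /= ?mulr1 ?mulr0 ?add0r ?addr0.
- apply: (integral_prod4_eq0_3 (integrable_partial o2) (@integrable3 o2)).
  move=> t x z; apply: (line (p := fun s : R => (t, x, s, z))); apply: lineE => s.
  by apply: ord4P; rewrite !mxE /= ?mulr1 ?mulr0 ?add0r ?addr0.
- apply: (integral_prod4_eq0_4 (integrable_partial o3)).
  move=> t x y; apply: (line (p := fun s : R => (t, x, y, s))); apply: lineE => s.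
  by apply: ord4P; rewrite !mxE /= ?mulr1 ?mulr0 ?add0r ?addr0.
Qed.

End partial_derivative.

End spacetime_integral.

(** * Bounds for integrals and determinants in the flux *)

Section integral_bound.
Local Open Scope ereal_scope.
Context {d : measure_display} {T : measurableType d} {R : realType}.
Variable mu : {measure set T -> \bar R}.
Import HBNNSimple.

(* No measurability assumption on [f]: the integral of a nonnegative function
   is a supremum over the simple functions below it. *)
Lemma ge0_integral_le_bound (f : T -> \bar R) (K : set T) (b : R) :
  measurable K -> (0 <= b)%R -> (forall x, 0 <= f x) ->
  (forall x, f x <= (b * \1_K x)%:E) -> \int[mu]_x f x <= b%:E * mu K.
Proof.
move=> mK b0 f0 fb; rewrite ge0_integralTE//; apply: ub_ereal_sup => _ [h hf <-].
rewrite -integralT_nnsfun; apply: (@le_trans _ _ (\int[mu]_x (b * \1_K x)%:E)).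
  have hb x : (h x)%:E <= (b * \1_K x)%:E := le_trans (hf x) (fb x).
  apply: ge0_le_integral => [//|x _|||x _]; [by rewrite lee_fin| | |exact: hb].
    exact/measurable_EFinP.
  by apply/measurable_EFinP/measurable_funM => //; exact: measurable_indic.
under eq_integral do rewrite EFinM.
rewrite ge0_integralZl//; last by apply/measurable_EFinP; exact: measurable_indic.
by rewrite integral_indic// setIT.
Qed.

(** The integrals of the positive and negative parts both lie between 0 and b times the measure of
    [K]; so does the absolute value of their difference, without a factor 2. *)
Lemma abse_integral_le_bound (f : T -> R) (D K : set T) (b : R) :
  measurable K -> (0 <= b)%R ->
  (forall x, D x -> (`|f x| <= b * \1_K x)%R) -> mu K < +oo ->
  `|\int[mu]_(x in D) (f x)%:E| <= b%:E * mu K.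
Proof.
move=> mK b0 fb Kfin; rewrite integral_mkcond integralE.
set g := _ \_ D.
have gb x : `|g x| <= (b * \1_K x)%:E.
  rewrite /g patchE; case: ifPn => [|_]; first by rewrite inE => /fb; rewrite lee_fin.
  by rewrite abse0 lee_fin mulr_ge0.
have pos : \int[mu]_x g^\+ x <= b%:E * mu K.
  apply: ge0_integral_le_bound => // x.
  by apply: le_trans (gb x); rewrite funeposE ge_max lee_abs abse_ge0.
have neg : \int[mu]_x g^\- x <= b%:E * mu K.
  apply: ge0_integral_le_bound => // x.
  by apply: le_trans (gb x); rewrite funenegE ge_max -abseN lee_abs abse_ge0.
have p0 : 0 <= \int[mu]_x g^\+ x by apply: integral_ge0.
have n0 : 0 <= \int[mu]_x g^\- x by apply: integral_ge0.
have bK : b%:E * mu K \is a fin_num by rewrite fin_numM// ge0_fin_numE.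
have bKoo : b%:E * mu K < +oo by rewrite ltey_eq bK.
have pf : \int[mu]_x g^\+ x \is a fin_num.
  by rewrite ge0_fin_numE//; exact: le_lt_trans pos bKoo.
have nf : \int[mu]_x g^\- x \is a fin_num.
  by rewrite ge0_fin_numE//; exact: le_lt_trans neg bKoo.
move: pos neg p0 n0; rewrite -(fineK bK) -(fineK pf) -(fineK nf) -EFinB abse_EFin !lee_fin.
by rewrite ler_norml => *; apply/andP; split; lra.
Qed.

End integral_bound.

(** Leibniz' formula with its 24 terms. The scalar [v] is grouped with row 0 because in the flux
    only the product of the volume density and the flux vector has a known bound. *)
Lemma det4_bound {R : realType} (M : 'M[R]_4) (v a b : R) : 0 <= b ->
  (forall j, `|v * M 0 j| <= a) -> (forall i j, i != 0 -> `|M i j| <= b) ->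
  `|v * \det M| <= a * b ^+ 3 *+ 24.
Proof.
move=> b0 h0 h; rewrite /determinant mulr_sumr.
have -> : a * b ^+ 3 *+ 24 = \sum_(s : 'S_4) a * b ^+ 3.
  by rewrite sumr_const card_Sn.
apply: le_trans (ler_norm_sum _ _ _) _; apply: ler_sum => s _.
have -> : v * ((-1) ^+ s * \prod_i M i (s i)) =
  (-1) ^+ s * (v * M 0 (s 0)) * (M o1 (s o1) * (M o2 (s o2) * M o3 (s o3))).
  have -> : \prod_i M i (s i) = M 0 (s 0) * (M o1 (s o1) * (M o2 (s o2) * M o3 (s o3))).
    rewrite !big_ord_recl big_ord0 mulr1.
    by do ! congr (_ * _); congr (M _ (s _)); apply/val_inj.
  by rewrite mulrCA !mulrA.
have hM i : i != 0 -> `|M i (s i)| <= b by exact: h.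
rewrite normrM; apply: ler_pM => //; first by rewrite normrM normr_sign mul1r h0.
rewrite (_ : b ^+ 3 = b * (b * b)); last by rewrite !exprS expr0 mulr1.
rewrite normrM; apply: ler_pM => //; first exact: hM.
by rewrite normrM; apply: ler_pM => //; exact: hM.
Qed.

(** * The coordinate cylinders and their tangent vectors *)

Section cylinder.
Context {R : realType}.

Lemma is_derive_chart_point (f0 f1 f2 f3 : R -> R) (t d0 d1 d2 d3 : R) :
  is_derive t (1 : R) f0 d0 -> is_derive t (1 : R) f1 d1 ->
  is_derive t (1 : R) f2 d2 -> is_derive t (1 : R) f3 d3 ->
  derive1 (fun s => chart_point (f0 s) (f1 s) (f2 s) (f3 s)) t = chart_point d0 d1 d2 d3.
Proof.
move=> h0 h1 h2 h3.
have comp i j : is_derive t (1 : R)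
    (fun s => chart_point (f0 s) (f1 s) (f2 s) (f3 s) i j) (chart_point d0 d1 d2 d3 i j).
  rewrite mxE; rewrite (_ : (fun s => _) = fun s => nth 0 [:: f0 s; f1 s; f2 s; f3 s] j).
    by move: j; apply: ord4P.
  by apply/funext => s; rewrite mxE.
have df : derivable (fun s => chart_point (f0 s) (f1 s) (f2 s) (f3 s)) t (1 : R).
  by apply/derivable_mxP => i j; have [] := comp i j.
rewrite derive1E (derive_mx df); apply/matrixP => i j; rewrite mxE.
by have [_ ->] := comp i j.
Qed.

Lemma derive1_cylinder_t (rho t th ph : R) :
  derive1 (fun s : R => cylinder_point rho s th ph) t = chart_point 1 0 0 0.
Proof.
have hc (a : R) := is_derive_cst a t (1 : R).
exact: (is_derive_chart_point (is_derive_id t (1 : R)) (hc _) (hc _) (hc _)).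
Qed.

Lemma derive1_cylinder_th (rho t th ph : R) :
  derive1 (fun s : R => cylinder_point rho t s ph) th =
  chart_point 0 (rho * cos th * cos ph) (rho * cos th * sin ph) (- (rho * sin th)).
Proof.
have dsin := is_derive_sin th; have dcos := is_derive_cos th.
have drs := is_deriveZ rho dsin; have drc := is_deriveZ rho dcos.
have h1 : is_derive th (1 : R) (fun s => rho * sin s * cos ph) (rho * cos th * cos ph).
  apply: (is_derive_eq (is_deriveM drs (is_derive_cst (cos ph) th (1 : R)))).
  by rewrite /GRing.scale/= /GRing.scale/=; ring.
have h2 : is_derive th (1 : R) (fun s => rho * sin s * sin ph) (rho * cos th * sin ph).
  apply: (is_derive_eq (is_deriveM drs (is_derive_cst (sin ph) th (1 : R)))).
  by rewrite /GRing.scale/= /GRing.scale/=; ring.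
have h3 : is_derive th (1 : R) (fun s => rho * cos s) (- (rho * sin th)).
  by apply: (is_derive_eq drc); rewrite /GRing.scale/= mulrN.
exact: (is_derive_chart_point (is_derive_cst t th (1 : R)) h1 h2 h3).
Qed.

Lemma derive1_cylinder_ph (rho t th ph : R) :
  derive1 (fun s : R => cylinder_point rho t th s) ph =
  chart_point 0 (- (rho * sin th * sin ph)) (rho * sin th * cos ph) 0.
Proof.
have dsin := is_derive_sin ph; have dcos := is_derive_cos ph.
have h1 : is_derive ph (1 : R) (fun s => rho * sin th * cos s) (- (rho * sin th * sin ph)).
  by apply: (is_derive_eq (is_deriveZ (rho * sin th) dcos)); rewrite /GRing.scale/= mulrN.
have h2 : is_derive ph (1 : R) (fun s => rho * sin th * sin s) (rho * sin th * cos ph).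
  exact: (is_deriveZ (rho * sin th) dsin).
have hc (a : R) := is_derive_cst a ph (1 : R).
exact: (is_derive_chart_point (hc _) h1 h2 (hc _)).
Qed.

Lemma space_norm_cylinder (rho t th ph : R) : 0 <= rho ->
  space_norm (cylinder_point rho t th ph) = rho.
Proof.
move=> rho0; rewrite space_normE /sqnorm /spatial !mxE /=.
have -> : (rho * sin th * cos ph) ^+ 2 + (rho * sin th * sin ph) ^+ 2 + (rho * cos th) ^+ 2
   = rho ^+ 2 * ((cos th ^+ 2 + sin th ^+ 2 * (cos ph ^+ 2 + sin ph ^+ 2))) by ring.
by rewrite !cos2Dsin2 mulr1 cos2Dsin2 mulr1 sqrtr_sqr ger0_norm.
Qed.

(** The bound must exceed 1 for the tangent vector in time and the radius for the two angular
    ones. *)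
Lemma cylinder_tangent_bound (rho t th ph b : R) (v0 : 'rV[R]_4) i j : 1 <= b -> 0 <= rho <= b ->
  i != 0 :> 'I_4 -> `|(\matrix_(i < 4, j < 4) (nth 0 [:: v0;
    derive1 (fun s : R => cylinder_point rho s th ph) t;
    derive1 (fun s : R => cylinder_point rho t s ph) th;
    derive1 (fun s : R => cylinder_point rho t th s) ph] i : 'rV[R]_4) 0 j) i j| <= b.
Proof.
move=> b1 /andP[r0 rb]; have b0 := le_trans ler01 b1.
rewrite derive1_cylinder_t derive1_cylinder_th derive1_cylinder_ph mxE.
have hs (x : R) : `|sin x| <= 1 by rewrite ler_norml sin_geN1 sin_le1.
have hc (x : R) : `|cos x| <= 1 by rewrite ler_norml cos_geN1 cos_le1.
have h1 x : `|x| <= 1 -> `|rho * x| <= b.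
  by move=> x1; rewrite normrM (ger0_norm r0) -[leRHS]mulr1 ler_pM.
have h2 x y : `|x| <= 1 -> `|y| <= 1 -> `|rho * x * y| <= b.
  by move=> x1 y1; rewrite -mulrA h1// normrM -[leRHS]mulr1 ler_pM.
by move: i j; do 2 apply: ord4P => //=; rewrite mxE//= ?normr0 ?normr1 ?normrN ?h1 ?h2.
Qed.

End cylinder.

(** * Support and bounds of the test fields *)

Section test_fields.
Context {R : realType}.
Variables (rho0 : R) (psi : 'rV[R]_4 -> 'rV[R]_4).
Hypothesis smooth_psi : smooth_up_to_boundary rho0 psi.
Hypothesis supp_psi : compactly_supported rho0 psi.

Let K := closure [set x | exteriorbar rho0 x /\ psi x != 0].

Lemma exterior_bar : exterior rho0 `<=` exteriorbar rho0.
Proof. by move=> x /ltW. Qed.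

Lemma closed_exteriorbar : closed (@exteriorbar R rho0).
Proof.
rewrite (_ : exteriorbar _ = @space_norm R @^-1` [set y | rho0 <= y])//.
by apply: closed_comp; [move=> x _; exact: space_norm_continuous|exact: closed_ge].
Qed.

Lemma support_exteriorbar : K `<=` exteriorbar rho0.
Proof.
rewrite [X in _ `<=` X](closure_id _).1; last exact: closed_exteriorbar.
by apply: closure_subset => x [].
Qed.

Lemma test_field_eq0 x : exteriorbar rho0 x -> ~ K x -> psi x = 0.
Proof.
move=> xe xK; apply/eqP/negPn/negP => px; apply: xK.
exact: subset_closure.
Qed.

Lemma test_field_support : exists2 L : R, 0 <= L &
  forall x i, exteriorbar rho0 x -> L < `|x 0 i| -> psi x = 0.
Proof.
have /compact_bounded [M [_ hM]] := supp_psi.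
(* Compactness makes every number greater than [M] a bound, and [M] itself may be negative. *)
exists (`|M| + 1); first by rewrite addr_ge0.
move=> x i xe Lx; apply: test_field_eq0 => // /hM h.
have /h : M < `|M| + 1 by apply: le_lt_trans (ler_norm M) _; rewrite ltrDl.
move=> xM; have := le_lt_trans (coord_le_norm x i) (le_lt_trans xM Lx).
by have := coord_le_norm x i; move=> *; lra.
Qed.

Lemma C1on_test_field nu : C1on (exterior rho0) (fun x => psi x 0 nu).
Proof.
have [V [Psi [oV eV sPsi PsiE]]] := smooth_psi.
have EV : exterior rho0 `<=` V by move=> x /exterior_bar /eV.
apply: (@C1on_eq _ _ (fun x => Psi x 0 nu)); first exact: open_exterior.
  by move=> x /exterior_bar /PsiE ->.
apply: (C1on_sub EV).
have der x i : V x -> is_derive x (delta_mx 0 i) (fun y => Psi y 0 nu) (partial i Psi x 0 nu).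
  move=> Vx; have [_ /(_ i) dPsi] := sPsi [::] x Vx.
  have /derivable_mxP /(_ 0 nu) d1 := dPsi.
  split => //; by rewrite /partial (derive_mx dPsi) mxE.
have cont f x : {for x, continuous (f : 'rV[R]_4 -> 'rV[R]_4)} ->
    {for x, continuous (fun y => f y 0 nu)}.
  by move=> cf; exact: (continuous_comp cf (@coord_continuous _ _ _ 0 nu (f x))).
apply: (C1onI oV (df := fun i x => partial i Psi x 0 nu)) => //.
- by move=> x Vx; exact: (cont Psi x (sPsi [::] x Vx).1).
- by move=> x i Vx; exact: (cont (partial i Psi) x (sPsi [:: i] x Vx).1).
Qed.

(** On the support the bounds come from compactness, applied to the smooth extension because the
    support may reach the boundary, where the derivatives of [psi] itself are not controlled. Off
    the support [psi] vanishes locally. *)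
Lemma test_field_bounded : exists2 M : R, 0 <= M & forall x, exterior rho0 x ->
  (forall nu, `|psi x 0 nu| <= M) /\
  (forall mu nu, `|partial mu (fun y => psi y 0 nu) x| <= M).
Proof.
have [V [Psi [oV eV sPsi PsiE]]] := smooth_psi.
have KV : K `<=` V by move=> x /support_exteriorbar /eV.
have bd (s : seq 'I_4) : exists2 M : R, 0 <= M &
    forall x, K x -> forall nu, `|foldr (@partial R _) Psi s x 0 nu| <= M.
  have cs : {within K, continuous (foldr (@partial R _) Psi s)}.
    apply: continuous_in_subspaceT => x /[!inE] /KV Vx.
    by have [] := sPsi s x Vx.
  have /compact_bounded [M [_ hM]] := continuous_compact cs supp_psi.
  exists (`|M| + 1); first by rewrite addr_ge0.
  move=> x Kx nu; apply: le_trans (coord_le_norm _ nu) _.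
  apply: (hM (`|M| + 1)); first by apply: le_lt_trans (ler_norm M) _; rewrite ltrDl.
  by exists x.
have [M0 M00 h0] := bd [::].
have /choice [M hM] : forall i : 'I_4, exists M : R, 0 <= M /\
    forall x, K x -> forall nu, `|partial i Psi x 0 nu| <= M.
  by move=> i; have [M M0' h] := bd [:: i]; exists M.
exists (M0 + \sum_i M i); first by rewrite addr_ge0// sumr_ge0// => i _; have [] := hM i.
have S0 : 0 <= \sum_i M i by rewrite sumr_ge0// => i _; have [] := hM i.
have MS i : M i <= \sum_i M i.
  rewrite (bigD1 i)//= lerDl sumr_ge0// => j _; by have [] := hM j.
move=> x xe; have [Kx|nKx] := pselect (K x).
  split => [nu|mu nu].
    by rewrite PsiE; [apply: le_trans (h0 x Kx nu) _; rewrite lerDl|exact: exterior_bar].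
  (* [psi] and its extension agree on the open exterior, hence so do their derivatives there. *)
  have -> : partial mu (fun y => psi y 0 nu) x = partial mu Psi x 0 nu.
    have Vx := KV _ Kx; have [_ /(_ mu) dPsi] := sPsi [::] x Vx.
    rewrite /partial (derive_mx dPsi) mxE; apply: near_eq_derive.
    apply: (open_near_eq (open_exterior (rho0 := rho0)) xe) => y /exterior_bar ye.
    by rewrite PsiE.
  apply: le_trans ((hM mu).2 x Kx nu) _; apply: le_trans (MS mu) _.
  by rewrite lerDr.
split => [nu|mu nu].
  by rewrite (test_field_eq0 (exterior_bar xe) nKx) mxE normr0 addr_ge0.
have oKc : open (exterior rho0 `&` ~` K).
  by apply: openI; [exact: open_exterior|exact/closed_openC/closed_closure].
have -> : partial mu (fun y => psi y 0 nu) x = 0.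
  rewrite /partial -(derive_cst (0 : R) x (delta_mx 0 mu)); apply: near_eq_derive.
  apply: (open_near_eq oKc) => // y [ye yK].
  by rewrite (test_field_eq0 (exterior_bar ye) yK) mxE.
by rewrite normr0 addr_ge0.
Qed.

End test_fields.

(** * The weak identity for a radial profile with regular center *)

Section weak_identity.
Context {R : realType}.
Variables (rho0 c : R) (S T D W rad : R -> R) (g : 'rV[R]_4 -> 'M[R]_4).
Hypotheses (rho0_gt0 : 0 < rho0) (c_gt0 : 0 < c).
Hypothesis prof : radial_profile rho0 S T D W rad.
Hypothesis reg : regular_center rho0 S T D rad.
Hypothesis gE : forall x, exterior rho0 x -> g x =
  \matrix_(i, j) if i != j then 0
    else if i == 0 then - (c ^+ 2 * Num.sqrt (S (rad (space_norm x))) ^+ 2)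
    else rad (space_norm x) ^+ 2 * (sqnorm x)^-1.
Variable psi : 'rV[R]_4 -> 'rV[R]_4.
Hypothesis smooth_psi : smooth_up_to_boundary rho0 psi.
Hypothesis supp_psi : compactly_supported rho0 psi.

Local Notation mu := (@lebesgue_measure R).
Local Notation RR := (measurableTypeR R).
Local Notation U := (@exterior R rho0).
Let oU : open U := @open_exterior R rho0.

(** Three spatial coordinates give the factor sqrt 3, which 2 dominates. *)
Lemma norm_le_box (L : R) (x : 'rV[R]_4) : (forall i, `|x 0 i| <= L) ->
  space_norm x <= 2 * L.
Proof.
move=> h; have L0 : 0 <= L := le_trans (normr_ge0 _) (h 0).
rewrite space_normE -[leRHS]ger0_norm ?mulr_ge0// -sqrtr_sqr ler_wsqrtr//.
have sq i : x 0 i ^+ 2 <= L ^+ 2 by rewrite -(ger0_norm (sqr_ge0 (x 0 i))) normrX lerXn2r ?nnegrE.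
have := sq o1; have := sq o2; have := sq o3; rewrite /sqnorm /spatial /=.
have := sqr_ge0 L; rewrite (exprMn _ 2 L); move: (L ^+ 2) => a.
by move: (x 0 o1 ^+ 2) (x 0 o2 ^+ 2) (x 0 o3 ^+ 2) => *; lra.
Qed.

(** The cut off flux, extended by 0 into the ball that the chart omits, so that integration runs
    over entire coordinate lines. *)
Let Z (n : nat) (m : 'I_4) (x : 'rV[R]_4) : R :=
  if rho0 < space_norm x
  then cutoff rad n.+1%:R x * \sum_nu stress c S T D rad m nu x * psi x 0 nu else 0.

(** As rad tends to 0 at rho0, it is below 1 / (n + 1) on some shell, and there the cutoff vanishes.
    The shell depends on [n]. *)
Let near_boundary n : exists2 e : R, 0 < e &
  forall x, space_norm x < rho0 + e -> forall m, Z n m x = 0.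
Proof.
have n0 : (0 : R) < n.+1%:R by rewrite ltr0n.
have : \forall rho \near rho0^'+, rad rho < n.+1%:R^-1.
  by apply: (cvgr_lt _ (rc_rad0 reg)); rewrite invr_gt0.
move=> [e /= e0 he]; exists e => // x xe m; rewrite /Z; case: ifPn => // Ux.
rewrite (cutoff_eq0 prof n0 Ux) ?mul0r//=.
rewrite -ler_pdivlMl// mulr1 ltW//.
apply: he => //; rewrite /ball_/= distrC ger0_norm; first by rewrite ltrBlDl.
by rewrite subr_ge0 ltW.
Qed.

Let Zext n m x : U x -> Z n m x =
  cutoff rad n.+1%:R x * \sum_nu stress c S T D rad m nu x * psi x 0 nu.
Proof. by rewrite /Z => ->. Qed.

Let C1Z n m : C1on setT (Z n m).
Proof.
have [e e0 he] := near_boundary n.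
have oN : open [set x : 'rV[R]_4 | space_norm x < rho0 + e].
  rewrite (_ : mkset _ = @space_norm R @^-1` [set y | y < rho0 + e])//.
  by apply: open_comp; [move=> x _; exact: space_norm_continuous|exact: open_lt].
(* The exterior and the slightly larger open ball overlap in that shell and cover everything; [Z] is
   C^1 on the first and zero on the second. *)
rewrite (_ : setT = U `|` [set x | space_norm x < rho0 + e]); last first.
  apply/esym/seteqP; split => // x _; have [h|h] := ltP rho0 (space_norm x); first by left.
  by right => /=; apply: le_lt_trans h _; rewrite ltrDl.
apply: C1onU; last first.
  by apply: (C1on_eq oN _ (C1on_cst 0 oN)) => x /he ->.
have n0 : n.+1%:R != 0 :> R by rewrite pnatr_eq0.
apply: (C1on_eq oU (fun x Ux => esym (Zext n m Ux))).
apply: (C1onM oU); first exact: (C1on_cutoff rho0_gt0 prof).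
apply: (C1on_sum oU) => nu; apply: (C1onM oU).
  exact: (C1on_stress c rho0_gt0 prof).
exact: (C1on_test_field smooth_psi).
Qed.

Let supportZ : exists2 L : R, 0 <= L & forall n m (x : 'rV[R]_4) i, L < `|x 0 i| ->
  Z n m x = 0 /\ (U x -> psi x = 0).
Proof.
have [L L0 hL] := test_field_support supp_psi; exists L => // n m x i Lx.
have psi0 : U x -> psi x = 0 by move=> /exterior_bar xe; exact: hL Lx.
split => //; rewrite /Z; case: ifPn => // Ux.
by rewrite big1 ?mulr0// => nu _; rewrite psi0// mxE mulr0.
Qed.

Let f (n : nat) (p : RR * RR * RR * RR) : R := \sum_m partial m (Z n m) (point4 p).

Let fE n p : U (point4 p) -> f n p =
  cutoff rad n.+1%:R (point4 p) * bianchi_density g psi (point4 p) +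
  \sum_m \sum_nu partial m (cutoff rad n.+1%:R) (point4 p) *
    (stress c S T D rad m nu (point4 p) * psi (point4 p) 0 nu).
Proof.
move=> Up; have n0 : n.+1%:R != 0 :> R by rewrite pnatr_eq0.
rewrite -(div_cutoff rho0_gt0 c_gt0 prof gE (C1on_cutoff rho0_gt0 prof n0)
  (C1on_test_field smooth_psi) Up).
apply: eq_bigr => m _; apply: near_eq_derive; apply: (open_near_eq oU Up) => y Uy.
exact: Zext.
Qed.

Let f_out n p : ~ U (point4 p) -> f n p = 0.
Proof.
move=> Up; have [e e0 he] := near_boundary n; rewrite /f big1// => m _.
have oN : open [set x : 'rV[R]_4 | space_norm x < rho0 + e].
  rewrite (_ : mkset _ = @space_norm R @^-1` [set y | y < rho0 + e])//.
  by apply: open_comp; [move=> x _; exact: space_norm_continuous|exact: open_lt].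
rewrite /partial -(derive_cst (0 : R) (point4 p) (delta_mx 0 m)).
apply: near_eq_derive; apply: (open_near_eq oN) => [|y /he ->//].
move: Up => /negP; rewrite /exterior/= -leNgt => h.
by apply: le_lt_trans h _; rewrite ltrDl.
Qed.

Let int_f n : (\int[mu \x mu \x mu \x mu]_p (f n p)%:E)%E = 0%E.
Proof.
have [L _ hL] := supportZ.
have ZL m (x : 'rV[R]_4) i : L < `|x 0 i| -> Z n m x = 0 by move=> /(hL n m x i)[].
have int m := integrable_partial (@C1Z n m) (ZL m) m.
transitivity (\sum_(m <- index_enum 'I_4)
  \int[mu \x mu \x mu \x mu]_p (partial m (Z n m) (point4 p))%:E)%E.
  rewrite -integral_sum//; apply: eq_integral => p _; rewrite /f.
  by rewrite -sumEFin.
by rewrite big1// => m _; exact: (integral_partial_eq0 (@C1Z n m) (ZL m)).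
Qed.

(** [L] confines the supports, [K1] bounds the density, and [K2] bounds what the gradient of the
    cutoff contributes, both uniformly and with the decaying factor. *)
Let bd : exists L K1 K2 : R, [/\ 0 <= L, 0 <= K1 & 0 <= K2] /\ [/\
  forall n p i, L < `|point4 p 0 i| -> f n p = 0,
  forall p i, U (point4 p) -> L < `|point4 p 0 i| -> bianchi_density g psi (point4 p) = 0 &
  forall p, U (point4 p) -> (forall i, `|point4 p 0 i| <= L) ->
    `|bianchi_density g psi (point4 p)| <= K1 /\
    forall n : nat,
    let t := f n p - cutoff rad n.+1%:R (point4 p) * bianchi_density g psi (point4 p) in
    `|t| <= K2 /\ `|t| <= K2 / (n.+1%:R * rad (space_norm (point4 p)))].
Proof.
have [L L0 hL] := supportZ; have [M M0 hM] := test_field_bounded smooth_psi supp_psi.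
have [K1 K10 hK1] := bianchi_density_bound rho0_gt0 c_gt0 prof gE (2 * L) reg M0.
have [K2 K20 hK2] := cutoff_flux_bound rho0_gt0 c_gt0 prof (2 * L) reg M0.
have sup p i : U (point4 p) -> L < `|point4 p 0 i| -> bianchi_density g psi (point4 p) = 0.
  move=> Up Lp; have psi0 nu : \forall y \near point4 p, psi y 0 nu = 0.
    have oL : open (U `&` [set y : 'rV[R]_4 | L < `|y 0 i|]).
      apply: openI; first exact: open_exterior.
      rewrite (_ : mkset _ = (fun y : 'rV[R]_4 => `|y 0 i|) @^-1` [set y | L < y])//.
      apply: open_comp; last exact: open_gt.
      move=> y _; apply: (continuous_comp (@coord_continuous _ _ _ 0 i y)).
      exact: norm_continuous.
    apply: (open_near_eq oL) => // y [Uy Ly].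
    by have [_ ->] := hL 0%N 0 y i Ly; rewrite // mxE.
  rewrite (bianchi_density_stress rho0_gt0 c_gt0 prof gE)// [X in X + _]big1 => [|m _].
    rewrite big1 ?mulr0 ?addr0// => l _; by rewrite (nbhs_singleton (psi0 l)) mulr0.
  rewrite big1// => nu _.
  by rewrite /partial (near_eq_derive _ (psi0 nu)) derive_cst mulr0.
exists L, K1, K2; split => //; split => //.
- move=> n p i Lp; rewrite /f big1// => m _.
  have ZL m' (x : 'rV[R]_4) j : L < `|x 0 j| -> Z n m' x = 0 by move=> /(hL n m' x j)[].
  exact: (partial_support (ZL m) _ Lp).
- move=> p Up pL; have pr := norm_le_box pL; have [h1 h2] := hM _ Up.
  split; first exact: hK1.
  move=> n; rewrite (fE n Up) addrC addKr.
  by apply: (hK2 n.+1%:R psi) => //; rewrite ltr0n.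
Qed.

Let dens (p : RR * RR * RR * RR) : R :=
  if rho0 < space_norm (point4 p) then bianchi_density g psi (point4 p) else 0.

Let f_cvg p : f n p @[n --> \oo] --> dens p.
Proof.
rewrite /dens; case: ifPn => [Up|/negP Up]; last first.
  by under eq_fun do rewrite f_out//; exact: cvg_cst.
have [L [K1 [K2 [[L0 K10 K20] [hf hd hb]]]]] := bd.
have [[i Li]|pL] := pselect (exists i, L < `|point4 p 0 i|).
  rewrite (hd p i)//; under eq_fun do rewrite (hf _ p i)//; exact: cvg_cst.
have {}pL i : `|point4 p 0 i| <= L by rewrite leNgt; apply/negP => h; apply: pL; exists i.
have [_ ht] := hb p Up pL.
set t := fun n => f n p - cutoff rad n.+1%:R (point4 p) * bianchi_density g psi (point4 p).
have t0 : t n @[n --> \oo] --> 0.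
  apply/norm_cvg0P.
  have k0 : K2 / rad (space_norm (point4 p)) * n.+1%:R^-1 @[n --> \oo] --> (0 : R).
    rewrite -[X in _ --> X](mulr0 (K2 / rad (space_norm (point4 p)))).
    by apply: cvgM; [exact: cvg_cst|exact: cvg_harmonic].
  apply: (squeeze_cvgr _ (cvg_cst 0) k0); near=> n.
  rewrite normr_ge0/= (le_trans (ht n).2)//.
  by rewrite invfM mulrA mulrAC.
have -> : f^~ p = fun n => t n + cutoff rad n.+1%:R (point4 p) * bianchi_density g psi (point4 p).
  by apply/funext => n; rewrite /t subrK.
rewrite -[X in _ --> X]add0r -[X in _ --> _ + X]mul1r.
apply: cvgD => //; apply: cvgM; last exact: cvg_cst.
exact: (cutoff_cvg prof Up).
Unshelve. all: by end_near. Qed.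

Let mf n : measurable_fun setT (f n).
Proof.
apply: measurable_sum => m.
exact: (measurable_fun_point4 (partial_continuous (@C1Z n m) (i := m))).
Qed.

(** The density inherits measurability as a pointwise limit of divergences of C^1 fields that are
    defined on the whole chart. *)
Let mdens : measurable_fun setT dens.
Proof. 
by apply: (@measurable_fun_cvg _ _ R setT f dens) => [n|p _]; [exact: mf|exact: f_cvg]. Qed.

Let dominated :
  (mu \x mu \x mu \x mu)%E.-integrable setT (EFin \o dens) /\
  (\int[mu \x mu \x mu \x mu]_p (dens p)%:E)%E = 0%E.
Proof.
have [L [K1 [K2 [[L0 K10 K20] [hf hd hb]]]]] := bd.
pose I : set RR := `[- L, L]%classic.
have mI : measurable I by exact: measurable_itv.
have finI : (mu I < +oo)%E.
  by rewrite lebesgue_measure_itv; case: ifP => // _; rewrite -EFinB ltry.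
pose K : set (RR * RR * RR * RR) := I `*` I `*` I `*` I.
have mI2 := measurableX mI mI; have mI3 := measurableX mI2 mI.
have mK : measurable K := measurableX mI3 mI.
have finI2 : ((mu \x mu)%E (I `*` I) < +oo)%E.
  rewrite product_measure1E; [|exact: mI|exact: mI].
  by apply: lte_mul_pinfty => //; rewrite ge0_fin_numE.
have finI3 : ((mu \x mu \x mu)%E (I `*` I `*` I) < +oo)%E.
  rewrite product_measure1E; [|exact: mI2|exact: mI].
  by apply: lte_mul_pinfty => //; rewrite ge0_fin_numE.
have finK : ((mu \x mu \x mu \x mu)%E K < +oo)%E.
  rewrite product_measure1E; [|exact: mI3|exact: mI].
  by apply: lte_mul_pinfty => //; rewrite ge0_fin_numE.
have inK p : K p \/ exists i, L < `|point4 p 0 i|.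
  have [h|h] := pselect (exists i, L < `|point4 p 0 i|); [by right|left].
  have {}h i : `|point4 p 0 i| <= L by rewrite leNgt; apply/negP => ?; apply: h; exists i.
  have := h o0; have := h o1; have := h o2; have := h o3; rewrite !mxE/= !ler_norml => *.
  by rewrite /K/I/=; split; [split; [split|]|]; rewrite /= in_itv.
pose b (p : RR * RR * RR * RR) : R := (K1 + K2) * \1_K p.
have f_le n p : `|f n p| <= b p.
  have b0 : 0 <= b p by rewrite mulr_ge0// addr_ge0.
  have [Kp|[i Li]] := inK p; last by rewrite (hf n p i)// normr0.
  have [Up|/negP Up] := boolP (rho0 < space_norm (point4 p)); last by rewrite f_out// normr0.
  have [[i Li]|pL] := pselect (exists i, L < `|point4 p 0 i|).
    by rewrite (hf n p i)// normr0.
  have {}pL i : `|point4 p 0 i| <= L by rewrite leNgt; apply/negP => ?; apply: pL; exists i.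
  have [h1 /(_ n)[h2 _]] := hb p Up pL.
  rewrite /b indicE mem_set// mulr1.
  have /andP[c0 c1] := @cutoff_ge0_le1 _ _ _ _ _ _ _ prof n.+1%:R _ ltac:(by rewrite ltr0n) Up.
  have h3 : `|cutoff rad n.+1%:R (point4 p) * bianchi_density g psi (point4 p)| <= K1.
    by rewrite normrM (ger0_norm c0) -[leRHS]mul1r ler_pM.
  (* The divergence splits into the cutoff gradient term, at most [K2], and the cut off density, at
     most [K1]. *)
  rewrite -[f n p](subrK (cutoff rad n.+1%:R (point4 p) * bianchi_density g psi (point4 p))).
  by apply: le_trans (ler_normD _ _) _; rewrite addrC lerD.
have ib : (mu \x mu \x mu \x mu)%E.-integrable setT (EFin \o b).
  apply: (bounded_support_integrable mK finK (M := K1 + K2)).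
  - by apply: measurable_funM => //; exact: measurable_indic.
  - move=> p; rewrite /b normrM ger0_norm ?addr_ge0// -[leRHS]mulr1 ler_wpM2l ?addr_ge0//.
    by rewrite indicE; case: (_ \in _); rewrite ?normr1 ?normr0.
  - by move=> p Kp; rewrite /b indicE memNset// mulr0.
have := @dominated_convergence _ _ R (mu \x mu \x mu \x mu)%E setT measurableT
  (fun n p => (f n p)%:E) (EFin \o dens) (EFin \o b).
case.
- by move=> n; apply/measurable_EFinP; exact: mf.
- by apply/measurable_EFinP; exact: mdens.
- by apply: aeW => p _; apply: cvg_EFin; [exact: nearW|exact: f_cvg].
- exact: ib.
- by apply: aeW => p n _; rewrite /= lee_fin f_le.
move=> idens _ cint; split => //.
have int0 : (fun n => \int[mu \x mu \x mu \x mu]_p (f n p)%:E)%E = cst 0%E.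
  by apply/funext => n; exact: int_f.
have {}cint : (fun n => \int[mu \x mu \x mu \x mu]_p (f n p)%:E)%E @ \oo -->
    (\int[mu \x mu \x mu \x mu]_p (dens p)%:E)%E := cint.
rewrite int0 in cint.
by apply/esym; apply: (cvg_unique _ (cvg_cst 0%E) cint).
Qed.

Lemma bianchi_integrable_eq0 :
  bianchi_integrable g rho0 psi /\ bianchi_integral g rho0 psi = 0%E.
Proof.
have mU : measurable (point4 @^-1` U : set (RR * RR * RR * RR)).
  exact: (measurable_point4 oU).
have [idens dens0] := dominated.
have E : EFin \o dens =
    (fun p : RR * RR * RR * RR => (bianchi_density g psi (point4 p))%:E) \_ (point4 @^-1` U).
  apply/funext => p /=; rewrite patchE /dens.
  have -> : (p \in point4 @^-1` U) = (rho0 < space_norm (point4 p)).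
    by apply/idP/idP; rewrite inE.
  by case: ifP.
split.
  by apply/(integrable_mkcond _ mU).2; rewrite -E.
by rewrite /bianchi_integral integral_mkcond -[RHS]dens0 -[in RHS]/(EFin \o dens) E.
Qed.

Lemma cvg_shift_right (a : R) : a + e @[e --> 0^'+] --> a^'+.
Proof.
move=> A [e /= e0 he]; exists e => // x /= xe x0; apply: he.
  by move: xe; rewrite /ball_/= opprD addNKr sub0r.
by rewrite ltrDl.
Qed.

(** Up to the fixed size of the tangent vectors, the flux density is the stress times [psi], hence
    at most a multiple of sqrt(rad(rho0 + e)). The support of [psi] bounds the time interval, so
    this is integrated over a set of finite measure. *)
Lemma flux_density_bound : exists (K : set (RR * RR * RR)) (b : R -> R),
  [/\ measurable K, ((mu \x mu \x mu)%E K < +oo)%E,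
   b e @[e --> 0^'+] --> (0 : R) &
   forall e (p : RR * RR * RR), 0 < e -> e <= 1 ->
     (0 <= p.1.2 <= pi)%R /\ (0 <= p.2 <= 2 * pi)%R ->
     0 <= b e /\ `|flux_density g psi (rho0 + e) p.1.1 p.1.2 p.2| <= b e * \1_K p].
Proof.
have [L L0 hL] := test_field_support supp_psi.
have [M M0 hM] := test_field_bounded smooth_psi supp_psi.
have [K1 K10 hK1] := stress_bound rho0_gt0 c_gt0 prof reg (rho0 + 1).
have [K3 K30 hK3] := area_lapse_bound prof reg (rho0 + 1).
(* Bound on one component of the volume density times the flux vector, a sum of four terms; [r1]
   below bounds the tangent vectors for e <= 1. *)
pose a e := K1 * Num.sqrt (K3 * rad (rho0 + e)) * M *+ 4.
pose r1 := rho0 + 1.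
have r10 : 0 <= r1 by rewrite addr_ge0// ltW.
pose I1 : set RR := `[- L, L]%classic; pose I2 : set RR := `[0, pi]%classic.
pose I3 : set RR := `[0, 2 * pi]%classic.
exists (I1 `*` I2 `*` I3).
exists (fun e => a e * r1 ^+ 3 *+ 24).
have fin (x y : R) : (mu `[x, y]%classic < +oo)%E.
  by rewrite lebesgue_measure_itv; case: ifP => // _; rewrite -EFinB ltry.
have ms (x y : R) : measurable (`[x, y]%classic : set RR) by exact: measurable_itv.
have m1 : measurable I1 := ms _ _; have m2 : measurable I2 := ms _ _.
have m3 : measurable I3 := ms _ _; have m12 := measurableX m1 m2.
have [f1 f2 f3] : [/\ (mu I1 < +oo)%E, (mu I2 < +oo)%E & (mu I3 < +oo)%E].
  by split; exact: fin.
split.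
- exact: (measurableX m12 m3).
- have fin2 : ((mu \x mu)%E (I1 `*` I2) < +oo)%E.
    rewrite product_measure1E; [|exact: m1|exact: m2].
    by apply: lte_mul_pinfty; rewrite ?ge0_fin_numE//.
  rewrite product_measure1E; [|exact: m12|exact: m3].
  by apply: lte_mul_pinfty; rewrite ?ge0_fin_numE//.
- have h0 : rad (rho0 + e) @[e --> 0^'+] --> (0 : R).
    apply: (@cvg_comp _ _ _ (fun e => rho0 + e) rad); first exact: cvg_shift_right.
    exact: (rc_rad0 reg).
  have h1 : Num.sqrt (K3 * rad (rho0 + e)) @[e --> 0^'+] --> (0 : R).
    rewrite -[X in _ --> X](sqrtr0 R) -[X in _ --> Num.sqrt X](mulr0 K3).
    apply: (@cvg_comp _ _ _ (fun e => K3 * rad (rho0 + e)) Num.sqrt).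
      by apply: cvgM; [exact: cvg_cst|exact: h0].
    exact: sqrt_continuous.
  have h2 : a e * (r1 ^+ 3 *+ 24) @[e --> 0^'+] --> K1 * 0 * M * 4%:R * (r1 ^+ 3 *+ 24).
    rewrite /a; under eq_fun do rewrite -[_ *+ 4]mulr_natr.
    apply: cvgM; last exact: cvg_cst.
    apply: cvgM; last exact: cvg_cst.
    apply: cvgM; last exact: cvg_cst.
    by apply: cvgM; [exact: cvg_cst|exact: h1].
  rewrite mulr0 !mul0r in h2.
  by under eq_fun do rewrite -mulrnAr.
move=> e p e0 e1 [hp1 hp2].
have ae0 : 0 <= a e by rewrite mulrn_wge0// !mulr_ge0// sqrtr_ge0.
split; first by rewrite mulrn_wge0// mulr_ge0// exprn_ge0.
set x := cylinder_point (rho0 + e) p.1.1 p.1.2 p.2.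
have rho_ge0 : 0 <= rho0 + e by rewrite addr_ge0// ltW.
have xr : space_norm x = rho0 + e by rewrite space_norm_cylinder.
have Ux : U x by rewrite /exterior/= xr ltrDl.
set K := _ `*` _.
rewrite mulrnAl -mulrAC /flux_density -/x /vol_form; apply: det4_bound => // [j|i j i0].
  rewrite mxE /= mxE mulr_sumr.
  have -> : \sum_nu vol_density g x * (einstein g x j nu * psi x 0 nu) =
      \sum_nu stress c S T D rad j nu x * psi x 0 nu.
    by apply: eq_bigr => nu _; rewrite mulrA (vol_einstein rho0_gt0 c_gt0 prof gE).
  have [tL|tL] := leP `|p.1.1| L; last first.
    rewrite big1 ?normr0 ?mulr_ge0// => nu _.
    rewrite (hL x 0) ?mxE ?mulr0//; first exact: exterior_bar.
  rewrite indicE mem_set; last first.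
    by split; [split|]; rewrite /I1 /I2 /I3 /= in_itv/= ?hp1 ?hp2// -ler_norml.
  rewrite mulr1 /a; apply: le_trans (ler_norm_sum _ _ _) _.
  have -> : K1 * Num.sqrt (K3 * rad (rho0 + e)) * M *+ 4 =
    \sum_(nu < 4) K1 * Num.sqrt (K3 * rad (rho0 + e)) * M by rewrite sumr_const card_ord.
  apply: ler_sum => nu _; rewrite normrM ler_pM//; last exact: (hM x Ux).1.
  have xr1 : space_norm x <= rho0 + 1 by rewrite xr lerD2l.
  apply: le_trans (hK1 x Ux xr1 j nu) _; rewrite ler_wpM2l//.
  by have [_] := hK3 x Ux xr1; rewrite xr.
apply: cylinder_tangent_bound => //; first by rewrite lerDr ltW.
by rewrite rho_ge0 lerD2l.
Qed.

Lemma boundary_flux_cvg0 :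
  boundary_flux g psi (rho0 + e) @[e --> 0^'+] --> (0%E : \bar R).
Proof.
have [K [b [mK finK b0 hb]]] := flux_density_bound.
have Kfin : (mu \x mu \x mu)%E K \is a fin_num by rewrite ge0_fin_numE.
have h : forall e, 0 < e -> e <= 1 ->
    (`|boundary_flux g psi (rho0 + e)| <= (b e * fine ((mu \x mu \x mu)%E K))%:E)%E.
  move=> e e0 e1; rewrite EFinM fineK//.
  have be0 : 0 <= b e.
    (* Any point with admissible angles would do, since the sign of [b e] does not depend on it. *)
    have [] // := hb e (0, 0, 0) e0 e1.
    by rewrite /= lexx mulr_ge0 ?pi_ge0.
  by apply: abse_integral_le_bound => // p Dp; have [] := hb e p e0 e1 Dp.
have lim (s : R) : (s * (b e * fine ((mu \x mu \x mu)%E K)))%:E @[e --> 0^'+] --> 0%E.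
  apply: cvg_EFin; first exact: nearW.
  rewrite -[X in _ --> X](mulr0 s) -[X in _ --> s * X](mul0r (fine ((mu \x mu \x mu)%E K))).
  by apply: cvgM; [exact: cvg_cst|apply: cvgM; [exact: b0|exact: cvg_cst]].
apply: (squeeze_cvge _ (lim (-1)) (lim 1)); near=> e.
have e0 : 0 < e by near: e; exact: nbhs_right_gt.
have e1 : e <= 1 by near: e; exact: nbhs_right_le.
move: (h e e0 e1); rewrite mul1r mulN1r.
case: (boundary_flux g psi (rho0 + e)) => [r| |]//=.
by rewrite !lee_fin -ler_norml.
Unshelve. all: by end_near. Qed.

Lemma weak_bianchi_radial_field :
  [/\ bianchi_integrable g rho0 psi,
    boundary_flux g psi (rho0 + eps) @[eps --> 0^'+] --> bianchi_integral g rho0 psi &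
    bianchi_integral g rho0 psi = 0%E].
Proof.
have [h1 h2] := bianchi_integrable_eq0; split => //; rewrite h2.
exact: boundary_flux_cvg0.
Qed.

End weak_identity.

(** * The electrostatic spacetime *)

Section integrability.
Context {R : realType}.
Notation mu := (@lebesgue_measure R).

Lemma derivable_itv_LRcontinuous (f F : R -> R) (a b : R) :
  (forall s : R, a <= s <= b -> is_derive s (1 : R) F (f s)) ->
  a <= b -> derivable_oo_LRcontinuous F a b.
Proof.
move=> dF ab.
have cF s : a <= s <= b -> {for s, continuous F}.
  by move=> /dF [dFs _]; apply: differentiable_continuous; exact/derivable1_diffP.
split.
- move=> s; rewrite in_itv/= => /andP[h1 h2].
  by have [] := dF s; rewrite ?(ltW h1) ?(ltW h2).
- by apply: cvg_at_right_filter; apply: cF; rewrite lexx ab.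
- by apply: cvg_at_left_filter; apply: cF; rewrite lexx ab.
Qed.

(** Starting from 2 makes every interval nondegenerate, as the fundamental theorem of calculus on it
    requires. *)
Lemma positive_halfline_itv :
  \bigcup_(n in [set: nat]) `[n.+2%:R^-1, n.+2%:R]%classic = (`]0, +oo[%classic : set R).
Proof.
apply/seteqP; split => [s [n _]|s] /=; rewrite !in_itv/= ?andbT.
  by move=> /andP[+ _]; apply: lt_le_trans; rewrite invr_gt0.
move=> s0; pose m := maxn (Num.truncn s) (Num.truncn s^-1).
exists m => //=; rewrite in_itv/=; apply/andP; split.
  rewrite -[leRHS]invrK lef_pV2 ?posrE ?invr_gt0// ltW//.
  apply: (lt_le_trans (truncnS_gt s^-1)); rewrite ler_nat ltnS.
  by apply: leq_trans (leqnSn _); rewrite leq_maxr.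
rewrite ltW//; apply: (lt_le_trans (truncnS_gt s)); rewrite ler_nat ltnS.
by apply: leq_trans (leqnSn _); rewrite leq_maxl.
Qed.

(** The integrals over the exhausting intervals are differences of values of [F], hence at most 2 C,
    and monotone convergence passes to the half-line. *)
Lemma integrable_bounded_primitive (f F : R -> R) (C : R) :
  (forall s : R, 0 < s -> 0 <= f s) ->
  (forall s : R, 0 < s -> {for s, continuous f}) ->
  (forall s : R, 0 < s -> is_derive s (1 : R) F (f s)) ->
  (forall s : R, 0 < s -> `|F s| <= C) ->
  mu.-integrable `]0, +oo[ (EFin \o f).
Proof.
move=> f0 cf dF FC.
have mf : measurable_fun (`]0, +oo[%classic : set R) f.
  apply: open_continuous_measurable_fun; first exact: interval_open.
  by move=> s; rewrite inE/= in_itv/= andbT => /cf.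
apply/integrableP; split; first by apply/measurable_EFinP.
pose A n : set R := `[n.+2%:R^-1, n.+2%:R]%classic.
have A0 n s : A n s -> 0 < s.
  by rewrite /A/= in_itv/= => /andP[+ _]; apply: lt_le_trans; rewrite invr_gt0.
have AE : \bigcup_n A n = `]0, +oo[%classic by exact: positive_halfline_itv.
have subA n : A n `<=` `]0, +oo[ by rewrite -AE; exact: bigcup_sup.
have ndA : {homo A : n m / (n <= m)%N >-> (n <= m)%O}.
  move=> n m nm; apply/subsetPset => s; rewrite /A/= !in_itv/= => /andP[h1 h2].
  apply/andP; split; last by apply: (le_trans h2); rewrite ler_nat !ltnS.
  by apply: le_trans h1; rewrite lef_pV2 ?posrE// ler_nat !ltnS.
have mA n : measurable (A n) by exact: measurable_itv.
have mA' n : measurable_fun (A n) (EFin \o f).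
  by apply/measurable_EFinP; exact: (measurable_funS _ (subA n) mf).
have f0A n s : A n s -> (0 <= (EFin \o f) s)%E by move=> /A0 s0; rewrite lee_fin f0.
have := @ge0_nondecreasing_set_cvg_integral _ (measurableTypeR R) R A (EFin \o f) mu ndA mA mA' f0A.
rewrite AE.
rewrite (_ : (\int[mu]_(x in _) `|_|)%E =
     (\int[mu]_(x in `]0%R, +oo[) (EFin \o f) x)%E); last first.
  apply: eq_integral => s; rewrite inE/= in_itv/= andbT => s0.
  by rewrite ger0_norm// f0.
move=> cv; apply: (@le_lt_trans _ _ (2 * C)%:E); last by rewrite ltry.
rewrite -(cvg_lim _ cv)//; apply: lime_le; first by apply/cvg_ex; eexists; exact: cv.
apply: nearW => n.
have ab : n.+2%:R^-1 < n.+2%:R :> R.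
  by rewrite (@lt_le_trans _ _ 1)// ?invf_lt1 ?ltr1n// ler1n.
rewrite (@continuous_FTC2 _ f F)//.
+ rewrite -EFinB lee_fin (le_trans (ler_norm _))// (le_trans (ler_normB _ _))//.
  by rewrite mulr_natl mulr2n lerD// FC// invr_gt0.
+ apply: continuous_in_subspaceT => s; rewrite inE => /A0; exact: cf.
+ by apply: (derivable_itv_LRcontinuous (f := f)); [move=> s /A0; exact: dF|exact: ltW].
+ move=> s; rewrite in_itv/= => /andP[h1 h2]; rewrite derive1E.
  by have /dF hd : 0 < s; [apply: lt_trans h1; rewrite invr_gt0|exact: derive_val].
Qed.

(** Comparison function for the energy density, which is bounded and decays like s^(-2). *)
Lemma integrable_inv_1Dsqr :
  mu.-integrable `]0, +oo[ (fun s : R => ((1 + s ^+ 2)^-1)%:E).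
Proof.
have p (s : R) : 0 < 1 + s ^+ 2 by rewrite ltr_pwDl// sqr_ge0.
apply: (@integrable_bounded_primitive (fun s => (1 + s ^+ 2)^-1) atan (pi / 2)).
- by move=> s _; rewrite invr_ge0 ltW.
- move=> s _; apply: continuousV; first by rewrite gt_eqF.
  by apply: continuousD; [exact: cst_continuous|exact: exprn_continuous].
- by move=> s _; rewrite ler_norml !ltW ?atan_gtNpi2 ?atan_ltpi2.
Qed.

(** Comparison function with the singularity s^(-1/2) that the isotropic radius has at the
    center. *)
Lemma integrable_inv_sqrt_1D :
  mu.-integrable `]0, +oo[ (fun s : R => ((Num.sqrt s * (1 + s))^-1)%:E).
Proof.
apply: (@integrable_bounded_primitive (fun s => (Num.sqrt s * (1 + s))^-1)
  (fun s => 2 * atan (Num.sqrt s)) pi).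
- by move=> s s0; rewrite invr_ge0 mulr_ge0 ?sqrtr_ge0 ?addr_ge0// ltW.
- move=> s s0; apply: continuousV.
    by rewrite mulf_neq0// gt_eqF ?sqrtr_gt0 ?addr_gt0.
  apply: continuousM; first exact: sqrt_continuous.
  by apply: continuousD; [exact: cst_continuous|move=> ?; exact: cvg_id].
- move=> s s0.
  have h1 := is_derive1_sqrt s0.
  have h2 := is_derive1_atan (Num.sqrt s).
  have h3 := is_derive1_comp h2 h1.
  apply: is_derive_eq.
  rewrite /GRing.scale/= sqr_sqrtr ?ltW//.
  have q0 : 0 < Num.sqrt s by rewrite sqrtr_gt0.
  field; rewrite gt_eqF ?addr_gt0//= gt_eqF//.
- move=> s s0; rewrite normrM ger0_norm// mulrC -ler_pdivlMr//.
  by rewrite ler_norml !ltW ?atan_gtNpi2 ?atan_ltpi2.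
Qed.

Lemma is_derive_integral_left (f : R -> R) (x : R) : 0 < x ->
  (forall u : R, mu.-integrable `]0, u] (EFin \o f)) -> {for x, continuous f} ->
  is_derive x (1 : R) (fun y : R => \int[mu]_(s in `]0, y[) f s) (f x).
Proof.
move=> x0 intf cf.
have xx1 : x < x + 1 by rewrite ltrDl.
have ax : (BRight 0 < BRight x :> itv_bound R)%O by rewrite bnd_simp.
have [d e] := @continuous_FTC1 R f (BRight 0) x (x + 1) xx1 (intf _) ax cf.
rewrite derive1E in e.
rewrite (_ : (fun y => _) = (fun y : R => \int[mu]_(s in `]0, y]) f s)).
  by split.
apply/funext => y; rewrite Rintegral_itv_bndo_bndc//.
apply: integrableS (intf y) => //.
by move=> z /=; rewrite !in_itv/= => /andP[-> /ltW].
Qed.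

Lemma is_derive_integral_right (f : R -> R) (x : R) : 0 < x ->
  mu.-integrable `]0, +oo[ (EFin \o f) -> {for x, continuous f} ->
  is_derive x (1 : R) (fun y : R => \int[mu]_(s in `]y, +oo[) f s) (- f x).
Proof.
move=> x0 intf cf.
have intu (u : R) : mu.-integrable `]0, u] (EFin \o f).
  by apply: integrableS intf => //; apply: subset_itvl.
have d := is_derive_integral_left x0 intu cf.
apply: (@near_eq_is_derive _ _ _
  (fun y : R => \int[mu]_(s in `]0%R, +oo[) f s - \int[mu]_(s in `]0%R, y[) f s)).
- near=> y; have y0 : 0 < y by near: y; exact: lt_nbhsr.
  rewrite Rintegral_itv_bndo_bndc; last first.
    by apply: integrableS intf => //; apply: subset_itvl.
  by rewrite Rintegral_itvB// bnd_simp ltW.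
- have := is_deriveB (is_derive_cst (\int[mu]_(s in `]0%R, +oo[) f s) x (1 : R)) d.
  by rewrite sub0r.
Unshelve. all: by end_near. Qed.

End integrability.

(** * The energy density and the cumulative mass *)

Section mass_function.
Context {R : realType}.
Variables (zeta : R -> R) (Q : R).
Hypotheses (adm : admissible zeta) (Q_neq0 : Q != 0).

(** Half the square of the Coulomb field Q / s^2. *)
Definition field_intensity (s : R) : R := Q ^+ 2 / (2 * s ^+ 4).

Definition energy_density (s : R) : R := zeta (field_intensity s) * s ^+ 2.

Lemma field_intensity_gt0 (s : R) : 0 < s -> 0 < field_intensity s.
Proof.
by move=> s0; rewrite divr_gt0 ?exprn_even_gt0 ?mulr_gt0 ?exprn_gt0.
Qed.

Lemma reduced_hamiltonian_gt0 (y : R) : 0 < y -> 0 < zeta y.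
Proof.
move=> y0; have [z1 z2] := adm_R2 adm y0.
by apply: lt_le_trans (_ : y * zeta^`()%classic y <= _); [exact: mulr_gt0|rewrite -subr_ge0].
Qed.

(** Near 0 the slope is below 2 by (R1); from d / 2 on, the square root in (R5) is at most a
    multiple of y. Linearity gives the decay of the energy density at infinity, where its argument
    is of order s^(-4). *)
Lemma reduced_hamiltonian_le_linear :
  exists2 A : R, 0 < A & forall y : R, 0 < y -> zeta y <= A * y.
Proof.
have [J [K [L [J0 K0 L0 h _]]]] := adm_R5 adm.
have /cvgr_lt/(_ _ (ltr1n R 2))[d /= d0 hd] := adm_R1 adm.
have d20 : 0 < d / 2 by rewrite divr_gt0.
exists (2 + J / Num.sqrt (d / 2)).
  by rewrite addr_gt0// divr_gt0// sqrtr_gt0.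
move=> y y0; have [yd|dy] := ltP y (d / 2).
  have := hd y; rewrite /ball_/= sub0r normrN gtr0_norm// => /(_ _ y0) h1.
  have h2 : zeta y / y < 2 by apply: h1; rewrite (lt_trans yd)// ltr_pdivrMr// ltr_pMr// ltr1n.
  move: h2; rewrite ltr_pdivrMr// => /ltW /le_trans; apply.
  by rewrite ler_pM2r// lerDl divr_ge0 ?sqrtr_ge0 ?ltW.
have [_ /le_trans] := andP (h y (ltW y0)); apply.
have q0 : 0 < Num.sqrt (d / 2) by rewrite sqrtr_gt0.
apply: (@le_trans _ _ (J / Num.sqrt (d / 2) * y)); last first.
  by rewrite ler_pM2r// lerDr.
rewrite -mulrA ler_pM2l// -{2}(sqr_sqrtr (ltW y0)) expr2 mulrA.
by rewrite ler_peMl ?sqrtr_ge0// mulrC ler_pdivlMr// mul1r ler_wsqrtr.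
Qed.

Lemma is_derive_energy_density (s : R) : 0 < s ->
  is_derive s (1 : R) energy_density
    (2 * s * (zeta (field_intensity s) -
              2 * field_intensity s * derive1 zeta (field_intensity s))).
Proof.
move=> s0.
have i0 := field_intensity_gt0 s0.
have d1 : is_derive (field_intensity s) (1 : R) zeta (derive1 zeta (field_intensity s)).
  rewrite derive1E; exact: (derivableP (adm_derivable adm i0)).
have n0 : 2 * s ^+ 4 != 0 by rewrite gt_eqF ?mulr_gt0 ?exprn_gt0.
have d2 : is_derive s (1 : R) field_intensity (- 4 * field_intensity s / s).
  have dX : is_derive s (1 : R) (fun s : R => s ^+ 4) (4 * s ^+ 3).
    by apply: is_derive_eq; rewrite /GRing.scale/=; ring.
  have dX2 : is_derive s (1 : R) (fun s : R => 2 * s ^+ 4) (2 * (4 * s ^+ 3)).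
    by have := is_deriveZ 2 dX.
  have := is_deriveZ (Q ^+ 2) (@is_derive_inv _ _ (fun s : R => 2 * s ^+ 4) s 1 _ n0 dX2).
  rewrite (_ : _ *: _ = - 4 * field_intensity s / s)//.
  by rewrite /GRing.scale/= /field_intensity; field; rewrite gt_eqF.
have d3 := is_derive1_comp d1 d2.
have dX : is_derive s (1 : R) (fun s : R => s ^+ 2) (2 * s).
  by apply: is_derive_eq; rewrite /GRing.scale/=; ring.
have := is_deriveM d3 dX.
rewrite (_ : _ + _ = 2 * s * (zeta (field_intensity s) -
  2 * field_intensity s * derive1 zeta (field_intensity s)))//.
rewrite /GRing.scale/=; set d := derive1 _ _; rewrite -/(field_intensity s).
by field; rewrite gt_eqF.
Qed.

Lemma continuous_energy_density (s : R) : 0 < s ->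
  {for s, continuous energy_density}.
Proof. by move=> /is_derive_energy_density; exact: is_derive_continuous. Qed.

Lemma energy_density_gt0 (s : R) : 0 < s -> 0 < energy_density s.
Proof.
by move=> s0; rewrite mulr_gt0 ?exprn_gt0// reduced_hamiltonian_gt0 ?field_intensity_gt0.
Qed.

(** In (R5) the square root of the argument, times s^2, is the constant |Q| / sqrt 2. *)
Lemma energy_density_bounded :
  exists2 B : R, 0 < B & forall s : R, 0 < s -> energy_density s <= B.
Proof.
have [J [K [L [J0 K0 L0 h _]]]] := adm_R5 adm.
exists (J * Num.sqrt (Q ^+ 2 / 2)).
  by rewrite mulr_gt0 ?sqrtr_gt0 ?divr_gt0// exprn_even_gt0.
move=> s s0; have [_ h2] := andP (h _ (ltW (field_intensity_gt0 s0))).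
have s4 : Num.sqrt (field_intensity s) * s ^+ 2 = Num.sqrt (Q ^+ 2 / 2).
  have -> : s ^+ 2 = Num.sqrt ((s ^+ 2) ^+ 2) by rewrite sqrtr_sqr ger0_norm// sqr_ge0.
  rewrite -sqrtrM ?ltW ?field_intensity_gt0//; congr Num.sqrt.
  by rewrite /field_intensity; field; rewrite gt_eqF.
by rewrite -s4 mulrA ler_pM2r ?exprn_gt0.
Qed.

(** Both terms are J sqrt(mu) up to the constants of (R5), so the unbounded parts cancel. This
    controls the angular component of the Einstein tensor. *)
Lemma energy_density_slope_bounded : exists2 B : R, 0 < B &
  forall s : R, 0 < s -> `|zeta (field_intensity s) -
    2 * field_intensity s * derive1 zeta (field_intensity s)| <= B.
Proof.
have [J [K [L [J0 K0 L0 h1 h2]]]] := adm_R5 adm.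
exists (K + 2 * L); first by rewrite addr_gt0// mulr_gt0.
move=> s s0; have i0 := field_intensity_gt0 s0.
have /andP[a1 a2] := h1 _ (ltW i0); have /andP[b1 b2] := h2 _ i0.
by rewrite ler_norml; apply/andP; split; lra.
Qed.

Lemma integrable_energy_density :
  (@lebesgue_measure R).-integrable `]0, +oo[ (EFin \o energy_density).
Proof.
have [B B0 hB] := energy_density_bounded.
have [A A0 hA] := reduced_hamiltonian_le_linear.
(* [B] bounds the energy density and A Q^2 / 2 bounds it times s^2; their sum bounds it times 1 +
   s^2. *)
pose C := B + A * (Q ^+ 2 / 2).
have intC : (@lebesgue_measure R).-integrable `]0, +oo[
    (fun s : R => C%:E * ((1 + s ^+ 2)^-1)%:E)%E.
  by apply: integrableZl => //; exact: integrable_inv_1Dsqr.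
apply: le_integrable intC => //.
  apply/measurable_EFinP; apply: open_continuous_measurable_fun.
    exact: interval_open.
  by move=> s; rewrite inE/= in_itv/= andbT; exact: continuous_energy_density.
move=> s /=; rewrite in_itv/= andbT => s0; rewrite lee_fin.
have p : 0 < 1 + s ^+ 2 by rewrite ltr_pwDl// sqr_ge0.
have C0 : 0 < C by rewrite addr_gt0// mulr_gt0// divr_gt0// exprn_even_gt0.
rewrite !gtr0_norm ?energy_density_gt0//; last by rewrite divr_gt0.
rewrite ler_pdivlMr// mulrDr mulr1 lerD ?hB//.
have := hA _ (field_intensity_gt0 s0).
rewrite -(ler_pM2r (exprn_gt0 4 s0)) => h.
rewrite (le_trans _ (le_trans h _))//.
  by rewrite /energy_density le_eqVlt; apply/orP; left; apply/eqP; ring.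
by rewrite /field_intensity le_eqVlt; apply/orP; left; apply/eqP; field; rewrite gt_eqF.
Qed.

Variables (c M : R).
Hypothesis c_gt0 : 0 < c.
Let m := mass c zeta Q M.

Lemma is_derive_mass (r : R) : 0 < r ->
  is_derive r (1 : R) m (c ^- 2 * energy_density r).
Proof.
move=> r0; have d := is_derive_integral_right r0 integrable_energy_density
  (continuous_energy_density r0).
have := is_deriveB (is_derive_cst M r (1 : R)) (is_deriveZ (c ^- 2) d).
by rewrite sub0r /GRing.scale/= mulrN opprK.
Qed.

Lemma mass_nondecreasing (r s : R) : 0 < r -> r <= s -> m r <= m s.
Proof.
move=> r0; rewrite le_eqVlt => /orP[/eqP->//|rs].
have dm (u : R) : u \in `]r, s[ -> is_derive u (1 : R) m (c ^- 2 * energy_density u).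
  by rewrite in_itv/= => /andP[ru _]; apply: is_derive_mass; exact: lt_trans ru.
have cm : {within `[r, s], continuous m}.
  apply: continuous_in_subspaceT => u; rewrite inE/= in_itv/= => /andP[ru _].
  by apply: is_derive_continuous (is_derive_mass _); exact: lt_le_trans ru.
have [u + e] := MVT rs dm cm; rewrite in_itv/= => /andP[ru _].
have e0 : 0 <= energy_density u.
  by apply: ltW; apply: energy_density_gt0; exact: lt_trans ru.
have c20 : 0 <= c ^- 2 by rewrite invr_ge0 exprn_ge0// ltW.
rewrite -subr_ge0 e; apply: mulr_ge0; first exact: mulr_ge0.
by rewrite subr_ge0 ltW.
Qed.

Lemma mass_ge_bare (m0 r : R) : m r @[r --> 0^'+] --> m0 -> 0 < r -> m0 <= m r.
Proof.
move=> m0P r0; rewrite -(cvg_lim _ m0P)//; apply: limr_le.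
  by apply/cvg_ex; exists m0.
near=> s; apply: mass_nondecreasing; first by [].
by near: s; exact: nbhs_right_le.
Unshelve. all: by end_near. Qed.

End mass_function.

(** * Derivatives of e^(2 alpha) *)

Section lapse_function.
Context {R : realType}.
Variable al : R -> R.
Hypothesis al_smooth : forall (n : nat) (r : R), 0 < r -> derivable (derive1n n al) r 1.

Let a1 := derive1n 1 al.
Let a2 := derive1n 2 al.
Let a3 := derive1n 3 al.

(** Expressed through alpha, whose smoothness is what the spacetime provides; three derivatives are
    then explicit in those of alpha. *)
Definition lapse2 (r : R) : R := expR (2 * al r).
Definition lapse2' (r : R) : R := 2 * a1 r * lapse2 r.
Definition lapse2'' (r : R) : R := (2 * a2 r + 4 * a1 r ^+ 2) * lapse2 r.
Definition lapse2''' (r : R) : R :=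
  (2 * a3 r + 12 * a1 r * a2 r + 8 * a1 r ^+ 3) * lapse2 r.

Let is_derive_derive1n (n : nat) (r : R) : 0 < r ->
  is_derive r (1 : R) (derive1n n al) (derive1n n.+1 al r).
Proof. by move=> r0; have := derivableP (@al_smooth n r r0); rewrite -derive1E. Qed.

Lemma is_derive_lapse2 (r : R) : 0 < r -> is_derive r (1 : R) lapse2 (lapse2' r).
Proof.
move=> r0; have d0 : is_derive r (1 : R) al (a1 r) := is_derive_derive1n 0 r0.
have dd : is_derive r (1 : R) (fun y => 2 * al y) (2 * a1 r) := is_deriveZ 2 d0.
have d := @is_derive1_comp _ expR (fun y => 2 * al y) _ _ _ (is_derive_expR (2 * al r)) dd.
rewrite (_ : lapse2' r = expR (2 * al r) * (2 * a1 r))//.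
by rewrite /lapse2' /lapse2 /GRing.scale/=; ring.
Qed.

Lemma is_derive_lapse2' (r : R) : 0 < r -> is_derive r (1 : R) lapse2' (lapse2'' r).
Proof.
move=> r0; have d1 : is_derive r (1 : R) a1 (a2 r) := is_derive_derive1n 1 r0.
have d := is_deriveM (is_deriveZ 2 d1) (is_derive_lapse2 r0).
apply: (is_derive_eq d).
rewrite /lapse2'' /lapse2' ?fctE /GRing.scale/= /GRing.scale/= ?fctE; ring.
Qed.

Lemma is_derive_lapse2'' (r : R) : 0 < r -> is_derive r (1 : R) lapse2'' (lapse2''' r).
Proof.
move=> r0; have d1 : is_derive r (1 : R) a1 (a2 r) := is_derive_derive1n 1 r0.
have d2 : is_derive r (1 : R) a2 (a3 r) := is_derive_derive1n 2 r0.
have d := is_deriveM (is_deriveD (is_deriveZ 2 d2) (is_deriveZ 4 (is_deriveM d1 d1)))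
  (is_derive_lapse2 r0).
apply: (is_derive_eq d).
rewrite /lapse2''' /lapse2' ?fctE /GRing.scale/= /GRing.scale/= ?fctE; ring.
Qed.

Lemma continuous_lapse2''' (r : R) : 0 < r -> {for r, continuous lapse2'''}.
Proof.
move=> r0.
have cn n : {for r, continuous (derive1n n al)} := is_derive_continuous (is_derive_derive1n n r0).
have cS := is_derive_continuous (is_derive_lapse2 r0).
apply: continuousM => //; apply: continuousD; first apply: continuousD.
- by apply: continuousM; [exact: cst_continuous|exact: (cn 3%N)].
- apply: continuousM; last exact: (cn 2%N).
  by apply: continuousM; [exact: cst_continuous|exact: (cn 1%N)].
- apply: continuousM; first exact: cst_continuous.
  by apply: (@continuous_comp _ _ _ a1 (fun z => z ^+ 3)); [exact: (cn 1%N)|exact: exprn_continuous].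
Qed.

End lapse_function.

(** * Field equations and bounds at the center *)

Section center_bounds.
Context {R : realType}.
Variables (NG c : R) (zeta : R -> R) (Q M m0 : R).
Hypotheses (NG_gt0 : 0 < NG) (c_gt0 : 0 < c) (adm : admissible zeta) (Q_neq0 : Q != 0).
Let al := alpha NG c zeta Q M.
Let m := mass c zeta Q M.
Hypothesis al_smooth : forall (n : nat) (r : R), 0 < r -> derivable (derive1n n al) r 1.
Hypothesis naked : forall r : R, 0 < r -> 0 < exp2alpha NG c zeta Q M r.
Hypothesis m0P : m r @[r --> 0^'+] --> m0.
Let S := lapse2 al.
Let k := 2 * NG / c ^+ 2.
Let k_gt0 : 0 < k. Proof. by rewrite divr_gt0 ?mulr_gt0 ?exprn_gt0. Qed.
Let f := energy_density zeta Q.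

Lemma lapse2E (r : R) : 0 < r -> S r = 1 - k * m r / r.
Proof.
move=> r0; rewrite /S /lapse2 /al /alpha mulrC divfK ?pnatr_eq0// lnK ?posrE ?naked//.
by rewrite /exp2alpha /k /m; field; rewrite !gt_eqF.
Qed.

(** The derivative of r S = r - k m, with m' given by the energy density. *)
Lemma lapse2'_field_equation (r : R) : 0 < r ->
  r * lapse2' al r + S r - 1 = - (k / c ^+ 2 * f r).
Proof.
move=> r0; rewrite lapse2E//.
have dV : is_derive r (1 : R) (fun r : R => r^-1) (- 1 / r ^+ 2).
  by apply: (@is_derive_inv _ _ (fun r : R => r)); rewrite gt_eqF.
have dm := is_deriveM (is_derive_mass adm Q_neq0 c M r0) dV.
have d2 := is_deriveB (is_derive_cst (1 : R) r (1 : R)) (is_deriveZ k dm).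
have e : lapse2' al r = 0 - k *: (m r *: (- 1 / r ^+ 2) + r^-1 *: (c ^- 2 * f r)).
  have [_ <-] := is_derive_lapse2 al_smooth r0.
  have [_ <-] := d2; apply: near_eq_derive.
  near=> y; rewrite -/S lapse2E ?fctE /GRing.scale/= /GRing.scale/= ?fctE ?mulrA//.
  by near: y; exact: lt_nbhsr.
rewrite e /GRing.scale/=; field.
by rewrite !gt_eqF.
Unshelve. all: by end_near. Qed.

(** Differentiating the previous equation gives r D + 2 T on the left, which is 2 r times the
    angular component; the right side carries the same factor 2 r. *)
Lemma lapse2''_field_equation (r : R) : 0 < r ->
  lapse2' al r / r + lapse2'' al r / 2 =
  - (k / c ^+ 2 * (zeta (field_intensity Q r) -
       2 * field_intensity Q r * derive1 zeta (field_intensity Q r))).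
Proof.
move=> r0.
have dS := is_derive_lapse2 al_smooth r0.
have dT := is_derive_lapse2' al_smooth r0.
have dr : is_derive r (1 : R) (fun r : R => r) (1 : R) by exact: is_derive_id.
have d1 := is_deriveB (is_deriveD (is_deriveM dr dT) dS) (is_derive_cst (1 : R) r (1 : R)).
have d2 := is_deriveN (is_deriveZ (k / c ^+ 2) (is_derive_energy_density adm Q_neq0 r0)).
have e : r *: lapse2'' al r + lapse2' al r *: 1 + lapse2' al r - 0 =
  - (k / c ^+ 2 *: (2 * r * (zeta (field_intensity Q r) -
       2 * field_intensity Q r * derive1 zeta (field_intensity Q r)))).
  have [_ <-] := d1; have [_ <-] := d2; apply: near_eq_derive.
  near=> y; have y0 : 0 < y by near: y; exact: lt_nbhsr.
  have := lapse2'_field_equation y0; rewrite ?fctE /GRing.scale/= => ->//.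
move: e; rewrite /GRing.scale/= subr0 => e.
have r2 : 2 * r != 0 by rewrite gt_eqF ?mulr_gt0.
apply: (mulfI r2).
transitivity (r * lapse2'' al r + lapse2' al r * 1 + lapse2' al r).
  by field; rewrite gt_eqF.
by rewrite e; ring.
Unshelve. all: by end_near. Qed.

Lemma lapse2_center_bound (R1 : R) : exists2 C, 0 < C & forall r, 0 < r <= R1 ->
  [/\ `|r * lapse2' al r + S r - 1| <= C,
      `|lapse2' al r / r + lapse2'' al r / 2| <= C & r * S r <= C].
Proof.
have [B1 B10 hB1] := energy_density_bounded adm Q_neq0.
have [B2 B20 hB2] := energy_density_slope_bounded adm Q_neq0.
have k2 : 0 < k / c ^+ 2 by rewrite divr_gt0 ?exprn_gt0.
pose x1 := k / c ^+ 2 * B1; pose x2 := k / c ^+ 2 * B2; pose x3 := `|R1| + k * `|m0|.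
have x10 : 0 < x1 by rewrite mulr_gt0.
have x20 : 0 < x2 by rewrite mulr_gt0.
have x30 : 0 <= x3 by rewrite addr_ge0// mulr_ge0// ltW.
exists (x1 + x2 + x3); first by rewrite ltr_pwDl ?addr_gt0.
move=> r /andP[r0 rR]; split.
- rewrite lapse2'_field_equation// normrN normrM (gtr0_norm k2).
  rewrite (gtr0_norm (energy_density_gt0 adm Q_neq0 r0)).
  apply: (@le_trans _ _ x1); first by rewrite ler_pM2l// hB1.
  by rewrite -addrA lerDl addr_ge0// ltW.
- rewrite lapse2''_field_equation// normrN normrM (gtr0_norm k2).
  apply: (@le_trans _ _ x2); first by rewrite ler_pM2l// hB2.
  by rewrite addrAC lerDr addr_ge0// ltW.
- rewrite lapse2E//; apply: (@le_trans _ _ x3); last first.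
    by rewrite lerDr addr_ge0// ltW.
  (* The mass increases outwards from m0, so r S = r - k m stays below R1 + k |m0|. *)
  have -> : r * (1 - k * m r / r) = r - k * m r by field; rewrite gt_eqF.
  rewrite lerD ?(le_trans rR) ?ler_norm// -mulrN ler_pM2l//.
  apply: (@le_trans _ _ (- m0)); last by rewrite -normrN ler_norm.
  have mb := mass_ge_bare adm Q_neq0 c_gt0 m0P r0.
  by rewrite lerN2.
Qed.

End center_bounds.

(** * Integrands with an inverse square root singularity *)

Section singular_primitive.
Context {R : realType}.
Notation mu := (@lebesgue_measure R).

(** A multiple of 1 / (sqrt s (1 + s)) dominates: the hypothesis on [h] handles (0, d), and on the
    compact rest |h| has a maximum. The two terms of [C] correspond to these cases. *)
Lemma integrable_sqrt_singularity (h : R -> R) (d A u : R) : 0 < d ->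
  (forall s : R, 0 < s -> {for s, continuous h}) ->
  (forall s : R, 0 < s < d -> `|h s| <= A / Num.sqrt s) ->
  mu.-integrable `]0, u] (EFin \o h).
Proof.
move=> d0 ch hA; pose b := Num.max u d.
have db : d <= b by rewrite le_max lexx orbT.
have cabs : {within `[d, b], continuous (fun s => `|h s|)}.
  apply: continuous_in_subspaceT => s; rewrite inE/= in_itv/= => /andP[ds _].
  apply: (@continuous_comp _ _ _ h (fun z => `|z|)); last exact: norm_continuous.
  by apply: ch; exact: lt_le_trans ds.
have [e _ he] := EVT_max db cabs.
pose H := `|h e|; pose C := `|A| * (1 + d) + H * (Num.sqrt b * (1 + b)).
have b0 : 0 < b by exact: lt_le_trans db.
have C1 : 0 <= `|A| * (1 + d) by rewrite mulr_ge0// addr_ge0// ltW.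
have C2 : 0 <= H * (Num.sqrt b * (1 + b)).
  by rewrite mulr_ge0 ?normr_ge0// mulr_ge0 ?sqrtr_ge0// addr_ge0// ltW.
have intC : mu.-integrable `]0, u]
    (fun s : R => C%:E * ((Num.sqrt s * (1 + s))^-1)%:E)%E.
  have i2 : mu.-integrable `]0, +oo[
      (fun s : R => C%:E * ((Num.sqrt s * (1 + s))^-1)%:E)%E.
    by apply: integrableZl => //; exact: integrable_inv_sqrt_1D.
  by apply: integrableS i2 => //; apply: subset_itvl.
apply: le_integrable intC => //.
  apply/measurable_EFinP.
  apply: (@measurable_funS _ _ _ _ (`]0, +oo[%classic : set R)); [by []|by apply: subset_itvl|].
  apply: open_continuous_measurable_fun; first exact: interval_open.
  by move=> s; rewrite inE/= in_itv/= andbT; exact: ch.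
move=> s /=; rewrite in_itv/= => /andP[s0 su]; rewrite lee_fin.
have q0 : 0 < Num.sqrt s by rewrite sqrtr_gt0.
have p0 : 0 < Num.sqrt s * (1 + s) by rewrite mulr_gt0// addr_gt0.
rewrite [leRHS]ger0_norm; last by rewrite divr_ge0 ?addr_ge0// ltW.
rewrite ler_pdivlMr//.
have [sd|ds] := ltP s d.
  apply: (@le_trans _ _ (`|A| * (1 + d))); last by rewrite lerDl.
  rewrite mulrA ler_pM ?mulr_ge0 ?addr_ge0 ?(ltW s0) ?(ltW q0)//.
    rewrite -ler_pdivlMr// (le_trans (hA s _)) ?s0//.
    by rewrite ler_pM2r ?invr_gt0// ler_norm.
  by rewrite lerD2l ltW.
apply: (@le_trans _ _ (H * (Num.sqrt b * (1 + b)))); last by rewrite lerDr.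
have sb : s <= b by rewrite le_max su.
rewrite ler_pM ?mulr_ge0 ?addr_ge0 ?(ltW s0) ?(ltW q0)//.
  by apply: he; rewrite in_itv/= ds.
rewrite ler_pM ?addr_ge0 ?(ltW s0) ?(ltW q0)//; first by rewrite ler_wsqrtr.
by rewrite lerD2l.
Qed.

Lemma cvg_integral_at0 (h : R -> R) : (forall u : R, mu.-integrable `]0, u] (EFin \o h)) ->
  \int[mu]_(s in `]0, r[) h s @[r --> 0^'+] --> (0 : R).
Proof.
move=> ih.
have ih01 : mu.-integrable `[0, 1] (EFin \o h).
  have /integrableP[mh ph] := ih 1.
  have mh' : measurable_fun (`[0, 1]%classic : set R) (EFin \o h).
    by apply/emeasurable_fun_itv_obnd_cbndP.
  apply/integrableP; split => //.
  by rewrite -integral_itv_obnd_cbnd//; exact: measurableT_comp.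
rewrite (_ : (fun r => _) = (fun r : R => parameterized_integral mu 0 r h)).
  exact: cvg_at_right_filter (parameterized_integral_cvg_left ltr01 ih01).
apply/funext => r; rewrite /parameterized_integral -Rintegral_itv_obnd_cbnd//.
rewrite Rintegral_itv_bndo_bndc//.
by apply: integrableS (ih r) => // s /=; rewrite !in_itv/= => /andP[-> /ltW].
Qed.

End singular_primitive.

(** * Inverse of an increasing function on the positive half-line *)

Section increasing_inverse.
Context {R : realType}.
Variables (I dI : R -> R) (l : R).
Hypothesis dIP : forall r : R, 0 < r -> is_derive r (1 : R) I (dI r).
Hypothesis dI_gt0 : forall r : R, 0 < r -> 0 < dI r.
Hypothesis I0 : I r @[r --> 0^'+] --> l.
Hypothesis Iy : forall y : R, exists2 r, 0 < r & y < I r.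

Let inv (y : R) : R := xget 0 [set r : R | 0 < r /\ I r = y].

Let cI (r : R) : 0 < r -> {for r, continuous I}.
Proof. by move=> /dIP; exact: is_derive_continuous. Qed.

Lemma increasing_on_positives (r s : R) : 0 < r -> r < s -> I r < I s.
Proof.
move=> r0 rs.
have dr (u : R) : u \in `]r, s[ -> is_derive u (1 : R) I (dI u).
  by rewrite in_itv/= => /andP[ru _]; apply: dIP; exact: lt_trans ru.
have cr : {within `[r, s], continuous I}.
  apply: continuous_in_subspaceT => u; rewrite inE/= in_itv/= => /andP[ru _].
  by apply: cI; exact: lt_le_trans ru.
have [u + e] := MVT rs dr cr; rewrite in_itv/= => /andP[ru _].
by rewrite -subr_gt0 e mulr_gt0 ?subr_gt0// dI_gt0// (lt_trans r0).
Qed.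

Lemma increasing_gt_limit (r : R) : 0 < r -> l < I r.
Proof.
move=> r0; have r20 : 0 < r / 2 by rewrite divr_gt0.
apply: (@le_lt_trans _ _ (I (r / 2))); last first.
  by apply: increasing_on_positives => //; rewrite ltr_pdivrMr// ltr_pMr// ltr1n.
rewrite -(cvg_lim _ I0)//; apply: limr_le; first by apply/cvg_ex; exists l.
near=> s; apply: ltW; apply: increasing_on_positives; first by [].
by near: s; exact: nbhs_right_lt.
Unshelve. all: by end_near. Qed.

(** Intermediate values between a point near 0, where [I] is close to [l], and one supplied by
    unboundedness. *)
Lemma increasing_inverse_spec (y : R) : l < y -> 0 < inv y /\ I (inv y) = y.
Proof.
move=> ly; suff [r r0 e] : exists2 r, 0 < r & I r = y.
  by apply: (@xgetPex _ 0 [set r : R | 0 < r /\ I r = y]); exists r.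
have [r2 r20 yr2] := Iy y.
have /filter_ex[r1 [r10 r12 Ir1]] :
    \forall r1 \near (0 : R)^'+, [/\ 0 < r1, r1 < r2 & I r1 < y].
  have /cvgr_lt/(_ _ ly) Ily := I0.
  near=> r1; split; first by [].
  - by near: r1; exact: nbhs_right_lt.
  - by near: r1; exact: Ily.
have cr : {within `[r1, r2], continuous I}.
  apply: continuous_in_subspaceT => u; rewrite inE/= in_itv/= => /andP[ru _].
  by apply: cI; exact: lt_le_trans ru.
have [|r + e] := IVT (ltW r12) cr (v := y).
  rewrite minElt maxElt (increasing_on_positives r10 r12)//.
  by rewrite !ltW.
by rewrite in_itv/= => /andP[r1r _]; exists r => //; exact: lt_le_trans r1r.
Unshelve. all: by end_near. Qed.

Lemma increasing_inverseK (r : R) : 0 < r -> inv (I r) = r.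
Proof.
move=> r0; have [i0 e] := increasing_inverse_spec (increasing_gt_limit r0).
case: (ltgtP (inv (I r)) r) => // h.
- by have := increasing_on_positives i0 h; rewrite e ltxx.
- by have := increasing_on_positives r0 h; rewrite e ltxx.
Qed.

Lemma is_derive_increasing_inverse (y : R) : l < y ->
  is_derive y (1 : R) inv (dI (inv y))^-1.
Proof.
move=> ly; have [i0 e] := increasing_inverse_spec ly.
rewrite -{1}e; apply: (@is_derive_inverse _ I inv).
- by near=> r; apply: increasing_inverseK; near: r; exact: lt_nbhsr.
- by near=> r; apply: cI; near: r; exact: lt_nbhsr.
- exact: dIP.
- by rewrite gt_eqF// dI_gt0.
Unshelve. all: by end_near. Qed.

Lemma increasing_inverse_le (y r : R) : l < y -> 0 < r -> y <= I r -> inv y <= r.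
Proof.
move=> ly r0 yr; have [i0 e] := increasing_inverse_spec ly.
rewrite leNgt; apply/negP => /(increasing_on_positives r0).
by rewrite e ltNge yr.
Qed.

Lemma increasing_inverse_bound (y1 : R) : exists2 r1, 0 < r1 &
  forall y, l < y <= y1 -> inv y <= r1.
Proof.
have [r1 r10 y1r] := Iy y1; exists r1 => // y /andP[ly yy1].
by apply: increasing_inverse_le => //; rewrite (le_trans yy1)// ltW.
Qed.

Lemma cvg_increasing_inverse : inv y @[y --> l^'+] --> (0 : R).
Proof.
apply/cvgr0Pnorm_le => e e0.
have lI := increasing_gt_limit e0.
near=> y; have ly : l < y by [].
have [i0 _] := increasing_inverse_spec ly.
rewrite ger0_norm; last exact: ltW.
apply: increasing_inverse_le => //.
by near: y; exact: nbhs_right_le.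
Unshelve. all: by end_near. Qed.

End increasing_inverse.

(** * The isotropic radius and the assembly of the metric *)

Section isotropic_radius.
Context {R : realType}.
Notation mu := (@lebesgue_measure R).
Variables (NG c : R) (zeta : R -> R) (Q M m0 rho0 : R).
Hypotheses (NG_gt0 : 0 < NG) (c_gt0 : 0 < c) (adm : admissible zeta) (Q_neq0 : Q != 0).
Let al := alpha NG c zeta Q M.
Let m := mass c zeta Q M.
Hypothesis naked : forall r : R, 0 < r -> 0 < exp2alpha NG c zeta Q M r.
Hypothesis m0P : m r @[r --> 0^'+] --> m0.
Hypotheses (m0_lt0 : m0 < 0) (rho0_gt0 : 0 < rho0).
Let S := lapse2 al.
Let k := 2 * NG / c ^+ 2.
Let k_gt0 : 0 < k. Proof. by rewrite divr_gt0 ?mulr_gt0 ?exprn_gt0. Qed.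
Let I := iso_radius NG c zeta Q M rho0.
Let h (s : R) : R := (Num.sqrt (s ^+ 2 - 2 * NG / c ^+ 2 * s * m s))^-1.

Lemma radicandE (s : R) : 0 < s ->
  s ^+ 2 - 2 * NG / c ^+ 2 * s * m s = s ^+ 2 * S s.
Proof. by move=> s0; rewrite /S lapse2E// -/m; field; rewrite !gt_eqF. Qed.

Let S_gt0 (s : R) : 0 < S s. Proof. exact: expR_gt0. Qed.

Lemma radicand_gt0 (s : R) : 0 < s -> 0 < s ^+ 2 - 2 * NG / c ^+ 2 * s * m s.
Proof. by move=> s0; rewrite radicandE// mulr_gt0 ?exprn_gt0 ?S_gt0. Qed.

Lemma isotropic_integrandE (s : R) : 0 < s -> h s = (s * Num.sqrt (S s))^-1.
Proof.
by move=> s0; rewrite /h radicandE// sqrtrM ?sqr_ge0// sqrtr_sqr gtr0_norm.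
Qed.

Lemma isotropic_integrand_gt0 (s : R) : 0 < s -> 0 < h s.
Proof.
by move=> s0; rewrite isotropic_integrandE// invr_gt0 mulr_gt0// sqrtr_gt0 S_gt0.
Qed.

Lemma continuous_isotropic_integrand (s : R) : 0 < s -> {for s, continuous h}.
Proof.
move=> s0.
have cm := is_derive_continuous (is_derive_mass adm Q_neq0 c M s0).
apply: continuousV.
  by rewrite gt_eqF// sqrtr_gt0 radicand_gt0.
apply: (@continuous_comp _ _ _
  (fun s : R => s ^+ 2 - 2 * NG / c ^+ 2 * s * m s) (fun z : R => Num.sqrt z)); last exact: sqrt_continuous.
apply: continuousB; first exact: exprn_continuous.
apply: continuousM => //; apply: continuousM; last by move=> ?; exact: cvg_id.
exact: cst_continuous.
Qed.

(** Negativity of the bare mass is decisive here: near the center m < m0 / 2, so the radicand is at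
    least k (-m0 / 2) s and the integrand has an integrable singularity. *)
Lemma isotropic_integrand_center : exists d A : R, 0 < d /\
  forall s : R, 0 < s < d -> `|h s| <= A / Num.sqrt s.
Proof.
have m02 : m0 < m0 / 2.
  by rewrite ltr_pdivlMr// mulr_natr mulr2n gtrDl.
have /cvgr_lt/(_ _ m02)[d /= d0 hd] := m0P.
exists d, (Num.sqrt (k * (- m0 / 2)))^-1; split => // s /andP[s0 sd].
have b0 : 0 < k * (- m0 / 2) by rewrite mulr_gt0// divr_gt0// oppr_gt0.
rewrite gtr0_norm ?isotropic_integrand_gt0// -invfM -sqrtrM ?(ltW b0)//.
have ms : m s < m0 / 2 by apply: hd => //; rewrite /ball_/= sub0r normrN gtr0_norm.
have q0 := radicand_gt0 s0; have bs0 := mulr_gt0 b0 s0.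
rewrite lef_pV2 ?posrE ?sqrtr_gt0//.
rewrite ler_wsqrtr// -/k.
have h1 : s * m s <= s * (m0 / 2) by rewrite ler_pM2l// ltW.
have h2 : k * (s * m s) <= k * (s * (m0 / 2)) by rewrite ler_pM2l.
have h3 : 0 <= s ^+ 2 by exact: sqr_ge0.
by move: h2 h3; rewrite !mulrA => h2 h3; lra.
Qed.

Lemma integrable_isotropic_integrand (u : R) : mu.-integrable `]0, u] (EFin \o h).
Proof.
have [d [A [d0 hA]]] := isotropic_integrand_center.
exact: (integrable_sqrt_singularity u d0 continuous_isotropic_integrand hA).
Qed.

Let F (r : R) : R := \int[mu]_(s in `]0, r[) h s.

Let dF (r : R) : 0 < r -> is_derive r (1 : R) F (h r).
Proof.
move=> r0; apply: is_derive_integral_left => //.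
  exact: integrable_isotropic_integrand.
exact: continuous_isotropic_integrand.
Qed.

Lemma is_derive_iso_radius (r : R) : 0 < r -> is_derive r (1 : R) I (I r * h r).
Proof.
move=> r0; have d := is_derive1_comp (is_derive_expR (F r)) (dF r0).
have := is_deriveZ rho0 d.
by rewrite /GRing.scale/= mulrA.
Qed.

Lemma iso_radius_gt0 (r : R) : 0 < I r.
Proof. by rewrite mulr_gt0// expR_gt0. Qed.

Lemma cvg_iso_radius : I r @[r --> 0^'+] --> rho0.
Proof.
have F0 : F r @[r --> 0^'+] --> (0 : R).
  exact: (cvg_integral_at0 integrable_isotropic_integrand).
have e0 : expR (F r) @[r --> 0^'+] --> (1 : R).
  rewrite -[X in _ --> X](@expR0 R); apply: continuous_cvg F0.
  exact: continuous_expR.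
by rewrite -[X in _ --> X]mulr1; apply: cvgM e0; exact: cvg_cst.
Qed.

(** For s >= 1, m >= m0 bounds the radicand by (1 + k |m0|) s^2, so the exponent grows at least like
    ln r / a. *)
Lemma iso_radius_unbounded (y : R) : exists2 r : R, 0 < r & y < I r.
Proof.
pose a := Num.sqrt (1 + k * `|m0|).
have a0 : 0 < a by rewrite sqrtr_gt0 ltr_pwDl// mulr_ge0// ltW.
have ha (s : R) : 1 <= s -> (a * s)^-1 <= h s.
  move=> s1; have s0 : 0 < s by exact: lt_le_trans s1.
  have q0 := radicand_gt0 s0; have as0 := mulr_gt0 a0 s0.
  rewrite /h lef_pV2 ?posrE ?sqrtr_gt0//.
  have -> : a * s = Num.sqrt ((1 + k * `|m0|) * s ^+ 2).
    by rewrite sqrtrM ?sqrtr_sqr ?(gtr0_norm s0)// addr_ge0// mulr_ge0// ltW.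
  rewrite ler_wsqrtr// -/k.
  have mb := mass_ge_bare adm Q_neq0 c_gt0 m0P s0.
  have h1 : - (k * s * m s) <= k * `|m0| * s.
    rewrite -mulrN mulrAC; apply: ler_wpM2r; first exact: ltW.
    rewrite ler_pM2l//; apply: (@le_trans _ _ (- m0)); first by rewrite lerN2.
    by rewrite -normrN ler_norm.
  have h2 : k * `|m0| * s <= k * `|m0| * s ^+ 2.
    apply: ler_wpM2l; first by rewrite mulr_ge0// ltW.
    by rewrite expr2 ler_peMl// ltW.
  by rewrite mulrDl mul1r lerD2l (le_trans h1).
have grow (r : R) : 1 < r -> F 1 + ln r / a <= F r.
  move=> r1.
  have dG0 (u : R) : 0 < u -> is_derive u (1 : R)
      (fun u : R => F u - ln u / a) (h u - (a * u)^-1).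
    move=> u0; have dln := is_deriveM (is_derive1_ln u0) (is_derive_cst a^-1 u (1 : R)).
    have := is_deriveB (dF u0) dln.
    by rewrite scaler0 add0r invfM.
  have dG (u : R) : u \in `]1, r[ -> is_derive u (1 : R)
      (fun u : R => F u - ln u / a) (h u - (a * u)^-1).
    by rewrite in_itv/= => /andP[u1 _]; apply: dG0; exact: lt_trans u1.
  have cG : {within `[1, r], continuous (fun u : R => F u - ln u / a)}.
    apply: continuous_in_subspaceT => u; rewrite inE/= in_itv/= => /andP[u1 _].
    by apply: is_derive_continuous (dG0 u _); exact: lt_le_trans u1.
  have [u + e] := MVT r1 dG cG; rewrite in_itv/= => /andP[u1 _].
  have := ha u (ltW u1); rewrite -subr_ge0 => hu.
  have : 0 <= (h u - (a * u)^-1) * (r - 1) by rewrite mulr_ge0// subr_ge0 ltW.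
  by rewrite -e ln1 mul0r subr0; lra.
(* Chosen so that the exponent reaches |y / rho0| at e^L, after which e^x > x suffices; the maximum
   with 1 keeps e^L above 1, where the growth estimate holds. *)
pose L := Num.max 1 (a * (`|y / rho0| - F 1)).
exists (expR L); first exact: expR_gt0.
have L1 : 1 < expR L by rewrite expR_gt1 lt_max ltr01.
have := grow _ L1; rewrite expRK => hF.
have h1 : `|y / rho0| <= F (expR L).
  apply: le_trans hF; rewrite -lerBlDl ler_pdivlMr// mulrC le_max lexx orbT//.
change (y < rho0 * expR (F (expR L))); rewrite mulrC -ltr_pdivrMr//.
apply: (le_lt_trans (ler_norm _)); apply: (le_lt_trans h1).
by rewrite (lt_le_trans _ (expR_ge1Dx _))// ltrDr.
Qed.

Lemma area_radius_spec (rho : R) : rho0 < rho ->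
  0 < area_radius NG c zeta Q M rho0 rho /\ I (area_radius NG c zeta Q M rho0 rho) = rho.
Proof.
exact: (increasing_inverse_spec is_derive_iso_radius
  (fun r r0 => mulr_gt0 (iso_radius_gt0 r) (isotropic_integrand_gt0 r0))
  cvg_iso_radius iso_radius_unbounded).
Qed.

Hypothesis al_smooth : forall (n : nat) (r : R), 0 < r -> derivable (derive1n n al) r 1.
Let rad := area_radius NG c zeta Q M rho0.
Let dI_gt0 (r : R) : 0 < r -> 0 < I r * h r.
Proof. by move=> r0; rewrite mulr_gt0 ?iso_radius_gt0 ?isotropic_integrand_gt0. Qed.

Lemma radial_profile_area_radius :
  radial_profile rho0 S (lapse2' al) (lapse2'' al) (lapse2''' al) rad.
Proof.
split.
- by move=> r _; exact: expR_gt0.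
- exact: is_derive_lapse2.
- exact: is_derive_lapse2'.
- exact: is_derive_lapse2''.
- exact: continuous_lapse2'''.
- by move=> rho /area_radius_spec[].
- move=> rho rr; have [r0 e] := area_radius_spec rr.
  have := is_derive_increasing_inverse is_derive_iso_radius dI_gt0 cvg_iso_radius
    iso_radius_unbounded rr.
  rewrite -/rad e isotropic_integrandE//.
  have rho_gt0 : 0 < rho by exact: lt_trans rr.
  have s0 : 0 < Num.sqrt (S (rad rho)) by rewrite sqrtr_gt0 S_gt0.
  rewrite (_ : (rho / (rad rho * Num.sqrt (S (rad rho))))^-1 =
    rad rho * Num.sqrt (S (rad rho)) / rho)//.
  by rewrite invf_div.
Qed.

Lemma regular_center_area_radius :
  regular_center rho0 S (lapse2' al) (lapse2'' al) rad.
Proof.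
split.
- exact: (lapse2_center_bound NG_gt0 c_gt0 adm Q_neq0 al_smooth naked m0P).
- exact: (increasing_inverse_bound is_derive_iso_radius dI_gt0 cvg_iso_radius
    iso_radius_unbounded).
- exact: (cvg_increasing_inverse is_derive_iso_radius dI_gt0 cvg_iso_radius
    iso_radius_unbounded).
Qed.

(** Brings the metric into the form of the abstract profile: the fourth power of the conformal
    factor is r^2 / |x|^2, and e^(2 gamma) is the square of sqrt S. *)
Lemma electrostatic_metricE (x : 'rV[R]_4) : exterior rho0 x ->
  electrostatic_metric NG c zeta Q M rho0 x =
  \matrix_(i, j) if i != j then 0
    else if i == 0 then - (c ^+ 2 * Num.sqrt (S (rad (space_norm x))) ^+ 2)
    else rad (space_norm x) ^+ 2 * (sqnorm x)^-1.
Proof.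
move=> hx; have x0 : 0 < space_norm x by exact: lt_trans hx.
have [r0 _] := area_radius_spec hx.
apply/matrixP => i j; rewrite !mxE; case: ifP => // _; case: ifP => // _.
  by rewrite sqr_sqrtr ?ltW ?S_gt0// mulNr mulrC.
rewrite /conf_factor (exprM _ 2 2) sqr_sqrtr ?divr_ge0 ?(ltW r0) ?(ltW x0)//.
by rewrite expr_div_n space_norm_sqr.
Qed.

End isotropic_radius.

Unset Implicit Arguments.

Theorem theorem1p2 (R : realType) (NG c : R) (hNG : 0 < NG) (hc : 0 < c)
    (zeta : R -> R) (hzeta : admissible zeta)
    (Q M : R) (hQ : Q != 0)
    (rho0 : R) (hrho0 : 0 < rho0)
    (g F : 'rV[R]_4 -> 'M[R]_4)
    (hgF : electrostatic_spacetime NG c zeta Q M rho0 g F)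
    (m0 : R) (hm0 : mass c zeta Q M r @[r --> 0^'+] --> m0) (hm0_neg : m0 < 0)
    (hnaked : forall r : R, 0 < r ->
       0 < 1 - 2 * NG * mass c zeta Q M r / (c ^+ 2 * r)) :
  weak_bianchi g rho0.
Proof.
have [al_smooth gE _] := hgF.
move=> psi psi_smooth psi_supp.
apply: (weak_bianchi_radial_field hrho0 hc
  (radial_profile_area_radius hNG hc hzeta hQ hnaked hm0 hm0_neg hrho0 al_smooth)
  (regular_center_area_radius hNG hc hzeta hQ hnaked hm0 hm0_neg hrho0 al_smooth)) => //.
move=> x hx; rewrite gE//.
exact: (electrostatic_metricE hNG hc hzeta hQ hnaked hm0 hm0_neg hrho0 hx).
Qed.
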